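(* Let \[ s(z;\tau)=\sum_{n\geq 0}r_2(n)\,J_0(2\pi\sqrt{n}\,z)\,e^{\pi i n\tau}\qquad(\tau\in\mathbb H,\ z\in\mathbb C). \] Then $s$ has the expansion in powers of $z$ \[ s(z;\tau)=\theta(\tau)^2\exp\!\big(A(\tau)z^2\big)\sum_{n\geq 0}f_n(\tau)z^{2n}, \] where for every $n\ge 0$ the function $f_n(\tau)$ is a modular form of weight $2n$ with respect to $\Gamma(2)$, given explicitly by $f_n(\tau)=\pi^{2n}x(\tau)^n p_n(u(\tau))$. Here $p_n(u)$ are polynomials with rational coefficients determined by $p_{-1}(u)=0$, $p_0(u)=1$ and \[ (n+1)^2p_{n+1}(u)+p_n'(u)(u^2-u)-nu\,p_n(u)+\frac{u\,p_{n-1}(u)}{4}=0\qquad (n\geq 0). \]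
   Context: $\mathbb H=\{\tau\in\mathbb C:\mathrm{Im}\,\tau>0\}$. $r_2(n)=\#\{(a,b)\in\mathbb Z^2:a^2+b^2=n\}$. $J_0$ is the Bessel function, $J_0(2\sqrt{x})=\sum_{n\ge0}\frac{(-1)^nx^n}{n!^2}$ (an entire function of $x$, so $J_0(2\pi\sqrt n z)$ is unambiguous). $\theta(\tau)=\sum_{n\in\mathbb Z}e^{\pi i n^2\tau}$, $x(\tau)=-\big(\sum_{n\in\mathbb Z}(-1)^ne^{\pi i n^2\tau}\big)^4$, $y(\tau)=\big(\sum_{n\in\mathbb Z+\frac12}e^{\pi i n^2\tau}\big)^4$, $u(\tau)=y(\tau)/x(\tau)$. $t(\tau)=\frac{1}{2\pi i}\frac{\partial\log\theta(\tau)}{\partial\tau}$ and $A(\tau)=-4\pi^2t(\tau)=2\pi i\frac{\partial \log\theta}{\partial\tau}$. $\Gamma(2)=\{\gamma\in SL(2,\mathbb Z):\gamma\equiv I\pmod 2\}$. A modular form of weight $k$ for $\Gamma(2)$ is a holomorphic $f:\mathbb H\to\mathbb C$ with $f(\frac{a\tau+b}{c\tau+d})=(c\tau+d)^kf(\tau)$ for all $\begin{pmatrix}a&b\\c&d\end{pmatrix}\in\Gamma(2)$ and such that for every $r\in\mathbb Q$, $|f(r+iy)|$ grows at most polynomially in $y^{-1}$ as $y\to0^+$. *)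

(* Defs.v *)
From HB Require Import structures.
From mathcomp Require Import all_boot all_order all_algebra.
From mathcomp Require Import finmap.
From mathcomp Require Import all_classical all_reals all_analysis.
From mathcomp Require Import complex.

Set Implicit Arguments.
Unset Strict Implicit.
Unset Printing Implicit Defensive.

Import Order.TTheory GRing.Theory Num.Theory.
Import numFieldNormedType.Exports.

Local Open Scope classical_set_scope.
Local Open Scope ring_scope.

(* The complex numbers, presented as a [numClosedFieldType] so that the
   topology and the norm of a numeric field apply to them. *)
Definition Cplx (R : realType) : numClosedFieldType := R[i].

Section Defs.
Variable R : realType.
Local Notation C := (Cplx R).

Definition ofR (a : R) : C := a%:C%C.
Definition reC (z : C) : R := complex.Re z.
Definition imC (z : C) : R := complex.Im z.

Definition piC : C := ofR pi.

Definition expC (z : C) : C :=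
  ofR (expR (reC z)) * (ofR (cos (imC z)) + 'i * ofR (sin (imC z))).

(* [Negz k] is the integer [- k.+1]. *)
Definition sumZ (u : int -> C) : C :=
  limn (series (fun k => u (Posz k))) + limn (series (fun k => u (Negz k))).

Definition upper_half_plane : set C := [set tau | 0 < imC tau].

Definition r2 (n : nat) : nat :=
  #|` fset_set [set ab : int * int | ab.1 ^+ 2 + ab.2 ^+ 2 = n%:Z] |.

(* The defining series of [J_0 (2 * sqrt x)] with [x = (w / 2) ^+ 2]. *)
Definition besselJ0 (w : C) : C :=
  limn (series (fun k => (-1) ^+ k * (w / 2%:R) ^+ (2 * k) / (k`!%:R) ^+ 2)).

Definition theta (tau : C) : C :=
  sumZ (fun n => expC (piC * 'i * n%:~R ^+ 2 * tau)).

Definition xfun (tau : C) : C :=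
  - (sumZ (fun n => (-1) ^ n * expC (piC * 'i * n%:~R ^+ 2 * tau))) ^+ 4.

(* Half-integers are written [m + 1/2] with [m : int]. *)
Definition yfun (tau : C) : C :=
  (sumZ (fun m => expC (piC * 'i * (m%:~R + 2%:R^-1) ^+ 2 * tau))) ^+ 4.

Definition ufun (tau : C) : C := yfun tau / xfun tau.

(* The derivative of [log theta] is the logarithmic derivative, which does not
   depend on a choice of branch. *)
Definition tfun (tau : C) : C :=
  (2%:R * piC * 'i)^-1 * (derive1 theta tau / theta tau).

Definition Afun (tau : C) : C := - (4%:R * piC ^+ 2 * tfun tau).

Definition s_term (z tau : C) (n : nat) : C :=
  (r2 n)%:R * besselJ0 (2%:R * piC * ofR (Num.sqrt n%:R) * z)
    * expC (piC * 'i * n%:R * tau).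

Definition s (z tau : C) : C := limn (series (s_term z tau)).

Definition Gamma2 (g : 'M[int]_2) : Prop :=
  \det g = 1 /\
  forall i j, (g i j = (1%:M : 'M[int]_2) i j %[mod 2])%Z.

Definition modular_form_Gamma2 (k : nat) (f : C -> C) : Prop :=
  [/\ forall tau, upper_half_plane tau -> derivable f tau 1,
      forall (g : 'M[int]_2) (tau : C), Gamma2 g -> upper_half_plane tau ->
        f (((g 0 0)%:~R * tau + (g 0 1)%:~R)
             / ((g 1 0)%:~R * tau + (g 1 1)%:~R))
        = ((g 1 0)%:~R * tau + (g 1 1)%:~R) ^+ k * f tau
    & forall r : rat, exists (N : nat) (c : R), \forall y \near 0^'+,
        `|f (ratr r + 'i * ofR y)| <= ofR (c * (y^-1) ^+ N)].

(* The value at [n - 1], with the convention [p_(-1) = 0]. *)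
Definition prev_poly (p : nat -> {poly rat}) (n : nat) : {poly rat} :=
  if n is m.+1 then p m else 0.

Definition p_recurrence (p : nat -> {poly rat}) : Prop :=
  p 0%N = 1 /\
  forall n : nat,
    (n.+1%:R ^+ 2) *: p n.+1 + (p n)^`() * ('X ^+ 2 - 'X)
      - n%:R *: ('X * p n) + 4%:R^-1 *: ('X * prev_poly p n) = 0.

Definition f_coef (p : nat -> {poly rat}) (n : nat) (tau : C) : C :=
  piC ^+ (2 * n) * xfun tau ^+ n * (map_poly ratr (p n)).[ufun tau].

End Defs.

(* Main.v *)
(* The theta constants form, with A, a closed differential system: on the upper
   half plane, with ' standing for pi i d/dtau,
     x' = x (2 A + pi^2 y),  y' = y (2 A + pi^2 x),  A' = A^2 - pi^4 x y / 4.
   It follows from the duplication formulas of the theta constants, by iterating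
   tau |-> 2 tau and letting the imaginary part tend to infinity.

   The system is invariant under tau |-> - 1 / tau, so by uniqueness of its
   solutions the modularity of x and y only has to be checked at tau = i, where
   it follows from theta (i r) = r^(-1/2) theta (i / r). The latter is obtained
   as in Polya's note on theta functions: a sum of (zeta + zeta^-1)^(2m) over
   roots of unity is a sum of every l-th binomial coefficient, and both sides
   tend to theta series when m / l^2 converges. Gamma(2) is then reached by
   descent on the lower row of the matrix.

   Expanding the Bessel functions, s = sum_k c_k z^(2k) with
   c_k = (- pi^2)^k / k!^2 * sum over Z^2 of (a^2 + b^2)^k e^(pi i (a^2 + b^2) tau),
   so that c_0 = theta^2 and c_k' = (k + 1)^2 c_(k+1). Hence the coefficients of
   theta^(-2) exp (- A z^2) s satisfy a recurrence in which the differential system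
   turns c_k' into the recurrence that defines p_n. *)
Require Import Defs.
From HB Require Import structures.
From mathcomp Require Import all_boot all_order all_algebra.
From mathcomp Require Import finmap.
From mathcomp Require Import all_classical all_reals all_analysis.
From mathcomp Require Import complex.
From mathcomp Require Import ring lra.
From mathcomp Require Import zify.

Set Implicit Arguments.
Unset Strict Implicit.
Unset Printing Implicit Defensive.

Import Order.TTheory GRing.Theory Num.Theory.
Import numFieldNormedType.Exports.

Local Open Scope classical_set_scope.
Local Open Scope ring_scope.

(** * Complex numbers as pairs of reals *)

Section Basics.
Variable R : realType.
Local Notation C := (Cplx R).
Implicit Types (z w : C) (a b : R).

Lemma ofR_zmod_morphism : zmod_morphism (@ofR R).
Proof. by move=> a b; rewrite /ofR rmorphB. Qed.
Lemma ofR_monoid_morphism : monoid_morphism (@ofR R).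
Proof. by split=> [|a b]; rewrite /ofR ?rmorph1 ?rmorphM. Qed.
HB.instance Definition _ := GRing.isZmodMorphism.Build R C (@ofR R) ofR_zmod_morphism.
HB.instance Definition _ := GRing.isMonoidMorphism.Build R C (@ofR R) ofR_monoid_morphism.
Lemma reC_zmod_morphism : zmod_morphism (@reC R).
Proof. by case=> a b [c d]. Qed.
Lemma imC_zmod_morphism : zmod_morphism (@imC R).
Proof. by case=> a b [c d]. Qed.
HB.instance Definition _ := GRing.isZmodMorphism.Build C R (@reC R) reC_zmod_morphism.
HB.instance Definition _ := GRing.isZmodMorphism.Build C R (@imC R) imC_zmod_morphism.

Lemma ofRD a b : ofR (a + b) = ofR a + ofR b. Proof. exact: rmorphD. Qed.
Lemma ofRN a : ofR (- a) = - ofR a. Proof. exact: rmorphN. Qed.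
Lemma ofRB a b : ofR (a - b) = ofR a - ofR b. Proof. exact: rmorphB. Qed.
Lemma ofRM a b : ofR (a * b) = ofR a * ofR b. Proof. exact: rmorphM. Qed.
Lemma ofRV a : ofR (a^-1) = (ofR a)^-1. Proof. exact: fmorphV. Qed.
Lemma ofRX a n : ofR (a ^+ n) = ofR a ^+ n. Proof. exact: rmorphXn. Qed.
Lemma ofR0 : ofR 0 = 0 :> C. Proof. exact: rmorph0. Qed.
Lemma ofR1 : ofR 1 = 1 :> C. Proof. exact: rmorph1. Qed.
Lemma ofR_nat n : ofR n%:R = n%:R :> C. Proof. exact: rmorph_nat. Qed.
Lemma ofR_int (n : int) : ofR n%:~R = n%:~R :> C. Proof. exact: rmorph_int. Qed.
Lemma ofR_sum (I : Type) (r : seq I) P (F : I -> R) :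
  ofR (\sum_(i <- r | P i) F i) = \sum_(i <- r | P i) ofR (F i).
Proof. exact: rmorph_sum. Qed.

Lemma Cplx_eq z w : reC z = reC w -> imC z = imC w -> z = w.
Proof. by case: z w => a b [c d] /= -> ->. Qed.
Lemma reC_ofR a : reC (ofR a) = a. Proof. by []. Qed.
Lemma imC_ofR a : imC (ofR a) = 0. Proof. by []. Qed.
Lemma ofR_inj : injective (@ofR R). Proof. by move=> a b []. Qed.
Lemma reCD z w : reC (z + w) = reC z + reC w. Proof. exact: raddfD. Qed.
Lemma imCD z w : imC (z + w) = imC z + imC w. Proof. exact: raddfD. Qed.
Lemma reCB z w : reC (z - w) = reC z - reC w. Proof. exact: raddfB. Qed.
Lemma imCB z w : imC (z - w) = imC z - imC w. Proof. exact: raddfB. Qed.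
Lemma reCN z : reC (- z) = - reC z. Proof. exact: raddfN. Qed.
Lemma imCN z : imC (- z) = - imC z. Proof. exact: raddfN. Qed.
Lemma reC_sum (I : Type) (r : seq I) P (F : I -> C) :
  reC (\sum_(i <- r | P i) F i) = \sum_(i <- r | P i) reC (F i).
Proof. exact: raddf_sum. Qed.
Lemma imC_sum (I : Type) (r : seq I) P (F : I -> C) :
  imC (\sum_(i <- r | P i) F i) = \sum_(i <- r | P i) imC (F i).
Proof. exact: raddf_sum. Qed.
Lemma reCM z w : reC (z * w) = reC z * reC w - imC z * imC w.
Proof. by case: z w => a b [c d]. Qed.
Lemma imCM z w : imC (z * w) = reC z * imC w + imC z * reC w.
Proof. by case: z w => a b [c d]. Qed.
Lemma reCi : reC ('i : C) = 0. Proof. by []. Qed.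
Lemma imCi : imC ('i : C) = 1. Proof. by []. Qed.
Lemma reC_ofRM a z : reC (ofR a * z) = a * reC z.
Proof. by rewrite reCM imC_ofR mul0r subr0. Qed.
Lemma imC_ofRM a z : imC (ofR a * z) = a * imC z.
Proof. by rewrite imCM imC_ofR mul0r addr0. Qed.
Lemma Cplx_dec z : z = ofR (reC z) + 'i * ofR (imC z).
Proof.
by apply: Cplx_eq; rewrite ?reCD ?imCD ?reCM ?imCM reCi imCi !reC_ofR !imC_ofR; ring.
Qed.

Lemma ler_ofR a b : (ofR a <= ofR b) = (a <= b).
Proof. exact: lecR. Qed.
Lemma ltr_ofR a b : (ofR a < ofR b) = (a < b).
Proof. exact: ltcR. Qed.

Definition normR z : R := Num.sqrt (reC z ^+ 2 + imC z ^+ 2).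
Lemma normRE z : `|z| = ofR (normR z).
Proof. exact: normc_def. Qed.
Lemma normR_ge0 z : 0 <= normR z. Proof. exact: sqrtr_ge0. Qed.
Lemma normRM z w : normR (z * w) = normR z * normR w.
Proof. by apply: ofR_inj; rewrite ofRM -!normRE normrM. Qed.
Lemma normRD z w : normR (z + w) <= normR z + normR w.
Proof. by rewrite -ler_ofR ofRD -!normRE ler_normD. Qed.
Lemma normRN z : normR (- z) = normR z.
Proof. by apply: ofR_inj; rewrite -!normRE normrN. Qed.
Lemma normRB z w : normR (z - w) <= normR z + normR w.
Proof. by rewrite -[normR w]normRN normRD. Qed.
Lemma normR_subC z w : normR (z - w) = normR (w - z).
Proof. by rewrite -normRN opprB. Qed.
Lemma normR0 : normR 0 = 0.
Proof. by apply: ofR_inj; rewrite -!normRE normr0 ofR0. Qed.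
Lemma normR1 : normR 1 = 1.
Proof. by apply: ofR_inj; rewrite -!normRE normr1 ofR1. Qed.
Lemma normR_eq0 z : (normR z == 0) = (z == 0).
Proof. by rewrite -[z == 0]normr_eq0 normRE -ofR0 (inj_eq (@ofR_inj)). Qed.
Lemma normR_gt0 z : (0 < normR z) = (z != 0).
Proof. by rewrite lt0r normR_eq0 normR_ge0 andbT. Qed.
Lemma normRX z n : normR (z ^+ n) = normR z ^+ n.
Proof. by apply: ofR_inj; rewrite ofRX -!normRE normrX. Qed.
Lemma normRV z : normR (z^-1) = (normR z)^-1.
Proof. by apply: ofR_inj; rewrite ofRV -!normRE normfV. Qed.
Lemma normR_ofR a : normR (ofR a) = `|a|.
Proof. by rewrite /normR reC_ofR imC_ofR expr0n addr0 sqrtr_sqr. Qed.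
Lemma normR_nat n : normR n%:R = n%:R.
Proof. by apply: ofR_inj; rewrite -normRE normr_nat ofR_nat. Qed.
Lemma normRi : normR 'i = 1.
Proof. by rewrite /normR reCi imCi expr0n add0r expr1n sqrtr1. Qed.
Lemma normR_sum (I : Type) (r : seq I) (F : I -> C) :
  normR (\sum_(i <- r) F i) <= \sum_(i <- r) normR (F i).
Proof.
elim/big_ind2: _ => //; first by rewrite normR0.
by move=> z a w b hz hw; exact: le_trans (normRD _ _) (lerD hz hw).
Qed.
Lemma ler_reC z : `|reC z| <= normR z.
Proof. by rewrite -sqrtr_sqr ler_sqrt ?lerDl ?addr_ge0 ?sqr_ge0. Qed.
Lemma ler_imC z : `|imC z| <= normR z.
Proof. by rewrite -sqrtr_sqr ler_sqrt ?lerDr ?addr_ge0 ?sqr_ge0. Qed.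
Lemma sqr_normR z : normR z ^+ 2 = reC z ^+ 2 + imC z ^+ 2.
Proof. by rewrite sqr_sqrtr// addr_ge0// sqr_ge0. Qed.

Lemma lt0_ofR (e : C) : 0 < e -> exists2 d : R, 0 < d & e = ofR d.
Proof.
case: e => a b; rewrite ltcE /= => /andP[/eqP -> ha]; exists a => //.
Qed.
Lemma ltr_norm_ofR z a : (`|z| < ofR a) = (normR z < a).
Proof. by rewrite normRE ltr_ofR. Qed.

Lemma cvgCP (T : Type) (F : set_system T) {FF : Filter F} (f : T -> C) (l : C) :
  (f @ F --> l) <-> (forall e : R, 0 < e -> \forall x \near F, normR (f x - l) < e).
Proof.
split=> [/cvgrPdist_lt h e e0|h].
  have := h (ofR e); rewrite -ofR0 ltr_ofR => /(_ e0).
  by apply: filterS => x; rewrite ltr_norm_ofR normR_subC.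
apply/cvgrPdist_lt => e /lt0_ofR[d d0 ->].
by have := h d d0; apply: filterS => x; rewrite ltr_norm_ofR normR_subC.
Qed.
Lemma cvgC_reP (T : Type) (F : set_system T) {FF : Filter F} (f : T -> C) (l : C) :
  (f @ F --> l) <-> ((fun x => normR (f x - l)) @ F --> (0 : R)).
Proof.
rewrite cvgCP; split=> h.
  apply/cvgrPdist_lt => e e0; have := h e e0; apply: filterS => x.
  by rewrite sub0r normrN ger0_norm ?normR_ge0.
move=> e e0; move/cvgrPdist_lt : h => /(_ e e0); apply: filterS => x.
by rewrite sub0r normrN ger0_norm ?normR_ge0.
Qed.
Lemma cvg_ofR (T : Type) (F : set_system T) {FF : Filter F} (f : T -> R) (l : R) :
  f @ F --> l -> (fun x => ofR (f x)) @ F --> ofR l.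
Proof.
move=> /cvgrPdist_lt h; apply/cvgCP => e e0; have := h e e0; apply: filterS => x.
by rewrite -ofRB normR_ofR distrC.
Qed.
Lemma cvg_reC (T : Type) (F : set_system T) {FF : Filter F} (f : T -> C) (l : C) :
  f @ F --> l -> (fun x => reC (f x)) @ F --> reC l.
Proof.
move=> /cvgCP h; apply/cvgrPdist_lt => e e0; have := h e e0; apply: filterS => x.
by apply: le_lt_trans; rewrite -reCB normR_subC; apply: ler_reC.
Qed.
Lemma cvg_imC (T : Type) (F : set_system T) {FF : Filter F} (f : T -> C) (l : C) :
  f @ F --> l -> (fun x => imC (f x)) @ F --> imC l.
Proof.
move=> /cvgCP h; apply/cvgrPdist_lt => e e0; have := h e e0; apply: filterS => x.
by apply: le_lt_trans; rewrite -imCB normR_subC; apply: ler_imC.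
Qed.
Lemma cvg_normR (T : Type) (F : set_system T) {FF : Filter F} (f : T -> C) (l : C) :
  f @ F --> l -> (fun x => normR (f x)) @ F --> normR l.
Proof.
move=> /cvgCP h; apply/cvgrPdist_lt => e e0; have := h e e0; apply: filterS => x.
have h1 := normRD (f x - l) l; have h2 := normRD (l - f x) (f x).
rewrite !subrK normR_subC in h1 h2.
by apply: le_lt_trans; rewrite normR_subC ler_norml; apply/andP; split; lra.
Qed.
Lemma cvg_sumC (T I : Type) (F : set_system T) {FF : Filter F} (r : seq I)
  (f : I -> T -> C) (l : I -> C) : (forall i, f i @ F --> l i) ->
  (fun x => \sum_(i <- r) f i x) @ F --> \sum_(i <- r) l i.
Proof.
move=> h; elim: r => [|i r IH].
  by rewrite big_nil; under eq_fun do rewrite big_nil; exact: cvg_cst.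
by rewrite big_cons; under eq_fun do rewrite big_cons; exact: (cvgD (h i) IH).
Qed.
End Basics.
Arguments ofR : simpl never.
Arguments reC : simpl never.
Arguments imC : simpl never.
Arguments normR : simpl never.

(** * Unordered sums *)

Section Fins.
Variable T : choiceType.
Definition fins : set_system {fset T} :=
  filter_from setT (fun A => [set B | (A `<=` B)%fset]).

Global Instance fins_filter : ProperFilter fins.
Proof.
eapply filter_from_proper; last by move=> A _; exists A; rewrite /= fsubset_refl.
apply: filter_fromT_filter; first by exists fset0.
by move=> A B /=; exists (A `|` B)%fset => P /=; rewrite fsubUset => /andP[].
Qed.

Lemma big_fsetDr (V : nmodType) (A B : {fset T}) (f : T -> V) : (A `<=` B)%fset ->
  \sum_(i <- B) f i = \sum_(i <- A) f i + \sum_(i <- (B `\` A)%fset) f i.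
Proof.
move=> AB; rewrite -big_cat; apply: perm_big; apply: uniq_perm.
- exact: fset_uniq.
- rewrite cat_uniq !fset_uniq andbT /=; apply/hasPn => x.
  by rewrite !inE => /andP[].
- move=> x; rewrite mem_cat !inE; case xA: (x \in A) => //=.
  by rewrite (fsubsetP AB).
Qed.

Lemma ler_fsum (R : realType) (A B : {fset T}) (g : T -> R) : (forall i, 0 <= g i) ->
  (A `<=` B)%fset -> \sum_(i <- A) g i <= \sum_(i <- B) g i.
Proof. by move=> g0 AB; rewrite (big_fsetDr _ AB) lerDl; apply: sumr_ge0. Qed.

End Fins.
Arguments fins T : clear implicits.

Section Sums.
Variable R : realType.
Local Notation C := (Cplx R).

Variant hasum (T : choiceType) (f : T -> C) (s : C) : Prop :=
  HasSum of (fun A : {fset T} => \sum_(i <- A) f i) @ fins T --> s.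
Definition tsum (T : choiceType) (f : T -> C) : C :=
  lim ((fun A : {fset T} => \sum_(i <- A) f i) @ fins T).
Definition asum (T : choiceType) (f : T -> C) :=
  exists M : R, forall A : {fset T}, \sum_(i <- A) normR (f i) <= M.

Section OneType.
Variable T : choiceType.
Implicit Types (f g : T -> C) (s t : C).

Lemma hasumP f s : hasum f s <-> forall e : R, 0 < e ->
  exists A : {fset T}, forall B : {fset T}, (A `<=` B)%fset -> normR (\sum_(i <- B) f i - s) < e.
Proof.
split=> [[/cvgCP h] e e0|h]; first by have [A _ hA] := h e e0; exists A => B /hA.
by split; apply/cvgCP => e e0; have [A hA] := h e e0; exists A.
Qed.

Lemma hasum_tsum f s : hasum f s -> tsum f = s.
Proof. by case=> h; apply: cvg_lim => //; exact: norm_hausdorff. Qed.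

Lemma hasumD f g s t : hasum f s -> hasum g t -> hasum (fun i => f i + g i) (s + t).
Proof.
move=> [hf] [hg]; split; under eq_fun do rewrite big_split /=.
exact: (cvgD hf hg).
Qed.

Lemma hasumMl f s c : hasum f s -> hasum (fun i => c * f i) (c * s).
Proof.
move=> [hf]; split; under eq_fun do rewrite -big_distrr /=.
exact: (cvgM (cvg_cst c) hf).
Qed.

Lemma hasumN f s : hasum f s -> hasum (fun i => - f i) (- s).
Proof.
move=> [hf]; split; under eq_fun do rewrite sumrN.
exact: (cvgN hf).
Qed.

Lemma hasumB f g s t : hasum f s -> hasum g t -> hasum (fun i => f i - g i) (s - t).
Proof. by move=> hf hg; exact: (hasumD hf (hasumN hg)). Qed.

Lemma eq_hasum f g s : f =1 g -> hasum f s -> hasum g s.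
Proof. by move=> /funext ->. Qed.

Lemma hasum_ge0 (g : T -> R) M : (forall i, 0 <= g i) ->
  (forall A : {fset T}, \sum_(i <- A) g i <= M) ->
  exists s : R, [/\ hasum (fun i => ofR (g i)) (ofR s),
    forall A : {fset T}, \sum_(i <- A) g i <= s & s <= M].
Proof.
move=> g0 gM; pose S := [set x | exists A : {fset T}, x = \sum_(i <- A) g i].
have hS : has_sup S.
  split; first by exists (\sum_(i <- fset0) g i); exists fset0.
  by exists M => x [A ->].
have ub A : \sum_(i <- (A : {fset T})) g i <= sup S.
  by apply: sup_upper_bound => //; exists A.
exists (sup S); split=> //.
  apply/hasumP => e e0; have [x [A ->] hA] := sup_adherent e0 hS.
  exists A => B AB; rewrite -ofR_sum -ofRB normR_ofR ler0_norm ?subr_le0//.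
  have := ler_fsum g0 AB; lra.
by apply: ge_sup; [case: hS | move=> x [A ->]].
Qed.

Lemma asum_ge0_hasum (g : T -> R) (s : R) : (forall i, 0 <= g i) ->
  hasum (fun i => ofR (g i)) (ofR s) -> forall A : {fset T}, \sum_(i <- A) g i <= s.
Proof.
move=> g0 /hasumP h A; apply/ler_addgt0Pl => e e0; have [B hB] := h e e0.
have := hB (A `|` B)%fset (fsubsetUr _ _).
rewrite -ofR_sum -ofRB normR_ofR ltr_norml => /andP[_ h2].
have := ler_fsum g0 (fsubsetUl A B); lra.
Qed.

Lemma asum_hasum f : asum f -> exists s, hasum f s.
Proof.
move=> [M hM].
have [n [hn _ _]] := hasum_ge0 (fun i => normR_ge0 (f i)) hM.
have bnd (h : C -> R) : (forall z, `|h z| <= normR z) ->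
    exists s : R, hasum (fun i => ofR (h (f i))) (ofR s).
  move=> hh.
  have [||s [hs _ _]] := @hasum_ge0 (fun i => h (f i) + normR (f i)) (2 * M).
  - by move=> i; have := hh (f i); rewrite ler_norml; lra.
  - move=> A; rewrite big_split /=; have := hM A.
    have : \sum_(i <- A) h (f i) <= \sum_(i <- A) normR (f i).
      by apply: ler_sum => i _; have := hh (f i); rewrite ler_norml; lra.
    lra.
  exists (s - n); rewrite ofRB; apply: eq_hasum (hasumB hs hn) => i.
  by rewrite -ofRB addrK.
have [a ha] := bnd _ (@ler_reC R); have [b hb] := bnd _ (@ler_imC R).
exists (ofR a + 'i * ofR b); apply: eq_hasum (hasumD ha (hasumMl 'i hb)) => i.
by rewrite [RHS]Cplx_dec.
Qed.

Lemma asum_tsum f : asum f -> hasum f (tsum f).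
Proof. by move=> /asum_hasum[s hs]; rewrite (hasum_tsum hs). Qed.

Lemma asum_le f g : (forall i, normR (f i) <= normR (g i)) -> asum g -> asum f.
Proof.
move=> h [M hM]; exists M => A; apply: le_trans (hM A).
exact: ler_sum.
Qed.

Lemma asumMl f c : asum f -> asum (fun i => c * f i).
Proof.
move=> [M hM]; exists (normR c * M) => A; under eq_bigr do rewrite normRM.
by rewrite -big_distrr /= ler_wpM2l ?normR_ge0.
Qed.

Lemma asumD f g : asum f -> asum g -> asum (fun i => f i + g i).
Proof.
move=> [M hM] [N hN]; exists (M + N) => A; apply: le_trans (lerD (hM A) (hN A)).
by rewrite -big_split; apply: ler_sum => i _; exact: normRD.
Qed.

Lemma asumN f : asum f -> asum (fun i => - f i).
Proof. by apply: asum_le => i; rewrite normRN. Qed.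

Lemma eq_asum f g : f =1 g -> asum f -> asum g.
Proof. by move=> /funext ->. Qed.

Lemma hasum_norm_le f s (M : R) : hasum f s ->
  (forall A : {fset T}, \sum_(i <- A) normR (f i) <= M) -> normR s <= M.
Proof.
move=> /hasumP h hM; apply/ler_addgt0Pl => e e0; have [A hA] := h e e0.
have h1 := hA A (fsubset_refl _).
have h2 := normRB (\sum_(i <- A) f i) (\sum_(i <- A) f i - s).
rewrite opprB addrCA subrr addr0 in h2.
have := le_trans (normR_sum A f) (hM A); lra.
Qed.

Lemma tsum_norm_le f (g : T -> R) (t : R) : asum f -> (forall i, normR (f i) <= g i) ->
  hasum (fun i => ofR (g i)) (ofR t) -> normR (tsum f) <= t.
Proof.
move=> hf fg hg; apply: hasum_norm_le (asum_tsum hf) _ => A.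
apply: le_trans (_ : \sum_(i <- A) g i <= _); first exact: ler_sum.
by apply: asum_ge0_hasum => // i; exact: le_trans (normR_ge0 _) (fg i).
Qed.

Lemma asum_tail f (e : R) : asum f -> 0 < e ->
  exists A : {fset T}, forall B : {fset T}, (A `<=` B)%fset ->
    \sum_(i <- (B `\` A)%fset) normR (f i) < e.
Proof.
move=> [M hM] e0; have [s [/hasumP/(_ e e0) [A hA] hs _]] := hasum_ge0 (fun i => normR_ge0 (f i)) hM.
exists A => B AB; have h1 := hA A (fsubset_refl _); have h2 := hs B.
rewrite (big_fsetDr _ AB) in h2.
rewrite -ofR_sum -ofRB normR_ofR ltr_norml in h1; lra.
Qed.

Lemma tsumD f g : asum f -> asum g -> tsum (fun i => f i + g i) = tsum f + tsum g.
Proof. by move=> hf hg; apply: hasum_tsum; apply: hasumD; apply: asum_tsum. Qed.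
Lemma tsumN f : asum f -> tsum (fun i => - f i) = - tsum f.
Proof. by move=> hf; apply: hasum_tsum; apply: hasumN; apply: asum_tsum. Qed.
Lemma tsumB f g : asum f -> asum g -> tsum (fun i => f i - g i) = tsum f - tsum g.
Proof. by move=> hf hg; apply: hasum_tsum; apply: hasumB; apply: asum_tsum. Qed.
Lemma tsumMl f c : asum f -> tsum (fun i => c * f i) = c * tsum f.
Proof. by move=> hf; apply: hasum_tsum; apply: hasumMl; apply: asum_tsum. Qed.

Lemma hasum_finite f (A : {fset T}) : (forall i, i \notin A -> f i = 0) ->
  hasum f (\sum_(i <- A) f i).
Proof.
move=> h; apply/hasumP => e e0; exists A => B AB.
have h0 : \sum_(i <- (B `\` A)%fset) f i = 0.
  by rewrite big_seq big1// => i; rewrite !inE => /andP[/h].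
by rewrite (big_fsetDr _ AB) h0 addr0 subrr normR0.
Qed.

Lemma tannery (u : nat -> T -> C) f g : asum g ->
  (forall n i, normR (u n i) <= normR (g i)) ->
  (forall i, (fun n => u n i) @ \oo --> f i) ->
  asum f /\ (fun n => tsum (u n)) @ \oo --> tsum f.
Proof.
move=> hg hu hl.
have fg i : normR (f i) <= normR (g i).
  apply: (closed_cvg (fun x : R => x <= normR (g i))) (cvg_normR (hl i)).
    exact: closed_le.
  by apply: nearW => n; exact: hu.
have hf : asum f by apply: asum_le hg.
have hun n : asum (u n) by apply: asum_le hg.
split=> //; apply/cvgCP => e e0.
have e4 : 0 < e / 4 by lra.
have [A hA] := asum_tail hg e4.
have hfin : (fun n => \sum_(i <- A) u n i) @ \oo --> \sum_(i <- A) f i.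
  exact: cvg_sumC.
move/cvgCP : hfin => /(_ _ e4); apply: filterS => n hn.
rewrite -tsumB//; apply: le_lt_trans (_ : e * 3 / 4 < _); last by lra.
apply: le_trans (_ : normR (tsum (fun i => u n i - f i)) <= _) => //.
have /hasumP hs := asum_tsum (asumD (hun n) (asumN hf)).
apply/ler_addgt0Pl => d d0; have [B hB] := hs d d0.
have := hB (A `|` B)%fset (fsubsetUr _ _).
set S := \sum_(i <- _) _; set S' := tsum _ => hd.
have hS : normR S <= e * 3 / 4.
  rewrite /S (big_fsetDr _ (fsubsetUl A B)); apply: le_trans (normRD _ _) _.
  rewrite big_split sumrN /=; have := hA _ (fsubsetUl A B).
  have : normR (\sum_(i <- ((A `|` B) `\` A)%fset) (u n i - f i)) <=
     2 * \sum_(i <- ((A `|` B) `\` A)%fset) normR (g i).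
    apply: le_trans (normR_sum _ _) _; rewrite big_distrr /=; apply: ler_sum => i _.
    by apply: le_trans (normRB _ _) _; have := hu n i; have := fg i; lra.
  lra.
have := normRB S (S - S'); rewrite opprB addrCA subrr addr0; lra.
Qed.

End OneType.

Section TwoTypes.
Variables T U : choiceType.

Lemma tsum_eq (f g : T -> C) : f =1 g -> tsum f = tsum g.
Proof. by move=> /funext ->. Qed.

Lemma fset_preim (h : U -> T) (V : nmodType) (f : T -> V) (B : {fset T}) : injective h ->
  (forall t, (forall u, h u <> t) -> f t = 0) ->
  exists2 B' : {fset U}, forall u, (u \in B') = (h u \in B) &
    \sum_(i <- B) f i = \sum_(i <- B') f (h i).
Proof.
move=> hi h0.
have [B' hB'] : exists B' : {fset U}, forall u, (u \in B') = (h u \in B).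
  pose inv (t : T) : option U :=
    if pselect (exists u, h u = t) is left P then Some (proj1_sig (cid P)) else None.
  have invE u : inv (h u) = Some u.
    rewrite /inv; case: pselect => [P|[]]; last by exists u.
    by congr Some; apply: hi; case: (cid P).
  exists [fset u in pmap inv B]%fset => u; rewrite inE mem_pmap.
  apply/mapP/idP => [[t tB] |hu]; last by exists (h u); rewrite ?invE.
  by rewrite /inv; case: pselect => // P [->]; case: (cid P) => /= v ->.
exists B' => //.
have hBB : ([fset h u | u in B'] `<=` B)%fset.
  by apply/fsubsetP => t /imfsetP[u /= uB ->]; rewrite -hB'.
rewrite (big_fsetDr _ hBB) [X in _ + X](_ : _ = 0) ?addr0; last first.
  rewrite big_seq big1// => t; rewrite !inE => /andP[tn tB]; apply: h0 => u hu.
  by move/negP : tn; apply; apply/imfsetP; exists u; rewrite /= ?hB' ?hu.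
by rewrite big_imfset //= => x y _ _; exact: hi.
Qed.

Lemma hasum_reindex (h : U -> T) (f : T -> C) (s : C) : injective h ->
  (forall t, (forall u, h u <> t) -> f t = 0) ->
  hasum (fun u => f (h u)) s -> hasum f s.
Proof.
move=> hi h0 /hasumP H; apply/hasumP => e e0; have [A hA] := H e e0.
exists [fset h u | u in A]%fset => B hB.
have [B' hB' ->] := fset_preim B hi h0; apply: hA.
apply/fsubsetP => u uA; rewrite hB'; apply: (fsubsetP hB).
by apply/imfsetP; exists u.
Qed.

Lemma asum_inj (h : U -> T) (f : T -> C) : injective h -> asum f -> asum (fun u => f (h u)).
Proof.
move=> hi [M hM]; exists M => A; apply: le_trans (hM [fset h u | u in A]%fset).
by rewrite big_imfset //= => x y _ _; exact: hi.
Qed.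

Lemma tsum_reindex (h : U -> T) (f : T -> C) : injective h ->
  (forall t, (forall u, h u <> t) -> f t = 0) -> asum f ->
  tsum f = tsum (fun u => f (h u)).
Proof.
move=> hi h0 hf; apply: hasum_tsum; apply: hasum_reindex h0 _ => //.
exact/asum_tsum/asum_inj.
Qed.

Lemma hasum_fiber (p : T -> U) (f : T -> C) (s : C) (r : U -> C) : hasum f s ->
  (forall u, hasum (fun t => if p t == u then f t else 0) (r u)) -> hasum r s.
Proof.
move=> /hasumP hf hr; apply/hasumP => e e0; have e2 : 0 < e / 2 by lra.
have [F hF] := hf _ e2; exists (p @` F)%fset => W hW.
pose d := e / 2 / (#|` W|.+1)%:R.
have d0 : 0 < d by rewrite divr_gt0// ltr0n.
have /choice[G hG] : forall u : U, exists G : {fset T}, forall B : {fset T}, (G `<=` B)%fset ->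
    normR (\sum_(t <- B) (if p t == u then f t else 0) - r u) < d.
  by move=> u; have /hasumP/(_ d d0) := hr u.
pose B := (F `|` \bigcup_(u <- W) G u)%fset.
pose B' := [fset t in B | p t \in W]%fset.
have hB : (F `<=` B')%fset.
  apply/fsubsetP => t tF; rewrite !inE tF /=; apply: (fsubsetP hW).
  by apply/imfsetP; exists t.
have sumB : \sum_(t <- B') f t = \sum_(u <- W) \sum_(t <- B) (if p t == u then f t else 0).
  rewrite exchange_big /=.
  rewrite (perm_big [seq t <- B | p t \in W]) /=; last first.
    apply: uniq_perm; rewrite ?fset_uniq ?filter_uniq//.
    by move=> t; rewrite mem_filter in_fset /= inE andbC.
  rewrite big_filter big_mkcond; apply: eq_bigr => t _; case: ifPn => [ptW|ptW].
    rewrite (bigD1_seq (p t)) ?fset_uniq//= eqxx big1 ?addr0// => u /negPf.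
    by rewrite eq_sym => ->.
  rewrite big_seq big1// => u uW; case: eqP => // ptu.
  by rewrite -ptu (negPf ptW) in uW.
have h1 := hF _ hB; rewrite sumB in h1.
have h2 : normR (\sum_(u <- W) r u - \sum_(u <- W) \sum_(t <- B) (if p t == u then f t else 0)) <= e / 2.
  rewrite -sumrB; apply: le_trans (normR_sum _ _) _.
  apply: le_trans (_ : \sum_(u <- W) d <= _).
    rewrite big_seq [leRHS]big_seq; apply: ler_sum => u uW.
    rewrite normR_subC; apply/ltW/hG; rewrite /B.
    by apply: fsubsetU; apply/orP; right; exact: bigfcup_sup.
  rewrite big_const_seq count_predT iter_addr_0 -[d *+ _]mulr_natr [d * _]mulrAC.
  by rewrite ler_pdivrMr ?ltr0n//; apply: ler_wpM2l; [exact: ltW|rewrite ler_nat].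
have := normRD (\sum_(u <- W) r u - \sum_(u <- W) \sum_(t <- B) (if p t == u then f t else 0))
 (\sum_(u <- W) \sum_(t <- B) (if p t == u then f t else 0) - s).
by rewrite addrA subrK; lra.
Qed.

Lemma asum_fib (p : T -> U) (f : T -> C) u : asum f -> asum (fun t => if p t == u then f t else 0).
Proof. by apply: asum_le => t; case: ifP => // _; rewrite normR0 normR_ge0. Qed.

Lemma asum_fiber (p : T -> U) (f : T -> C) : asum f ->
  asum (fun u => tsum (fun t => if p t == u then f t else 0)).
Proof.
move=> hf; have hfu u := asum_fib p u hf.
have nn u : exists r : R, hasum (fun t => ofR (normR (if p t == u then f t else 0))) (ofR r : C).
  by have [M hM] := hfu u; have [r [hr _ _]] := hasum_ge0 (fun i => normR_ge0 _) hM; exists r.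
have [r hr] := choice nn.
have [M hM] := hf.
have [s [hs _ _]] := hasum_ge0 (fun i => normR_ge0 (f i)) hM.
have hrs : hasum (fun u => ofR (r u)) (ofR s : C).
  apply: (hasum_fiber (p := p) hs) => u; apply: eq_hasum (hr u) => t.
  by case: ifP => // _; rewrite normR0 ofR0.
have hle u : normR (tsum (fun t => if p t == u then f t else 0)) <= r u.
  by apply: tsum_norm_le (hfu u) _ (hr u).
exists s => A; apply: le_trans (_ : \sum_(u <- A) r u <= _); first exact: ler_sum.
apply: asum_ge0_hasum hrs A => u; exact: le_trans (normR_ge0 _) (hle u).
Qed.

Lemma tsum_fiber (p : T -> U) (f : T -> C) : asum f ->
  tsum f = tsum (fun u => tsum (fun t => if p t == u then f t else 0)).
Proof.
move=> hf; symmetry; apply: hasum_tsum; apply: (hasum_fiber (p := p) (asum_tsum hf)) => u.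
exact/asum_tsum/asum_fib.
Qed.

End TwoTypes.

Section Prod.
Variables T U : choiceType.

Lemma asum_pair (F : T * U -> C) (g : T -> C) :
  asum g -> (forall t (A : {fset U}), \sum_(u <- A) normR (F (t, u)) <= normR (g t)) -> asum F.
Proof.
move=> [M hM] h; exists M => A.
pose A1 := [fset x.1 | x in A]%fset; pose A2 := [fset x.2 | x in A]%fset.
have hA : (A `<=` [fset ((x, y) : (T * U)%type) | x in A1, y in A2])%fset.
  apply/fsubsetP => -[x y] hxy; apply/imfset2P; exists x; first by apply/imfsetP; exists (x, y).
  by exists y => //; apply/imfsetP; exists (x, y).
apply: le_trans (ler_fsum _ hA) _; first by move=> ?; exact: normR_ge0.
rewrite big_imfset2 /=; last first.
  by move=> [x y] [x' y'] /= _ _ [-> ->].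
by apply: le_trans (hM A1); apply: ler_sum => t _; exact: h.
Qed.

Lemma asum_row (F : T * U -> C) t : asum F -> asum (fun u => F (t, u)).
Proof. by apply: asum_inj => u v []. Qed.

Lemma tsum_pair (F : T * U -> C) : asum F ->
  asum (fun t => tsum (fun u => F (t, u))) /\ tsum F = tsum (fun t => tsum (fun u => F (t, u))).
Proof.
move=> hF.
have E t : tsum (fun x : T * U => if x.1 == t then F x else 0) = tsum (fun u => F (t, u)).
  rewrite (tsum_reindex (h := fun u => (t, u))) //=; first by apply: tsum_eq => u; rewrite eqxx.
  - by move=> u v [].
  - by move=> [x y] /= hxy; case: eqP => // e; case: (hxy y); rewrite e.
  - exact: (asum_fib fst).
split; first by have := asum_fiber fst hF; apply: eq_asum.
by rewrite (tsum_fiber fst hF); apply: tsum_eq.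
Qed.

Lemma asumM (f : T -> C) (g : U -> C) : asum f -> asum g -> asum (fun x => f x.1 * g x.2).
Proof.
move=> hf [M hM]; apply: (asum_pair (g := fun t => ofR M * f t)); first exact: asumMl.
move=> t A /=; under eq_bigr do rewrite normRM.
rewrite -big_distrr /= normRM normR_ofR mulrC ler_wpM2r ?normR_ge0//.
exact: le_trans (hM A) (ler_norm _).
Qed.

Lemma tsumM (f : T -> C) (g : U -> C) : asum f -> asum g ->
  tsum (fun x => f x.1 * g x.2) = tsum f * tsum g.
Proof.
move=> hf hg; have [_ ->] := tsum_pair (asumM hf hg).
under tsum_eq => t do rewrite /= tsumMl//.
by under tsum_eq => t do rewrite mulrC; rewrite tsumMl// mulrC.
Qed.
End Prod.

Lemma tsum_nat (f : nat -> C) : asum f -> series f @ \oo --> tsum f.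
Proof.
move=> /asum_tsum/hasumP h; apply/cvgCP => e e0; have [A hA] := h e e0.
exists (\max_(i <- A) i.+1)%N => // n /= hn.
have -> : series f n = \sum_(i <- [fset i | i in iota 0 n]%fset) f i.
  rewrite /series /= /index_iota subn0; apply: perm_big; apply: uniq_perm; rewrite ?iota_uniq ?fset_uniq//.
  by move=> x; rewrite !inE.
apply: hA; apply/fsubsetP => i iA; rewrite !inE mem_iota add0n leq0n /=.
by apply: leq_trans hn; rewrite (big_rem i) //= leq_maxl.
Qed.

Lemma sumZE (f : int -> C) : asum f -> sumZ f = tsum f.
Proof.
move=> hf; have hp : asum (fun k => f (Posz k)) by apply: asum_inj hf => ? ? [].
have hn : asum (fun k => f (Negz k)) by apply: asum_inj hf => ? ? [].
rewrite /sumZ (cvg_lim _ (tsum_nat hp)) ?(cvg_lim _ (tsum_nat hn)); try exact: norm_hausdorff.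
pose p (n : int) := if n is Posz _ then true else false.
rewrite (tsum_fiber p hf).
have E (b : bool) : tsum (fun t => if p t == b then f t else 0) =
    if b then tsum (fun k => f (Posz k)) else tsum (fun k => f (Negz k)).
  case: b.
    rewrite (tsum_reindex (h := Posz)) //; first by move=> ? ? [].
      by move=> [k|k] // hk; case: (hk k).
    exact: (asum_fib p).
  rewrite (tsum_reindex (h := Negz)) //; first by move=> ? ? [].
    by move=> [k|k] // hk; case: (hk k).
  exact: (asum_fib p).
pose g (b : bool) := if b then tsum (fun k => f (Posz k)) else tsum (fun k => f (Negz k)).
have hg : hasum g (\sum_(i <- [fset true; false]%fset) g i).
  by apply: hasum_finite => b; rewrite !inE; case: b.
rewrite big_fsetU1 ?inE //= big_seq_fset1 in hg.
by rewrite -[LHS](hasum_tsum hg); apply: tsum_eq => b; rewrite E.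
Qed.

End Sums.

(** * The complex exponential *)

Section Exp.
Variable R : realType.
Local Notation C := (Cplx R).
Implicit Types (z w : C).

Lemma asum_nat (f : nat -> C) (M : R) :
  (forall n, \sum_(0 <= k < n) normR (f k) <= M) -> asum f.
Proof.
move=> h; exists M => A; apply: le_trans (h (\max_(i <- A) i.+1)%N).
pose n := (\max_(i <- A) i.+1)%N.
have hA : (A `<=` [fset i | i in iota 0 n])%fset.
  apply/fsubsetP => i iA; rewrite !inE mem_iota add0n leq0n /=.
  by rewrite /n (big_rem i) //= leq_maxl.
apply: le_trans (ler_fsum _ hA) _; first by move=> i; exact: normR_ge0.
rewrite le_eqVlt; apply/orP; left; apply/eqP; rewrite /index_iota subn0; apply: perm_big; apply: uniq_perm; rewrite ?iota_uniq ?fset_uniq//.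
by move=> x; rewrite !inE.
Qed.

Lemma tsum_nat_lim (f : nat -> C) s : asum f -> series f @ \oo --> s -> tsum f = s.
Proof. by move=> /tsum_nat h1 h2; exact: (cvg_unique (@norm_hausdorff _ _) h1 h2). Qed.

Lemma cauchy_prod (f g : nat -> C) : asum f -> asum g ->
  asum (fun n => \sum_(k < n.+1) f k * g (n - k)%N) /\
  tsum f * tsum g = tsum (fun n => \sum_(k < n.+1) f k * g (n - k)%N).
Proof.
move=> hf hg; have hfg := asumM hf hg.
pose p (x : nat * nat) := (x.1 + x.2)%N.
have E n : tsum (fun x : nat * nat => if p x == n then f x.1 * g x.2 else 0) =
    \sum_(k < n.+1) f k * g (n - k)%N.
  have memL (L0 : seq (nat * nat)) x : (x \in [fset x in L0]%fset) = (x \in L0) by rewrite inE.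
  pose L := [seq ((k, n - k)%N : (nat * nat)%type) | k <- index_iota 0 n.+1].
  have hA : forall x, x \notin [fset x in L]%fset -> (if p x == n then f x.1 * g x.2 else 0) = 0.
    move=> [a b]; rewrite memL => xA; case: eqP => // e; case/negP : xA; apply/mapP.
    by exists a; rewrite ?mem_index_iota -e /p /= ?ltnS ?leq_addr ?addKn.
  rewrite (hasum_tsum (hasum_finite hA)) (perm_big L) /=; last first.
    apply: uniq_perm; rewrite ?fset_uniq ?map_inj_uniq ?iota_uniq//; last by move=> x; rewrite memL.
    by move=> a b [].
  rewrite big_map big_mkord; apply: eq_bigr => k _.
  by rewrite /p /= subnKC ?eqxx// -ltnS.
rewrite -(tsumM hf hg) (tsum_fiber p hfg); split; last exact: tsum_eq.
by have := asum_fiber p hfg; apply: eq_asum.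
Qed.

Lemma asum_shift (f : nat -> C) : asum f -> asum (fun n => f n.+1).
Proof. by apply: (asum_inj (h := S)) => ? ? []. Qed.

Lemma tsum_recl (f : nat -> C) : asum f -> tsum f = f 0%N + tsum (fun n => f n.+1).
Proof.
move=> hf; have /tsum_nat h1 := asum_shift hf.
apply: tsum_nat_lim; [exact: hf|rewrite -cvg_shiftS].
have -> : (fun n => series f n.+1) = (fun n => f 0%N + series (fun n => f n.+1) n).
  by apply/funext => n; rewrite /series /= big_nat_recl.
exact: (cvgD (cvg_cst (f 0%N)) h1).
Qed.

Definition expt z (k : nat) : C := z ^+ k / k`!%:R.

Lemma expt_bound z n : \sum_(0 <= k < n) normR (expt z k) <= expR (normR z).
Proof.
under eq_bigr do rewrite /expt normRM normRV normRX normR_nat.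
apply: le_trans (_ : series (exp_coeff (normR z)) n <= _) => //.
apply: nondecreasing_cvgn_le (is_cvg_series_exp_coeff _) _.
by apply: nondecreasing_series => k _ _; apply: exp_coeff_ge0; exact: normR_ge0.
Qed.

Lemma asum_expt z : asum (expt z).
Proof. exact: asum_nat (expt_bound z). Qed.

Lemma exptD z w n : expt (z + w) n = \sum_(k < n.+1) expt z k * expt w (n - k).
Proof.
rewrite /expt addrC exprDn big_distrl /=; apply: eq_bigr => i _.
have ile : (i <= n)%N by rewrite -ltnS.
rewrite -mulr_natr -(bin_fact ile) !natrM.
have f0 k : k`!%:R != 0 :> C by rewrite pnatr_eq0 -lt0n fact_gt0.
have b0 : 'C(n, i)%:R != 0 :> C by rewrite pnatr_eq0 -lt0n bin_gt0.
move: (f0 i) (f0 (n - i)%N) b0; move: (i`!%:R) ((n - i)`!%:R) ('C(n, i)%:R) => a b c a0 b0 c0.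
by field; rewrite a0 b0 c0.
Qed.

Lemma tsum_exptD z w : tsum (expt (z + w)) = tsum (expt z) * tsum (expt w).
Proof.
have [_ ->] := cauchy_prod (asum_expt z) (asum_expt w).
by apply: tsum_eq => n; exact: exptD.
Qed.

Lemma tsum_expt_ofR (x : R) : tsum (expt (ofR x)) = ofR (expR x).
Proof.
apply: tsum_nat_lim; first exact: asum_expt.
have -> : series (expt (ofR x)) = (fun n => ofR (series (exp_coeff x) n)).
  apply/funext => n; rewrite /series /= ofR_sum; apply: eq_bigr => k _.
  by rewrite /expt /exp_coeff /= ofRM ofRX ofRV ofR_nat.
exact: (cvg_ofR (is_cvg_series_exp_coeff x)).
Qed.

Lemma expr_i_odd k : ('i : C) ^+ k = if odd k then 'i * (-1) ^+ k./2 else (-1) ^+ k./2.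
Proof.
rewrite -{1}(odd_double_half k) exprD -mul2n exprM sqrCi.
by case: odd; rewrite ?expr1 ?expr0 ?mul1r.
Qed.

Lemma tsum_expt_i (y : R) : tsum (expt ('i * ofR y)) = ofR (cos y) + 'i * ofR (sin y).
Proof.
have h := tsum_nat (asum_expt ('i * ofR y)).
have E k : expt ('i * ofR y) k = ofR (cos_coeff y k) + 'i * ofR (sin_coeff y k).
  rewrite /expt /cos_coeff /sin_coeff /= exprMn expr_i_odd.
  rewrite -?exprnP !ofRM !ofRV !ofRX !ofRN !ofR_nat ofR1.
  case ko : (odd k) => /=; last by rewrite mul1r !mul0r mulr0 addr0.
  have -> : k.-1./2 = k./2 by rewrite -{1}(odd_double_half k) ko /= doubleK.
  by rewrite mul1r !mul0r add0r !mulrA.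
apply: Cplx_eq.
  have hr := @cvg_reC _ _ _ eventually_filter _ _ h.
  have -> : reC (ofR (cos y) + 'i * ofR (sin y)) = cos y.
    by rewrite reCD reCM reCi imCi reC_ofR imC_ofR; ring.
  suff hc : (fun n => reC (series (expt ('i * ofR y)) n)) @ \oo --> cos y.
    exact: (cvg_unique (@Rhausdorff R) hr hc).
  have -> : (fun n => reC (series (expt ('i * ofR y)) n)) = series (cos_coeff y).
    apply/funext => n; rewrite /series /= reC_sum; apply: eq_bigr => k _.
    by rewrite E reCD reCM reCi imCi reC_ofR imC_ofR; ring.
  by rewrite unlock; exact: is_cvg_series_cos_coeff.
have hr := @cvg_imC _ _ _ eventually_filter _ _ h.
have -> : imC (ofR (cos y) + 'i * ofR (sin y)) = sin y.
  by rewrite imCD imCM reCi imCi reC_ofR imC_ofR; ring.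
suff hc : (fun n => imC (series (expt ('i * ofR y)) n)) @ \oo --> sin y.
  exact: (cvg_unique (@Rhausdorff R) hr hc).
have -> : (fun n => imC (series (expt ('i * ofR y)) n)) = series (sin_coeff y).
  apply/funext => n; rewrite /series /= imC_sum; apply: eq_bigr => k _.
  by rewrite E imCD imCM reCi imCi reC_ofR imC_ofR; ring.
by rewrite unlock; exact: is_cvg_series_sin_coeff.
Qed.

Lemma expCE z : expC z = tsum (expt z).
Proof. by rewrite /expC -tsum_expt_ofR -tsum_expt_i -tsum_exptD -Cplx_dec. Qed.

Lemma expCD z w : expC (z + w) = expC z * expC w.
Proof. by rewrite !expCE tsum_exptD. Qed.
Lemma expC_ofR (x : R) : expC (ofR x) = ofR (expR x).
Proof. by rewrite expCE tsum_expt_ofR. Qed.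
Lemma expC0 : expC 0 = 1 :> C.
Proof. by rewrite -ofR0 expC_ofR expR0 ofR1. Qed.
Lemma normR_expC z : normR (expC z) = expR (reC z).
Proof.
rewrite /expC normRM normR_ofR ger0_norm ?expR_ge0// -[RHS]mulr1; congr (_ * _).
rewrite /normR.
have -> : reC (ofR (cos (imC z)) + 'i * ofR (sin (imC z))) = cos (imC z).
  by rewrite reCD reCM reCi imCi reC_ofR imC_ofR; ring.
have -> : imC (ofR (cos (imC z)) + 'i * ofR (sin (imC z))) = sin (imC z).
  by rewrite imCD imCM reCi imCi reC_ofR imC_ofR; ring.
by rewrite cos2Dsin2 sqrtr1.
Qed.
Lemma expC_neq0 z : expC z != 0.
Proof. by rewrite -normR_gt0 normR_expC expR_gt0. Qed.
Lemma expCN z : expC (- z) = (expC z)^-1.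
Proof. by apply: (mulIf (expC_neq0 z)); rewrite -expCD addNr expC0 mulVf ?expC_neq0. Qed.
Lemma expCMn z n : expC (n%:R * z) = expC z ^+ n.
Proof.
elim: n => [|n IH]; first by rewrite mul0r expC0 expr0.
by rewrite -add1n natrD mulrDl mul1r expCD IH exprS.
Qed.
Lemma expC_imR (y : R) : expC ('i * ofR y) = ofR (cos y) + 'i * ofR (sin y).
Proof. by rewrite expCE tsum_expt_i. Qed.

Lemma expC_taylor z : normR (expC z - 1 - z) <= normR z ^+ 2 * expR (normR z).
Proof.
have h := asum_expt z; have h1 := asum_shift h; have h2 := asum_shift h1.
rewrite expCE (tsum_recl h) (tsum_recl h1) /expt expr0 expr1 !fact0 divr1.
have -> : (1`!)%N = 1%N by [].
rewrite divr1.
have -> : 1 + (z + tsum (fun n => z ^+ n.+2 / (n.+2)`!%:R)) - 1 - z =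
   tsum (fun n => expt z n.+2) by ring.
apply: hasum_norm_le (asum_tsum h2) _ => A.
apply: le_trans (_ : normR z ^+ 2 * \sum_(k <- A) normR (expt z k) <= _).
  rewrite big_distrr /=; apply: ler_sum => k _.
  rewrite /expt (normRM (z ^+ k.+2)) (normRM (z ^+ k)) !normRV !normRX !normR_nat.
  have -> : normR z ^+ k.+2 = normR z ^+ 2 * normR z ^+ k by rewrite -exprD.
  rewrite -mulrA.
  rewrite ler_wpM2l ?sqr_ge0// ler_wpM2l ?exprn_ge0 ?normR_ge0// lef_pV2 ?posrE ?ltr0n ?fact_gt0//.
  by rewrite ler_nat !factS mulnA leq_pmull.
rewrite ler_wpM2l ?sqr_ge0//; apply: asum_ge0_hasum => [k|]; first exact: normR_ge0.
rewrite -tsum_expt_ofR; apply: eq_hasum (asum_tsum (asum_expt _)) => k.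
by rewrite /expt normRM normRX normRV normR_nat ofRM ofRX ofRV ofR_nat.
Qed.
End Exp.

(** * Generating series of exponentials *)

Section Deriv.
Variable R : realType.
Local Notation C := (Cplx R).

Lemma is_derive_cvg (f : C -> C) (x l : C) : is_derive x 1 f l <->
  (fun h => h^-1 * (f (h + x) - f x)) @ 0^' --> l.
Proof.
have E : (fun h => h^-1 *: ((f \o shift x) (h *: (1 : C)) - f x)) = (fun h => h^-1 * (f (h + x) - f x)).
  by apply/funext => h; rewrite /= /GRing.scale /= mulr1.
split=> [[hd <-]|h].
  by move: hd; rewrite /derivable /derive E.
have hc : cvg ((fun h => h^-1 *: ((f \o shift x) (h *: (1 : C)) - f x)) @ 0^').
  by rewrite E; apply/cvg_ex; exists l.
apply: DeriveDef; first exact: hc.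
by rewrite /derive E; apply: cvg_lim; [exact: norm_hausdorff|exact: h].
Qed.

Lemma near_dnbhs0 (r : R) (P : C -> Prop) : 0 < r ->
  (forall h, h != 0 -> normR h < r -> P h) -> \forall h \near 0^', P h.
Proof.
move=> r0 hP; exists (ofR r); first by rewrite /= -ofR0 ltr_ofR.
move=> h /=; rewrite sub0r normrN ltr_norm_ofR => hr h0; exact: hP.
Qed.

Lemma near_nbhs0 (r : R) (P : C -> Prop) (x : C) : 0 < r ->
  (forall h, normR (h - x) < r -> P h) -> \forall h \near x, P h.
Proof.
move=> r0 hP; exists (ofR r); first by rewrite /= -ofR0 ltr_ofR.
by move=> h /=; rewrite ltr_norm_ofR normR_subC => /hP.
Qed.

Lemma is_derive_bound (f : C -> C) (x l : C) (K r : R) : 0 < r ->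
  (forall h, h != 0 -> normR h < r ->
     normR (f (h + x) - f x - l * h) <= K * normR h ^+ 2) -> is_derive x 1 f l.
Proof.
move=> r0 hK; apply/is_derive_cvg/cvgCP => e e0.
have d0 : 0 < Num.min r (e / (`|K| + 1)).
  by rewrite lt_min r0 divr_gt0// ltr_pwDr.
apply: (near_dnbhs0 d0) => h h0; rewrite lt_min => /andP[hr he].
have -> : h^-1 * (f (h + x) - f x) - l = h^-1 * (f (h + x) - f x - l * h).
  by rewrite [RHS]mulrBr [h^-1 * (l * h)]mulrCA mulVf// mulr1.
rewrite normRM normRV; have nh : 0 < normR h by rewrite normR_gt0.
rewrite mulrC ltr_pdivrMr//; apply: le_lt_trans (hK h h0 hr) _.
rewrite expr2 mulrA ltr_pM2r//; apply: (@le_lt_trans _ _ (`|K| * normR h)).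
  by rewrite ler_wpM2r ?normR_ge0// ler_norm.
move: he; rewrite ltr_pdivlMr ?ltr_pwDr//; lra.
Qed.

(* Locked, so that matching never unfolds it to the product defining [expC]. *)
Fact qe_key : unit. Proof. exact: tt. Qed.
Definition qe : R -> C -> C :=
  locked_with qe_key (fun w tau => expC (piC R * 'i * ofR w * tau)).

Lemma qe_expC w tau : qe w tau = expC (piC R * 'i * ofR w * tau).
Proof. by rewrite /qe unlock. Qed.

Lemma qeE w tau : piC R * 'i * ofR w * tau = 'i * (ofR (pi * w) * tau).
Proof. by rewrite ofRM /piC; ring. Qed.

Lemma normR_qe w tau : normR (qe w tau) = expR (- (pi * w * imC tau)).
Proof.
rewrite qe_expC normR_expC qeE; congr expR.
by rewrite reCM reCi imCi mul0r mul1r sub0r imC_ofRM.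
Qed.

Lemma qeD w a b : qe w (a + b) = qe w a * qe w b.
Proof. by rewrite !qe_expC mulrDr expCD. Qed.
Lemma qeDw v w a : qe (v + w) a = qe v a * qe w a.
Proof. by rewrite !qe_expC -expCD -mulrDl -mulrDr ofRD. Qed.
Lemma qe0 a : qe 0 a = 1.
Proof. by rewrite qe_expC ofR0 mulr0 mul0r expC0. Qed.
Lemma qe_neq0 w a : qe w a != 0. Proof. by rewrite qe_expC; exact: expC_neq0. Qed.
Lemma qe_ofRM (r w : R) a : qe w (ofR r * a) = qe (r * w) a.
Proof. by rewrite !qe_expC ofRM; congr expC; ring. Qed.

Section Dsum.
Variable T : choiceType.
Implicit Types (w : T -> R) (c : T -> C).

Definition qsummable w c := forall tau : C, 0 < imC tau -> asum (fun t => c t * qe (w t) tau).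
Definition qsum w c (tau : C) := tsum (fun t => c t * qe (w t) tau).

Lemma exp_decay (v y : R) : 0 <= v -> 0 < y ->
  v * expR (- (pi * v * y)) <= 2 / (pi * y) * expR (- (pi * v * (y / 2))).
Proof.
move=> v0 y0; have p0 := pi_gt0 R.
have -> : expR (- (pi * v * y)) = expR (- (pi * v * (y / 2))) * expR (- (pi * v * (y / 2))).
  by rewrite -expRD; congr expR; field.
rewrite mulrA ler_wpM2r ?expR_ge0// expRN ler_pdivrMr ?expR_gt0//.
have h := expR_ge1Dx (pi * v * (y / 2)).
have h2 p : 0 < p -> v = 2 / (p * y) * (p * v * (y / 2)).
  by move=> pp; field; rewrite (gt_eqF pp) (gt_eqF y0).
rewrite [leLHS](h2 _ p0); apply: ler_wpM2l; last by lra.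
by rewrite divr_ge0// mulr_ge0// ltW.
Qed.

Lemma qsummable_pow w c : (forall t, 0 <= w t) -> qsummable w c -> qsummable w (fun t => ofR (w t) * c t).
Proof.
move=> w0 hc tau y0.
have y20 : 0 < imC (ofR (1 / 2) * tau) by rewrite imC_ofRM; lra.
apply: asum_le (asumMl (ofR (2 / (pi * imC tau))) (hc _ y20)) => t.
rewrite !normRM !normR_qe !normR_ofR ger0_norm// ger0_norm; last first.
  by rewrite divr_ge0// mulr_ge0 ?pi_ge0 ?ltW.
have := exp_decay (w0 t) y0; rewrite imC_ofRM.
have -> : 1 / 2 * imC tau = imC tau / 2 by rewrite mul1r mulrC.
move=> h; rewrite mulrAC [leRHS]mulrCA [leRHS]mulrC.
by rewrite ler_wpM2r ?normR_ge0.
Qed.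

Lemma qsum_derive w c tau : (forall t, 0 <= w t) -> qsummable w c -> 0 < imC tau ->
  is_derive tau 1 (qsum w c) (piC R * 'i * qsum w (fun t => ofR (w t) * c t) tau).
Proof.
move=> w0 hc y0; have hc1 := qsummable_pow w0 hc; have hc2 := qsummable_pow w0 hc1.
have t0 : 0 < imC (ofR (3 / 4) * tau) by rewrite imC_ofRM; lra.
have [M hM] := hc2 _ t0.
apply: (@is_derive_bound _ _ _ (pi ^+ 2 * M) (imC tau / 4)); first by lra.
move=> h h0 hr.
have yh : 0 < imC (h + tau).
  by rewrite imCD; have := ler_imC h; rewrite ler_norml; lra.
have a1 := asum_tsum (hc _ yh); have a0 := asum_tsum (hc _ y0).
have a2 := hasumMl (piC R * 'i * h) (asum_tsum (hc1 _ y0)).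
have := hasumB (hasumB a1 a0) a2.
have -> : piC R * 'i * h * tsum (fun t => ofR (w t) * c t * qe (w t) tau) =
  piC R * 'i * qsum w (fun t => ofR (w t) * c t) tau * h by rewrite /qsum; ring.
move/hasum_norm_le; apply => A.
apply: le_trans (_ : pi ^+ 2 * normR h ^+ 2 * \sum_(t <- A) normR (ofR (w t) * (ofR (w t) * c t) * qe (w t) (ofR (3 / 4) * tau)) <= _).
  rewrite big_distrr /=; apply: ler_sum => t _.
  rewrite qeD; set q := qe (w t) tau.
  have -> : c t * (qe (w t) h * q) - c t * q - piC R * 'i * h * (ofR (w t) * c t * q) =
     c t * q * (expC (piC R * 'i * ofR (w t) * h) - 1 - piC R * 'i * ofR (w t) * h).
    by rewrite (qe_expC _ h); ring.
  rewrite normRM; have := expC_taylor (piC R * 'i * ofR (w t) * h).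
  have -> : normR (piC R * 'i * ofR (w t) * h) = pi * w t * normR h.
    by rewrite !normRM !normR_ofR normRi mulr1 !ger0_norm ?pi_ge0.
  move/(ler_wpM2l (normR_ge0 (c t * q))); move/le_trans; apply.
  rewrite !normRM !normR_ofR !normR_qe (ger0_norm (w0 t)) imC_ofRM.
  have -> : normR (c t) * expR (- (pi * w t * imC tau)) *
    ((pi * w t * normR h) ^+ 2 * expR (pi * w t * normR h)) =
    pi ^+ 2 * normR h ^+ 2 * (w t * (w t * normR (c t))) *
     (expR (- (pi * w t * imC tau)) * expR (pi * w t * normR h)) by ring.
  rewrite -expRD [leRHS]mulrA; apply: ler_wpM2l.
    apply: mulr_ge0; first by apply: mulr_ge0; exact: sqr_ge0.
    by apply: mulr_ge0 => //; apply: mulr_ge0 => //; exact: normR_ge0.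
  rewrite ler_expR.
  have pw : 0 <= pi * w t by rewrite mulr_ge0 ?pi_ge0.
  have : pi * w t * normR h <= pi * w t * (imC tau / 4) by rewrite ler_wpM2l// ltW.
  lra.
rewrite mulrAC ler_wpM2r ?sqr_ge0// ler_wpM2l ?sqr_ge0//.
Qed.

Lemma qsum_infty w c tau : (forall t, 0 <= w t) -> qsummable w c -> 0 < imC tau ->
  (fun n : nat => qsum w c (ofR (2 ^+ n) * tau)) @ \oo --> tsum (fun t => if w t == 0 then c t else 0).
Proof.
move=> w0 hc y0.
have n2 n : n%:R + 1 <= 2 ^+ n :> R by rewrite -natrX -[1]/(1%:R) -natrD ler_nat addn1 ltn_expl.
apply: (proj2 (@tannery R T (fun n t => c t * qe (w t) (ofR (2 ^+ n) * tau)) _ _ (hc _ y0) _ _)) => [n t|t].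
  rewrite !normRM ler_wpM2l ?normR_ge0// !normR_qe ler_expR imC_ofRM lerN2.
  rewrite mulrCA -[leLHS]mul1r; apply: ler_wpM2r.
    by rewrite !mulr_ge0 ?pi_ge0 ?w0 ?ltW.
  by have := n2 n; have : 0 <= n%:R :> R by []; lra.
case: eqP => wt.
  by under eq_fun do rewrite wt qe0 mulr1; exact: cvg_cst.
have wp : 0 < w t by rewrite lt0r w0 andbT; apply/eqP.
pose a := expR (- (pi * w t * imC tau)).
have a1 : `|a| < 1.
  rewrite ger0_norm ?expR_ge0// expR_lt1 oppr_lt0.
  by rewrite !mulr_gt0 ?pi_gt0.
have hg : (fun n => normR (c t) * a ^+ n) @ \oo --> normR (c t) * 0.
  exact: cvgM (cvg_cst _) (cvg_expr a1).
rewrite mulr0 in hg.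
apply/cvgC_reP; apply: (squeeze_cvgr _ (cvg_cst 0) hg).
apply: nearW => n; rewrite normR_ge0 subr0 normRM normR_qe /=.
rewrite ler_wpM2l ?normR_ge0// /a -expRM_natr ler_expR imC_ofRM mulNr lerN2.
rewrite [leRHS]mulrCA mulrC; apply: ler_wpM2r.
  by rewrite !mulr_ge0 ?pi_ge0 ?w0 ?ltW.
by have := n2 n; lra.
Qed.

End Dsum.
End Deriv.

(** * Theta constants *)

Section Thetas.
Variable R : realType.
Local Notation C := (Cplx R).
Implicit Types (tau : C).

Lemma is_derive_eqH (f g : C -> C) tau (a b : C) : 0 < imC tau ->
  (forall z, 0 < imC z -> f z = g z) ->
  is_derive tau 1 f a -> is_derive tau 1 g b -> a = b.
Proof.
move=> y0 fg fa gb; have h : \near tau, f tau = g tau.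
  apply: (near_nbhs0 y0) => z hz; apply: fg.
  by have := le_lt_trans (ler_imC _) hz; rewrite imCB ltr_norml; lra.
have fb := near_eq_is_derive h fa.
by rewrite -(derive_val (is_derive := fb)) (derive_val (is_derive := gb)).
Qed.

(* [k] for both [k] and [- k.+1]: a lower bound for all the exponents below. *)
Definition int_rk (n : int) : nat := match n with Posz k => k | Negz k => k end.

Lemma rk_geometric (f : int -> C) (r : R) : 0 <= r < 1 ->
  (forall n, normR (f n) <= r ^+ int_rk n) ->
  forall A : {fset int}, \sum_(n <- A) normR (f n) <= 2 / (1 - r).
Proof.
move=> /andP[r0 r1] hf A.
pose N := (\max_(n <- A) (int_rk n).+1)%N.
pose L := [seq Posz k | k <- iota 0 N] ++ [seq Negz k | k <- iota 0 N].
have memL (L0 : seq int) x : (x \in [fset x in L0]%fset) = (x \in L0) by rewrite inE.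
have hA : (A `<=` [fset x in L])%fset.
  apply/fsubsetP => n nA; rewrite memL mem_cat.
  have hn : (int_rk n < N)%N by rewrite /N (big_rem n) //= leq_maxl.
  case: n hn {nA} => k /= hk; apply/orP; [left|right]; apply/mapP; exists k => //;
  by rewrite mem_iota.
apply: le_trans (ler_fsum _ hA) _; first by move=> i; exact: normR_ge0.
have uL : uniq L.
  rewrite cat_uniq !map_inj_uniq ?iota_uniq ?andbT /=; try by move=> ? ? [].
  by apply/hasPn => x /mapP[k _ ->]; apply/mapP => -[].
rewrite (perm_big L) /=; last first.
  by apply: uniq_perm; rewrite ?fset_uniq// => x; rewrite memL.
rewrite big_cat !big_map /=.
have geo M : \sum_(k <- iota 0 M) r ^+ k <= 1 / (1 - r).
  rewrite ler_pdivlMr ?subr_gt0// mulrC.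
  have -> : (1 - r) * \sum_(k <- iota 0 M) r ^+ k = 1 - r ^+ M.
    elim: M => [|M IH]; first by rewrite big_nil mulr0 expr0 subrr.
    by rewrite -addn1 iotaD big_cat /= big_seq1 mulrDr IH add0n addn1 exprS; ring.
  by rewrite lerBlDr lerDl exprn_ge0.
have h1 : \sum_(k <- iota 0 N) normR (f k) <= 1 / (1 - r).
  by apply: le_trans (geo N); apply: ler_sum => k _; exact: (hf (Posz k)).
have h2 : \sum_(k <- iota 0 N) normR (f (Negz k)) <= 1 / (1 - r).
  by apply: le_trans (geo N); apply: ler_sum => k _; exact: (hf (Negz k)).
have -> : 2 / (1 - r) = 1 / (1 - r) + 1 / (1 - r) by rewrite -mulrDl.
exact: lerD.
Qed.

Lemma qsummable_rk (w : int -> R) (c : int -> C) :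
  (forall n, (int_rk n)%:R <= w n) -> (forall n, normR (c n) <= 1) ->
  forall tau, 0 < imC tau -> forall A : {fset int},
   \sum_(n <- A) normR (c n * qe (w n) tau) <= 2 / (1 - expR (- (pi * imC tau))).
Proof.
move=> hw hc tau y0; have py : 0 < pi * imC tau by rewrite mulr_gt0 ?pi_gt0.
apply: rk_geometric; first by rewrite expR_ge0 expR_lt1 oppr_lt0.
move=> n; rewrite normRM normR_qe -[leRHS]mul1r; apply: ler_pM => //; first exact: normR_ge0.
rewrite -expRM_natr ler_expR mulNr lerN2 [leRHS]mulrAC.
by apply: ler_wpM2l; [exact: ltW|exact: hw].
Qed.

Lemma qsummable_rkW (w : int -> R) (c : int -> C) :
  (forall n, (int_rk n)%:R <= w n) -> (forall n, normR (c n) <= 1) -> qsummable w c.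
Proof. by move=> hw hc tau y0; exists (2 / (1 - expR (- (pi * imC tau)))); exact: qsummable_rk. Qed.

Definition w3 (n : int) : R := n%:~R ^+ 2.
Definition w2 (n : int) : R := (n%:~R + 2^-1) ^+ 2.
Definition one (n : int) : C := 1.
Definition alt (n : int) : C := (-1) ^ n.
Definition theta3 := qsum w3 one.
Definition theta4 := qsum w3 alt.
Definition theta2 := qsum w2 one.

Lemma w3_ge0 n : 0 <= w3 n. Proof. exact: sqr_ge0. Qed.
Lemma w2_ge0 n : 0 <= w2 n. Proof. exact: sqr_ge0. Qed.
Lemma natr_sqr_ge (k : nat) : k%:R <= k%:R ^+ 2 :> R.
Proof. by rewrite -natrX ler_nat; case: k => // k; rewrite leq_pmulr. Qed.
Lemma NegzR k : (Negz k)%:~R = - (k%:R + 1) :> R.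
Proof. by rewrite NegzE rmorphN /= -addn1 -[(k + 1)%N%:~R]/((k + 1)%:R) natrD. Qed.
Lemma w3_rk n : (int_rk n)%:R <= w3 n.
Proof.
rewrite /w3; case: n => k; first exact: natr_sqr_ge.
by rewrite NegzR /=; have := natr_sqr_ge k; have : 0 <= k%:R :> R by []; nra.
Qed.
Lemma w2_rk n : (int_rk n)%:R <= w2 n.
Proof.
rewrite /w2; case: n => k /=.
  by have := natr_sqr_ge k; have : 0 <= k%:R :> R by []; rewrite -[k%:~R]/(k%:R); nra.
by rewrite NegzR /=; have := natr_sqr_ge k; have : 0 <= k%:R :> R by []; nra.
Qed.
Lemma one_le n : normR (one n) <= 1. Proof. by rewrite normR1. Qed.
Lemma alt_sqr n : alt n * alt n = 1.
Proof. by rewrite /alt -expfzMl mulrNN mulr1 exp1rz. Qed.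
Lemma alt_le n : normR (alt n) <= 1.
Proof.
have := congr1 (@normR R) (alt_sqr n); rewrite normRM normR1 => h.
by have := normR_ge0 (alt n); nra.
Qed.
Lemma altD m n : alt (m + n) = alt m * alt n.
Proof. by rewrite /alt expfzDr ?oppr_eq0 ?oner_eq0. Qed.
Lemma altN n : alt (- n) = alt n.
Proof. by rewrite -[LHS]mulr1 -(alt_sqr n) mulrA -altD addNr mul1r. Qed.
Lemma alt1 : alt 1 = -1. Proof. by rewrite /alt expr1z. Qed.

Lemma qsummable3 : qsummable w3 one. Proof. exact: qsummable_rkW w3_rk one_le. Qed.
Lemma qsummable4 : qsummable w3 alt. Proof. exact: qsummable_rkW w3_rk alt_le. Qed.
Lemma qsummable2 : qsummable w2 one. Proof. exact: qsummable_rkW w2_rk one_le. Qed.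

(* [Z^2] is the disjoint union of the images of (a, b) |-> (a + b, a - b) and
   (a, b) |-> (a + b + 1, a - b), according to the parity of the sum. *)
Lemma tsum_diag (F : (int * int)%type -> C) : asum F ->
  tsum F = tsum (fun p : int * int => F (p.1 + p.2, p.1 - p.2))
         + tsum (fun p : int * int => F (p.1 + p.2 + 1, p.1 - p.2)).
Proof.
move=> hF; pose e (p : int * int) := (2 %| p.1 + p.2)%Z.
have he : asum (fun p => if e p then F p else 0).
  by apply: asum_le hF => p; case: ifP => // _; rewrite normR0 normR_ge0.
have ho : asum (fun p => if e p then 0 else F p).
  by apply: asum_le hF => p; case: ifP => // _; rewrite normR0 normR_ge0.
rewrite -[LHS](_ : tsum (fun p => (if e p then F p else 0) + (if e p then 0 else F p)) = _); last first.
  by apply: tsum_eq => p; case: ifP; rewrite ?addr0 ?add0r.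
rewrite tsumD//; congr (_ + _).
  rewrite (tsum_reindex (h := fun p : int * int => (p.1 + p.2, p.1 - p.2))) //.
  - by apply: tsum_eq => -[a b] /=; rewrite /e /= (_ : (2 %| _)%Z = true) //; lia.
  - by move=> [a b] [a' b'] /= [h1 h2]; congr (_, _); lia.
  - move=> [m n] hmn; rewrite /e /=; case: ifP => // h; exfalso.
    case/dvdzP: h => a ha; apply: (hmn (a, a - n)) => /=; congr (_, _); lia.
rewrite (tsum_reindex (h := fun p : int * int => (p.1 + p.2 + 1, p.1 - p.2))) //.
- by apply: tsum_eq => -[a b] /=; rewrite /e /= (_ : (2 %| _)%Z = false) //; lia.
- by move=> [a b] [a' b'] /= [h1 h2]; congr (_, _); lia.
- move=> [m n] hmn; rewrite /e /=; case: ifP => // h; exfalso.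
  have [a ha] : exists a, m + n = 2 * a + 1 by exists ((m + n) %/ 2)%Z; lia.
  apply: (hmn (a, a - n)) => /=; congr (_, _); lia.
Qed.
End Thetas.

Section Dup.
Variable R : realType.
Local Notation C := (Cplx R).
Implicit Types (tau : C).
Local Notation w3 := (@w3 R).
Local Notation w2 := (@w2 R).
Local Notation one := (@one R).
Local Notation alt := (@alt R).
Local Notation theta2 := (@theta2 R).
Local Notation theta3 := (@theta3 R).
Local Notation theta4 := (@theta4 R).

Definition dbl tau : C := ofR 2 * tau.
Lemma dbl_gt0 tau : 0 < imC tau -> 0 < imC (dbl tau).
Proof. by rewrite /dbl imC_ofRM; lra. Qed.
Lemma qe_dbl w tau : qe w (dbl tau) = qe (2 * w) tau.
Proof. exact: qe_ofRM. Qed.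

Lemma tsum_prod_dbl (F : (int * int)%type -> C) (w v : int -> R) (c d : int -> C) tau :
  qsummable w c -> qsummable v d -> 0 < imC tau ->
  (forall a b, F (a, b) = c a * d b * qe (2 * w a + 2 * v b) tau) ->
  tsum F = qsum w c (dbl tau) * qsum v d (dbl tau).
Proof.
move=> hc hd /dbl_gt0 y0 hF; rewrite /qsum -tsumM; [|exact: hc|exact: hd].
apply: tsum_eq => -[a b]; rewrite hF /= !qe_dbl qeDw; ring.
Qed.

Lemma theta_mul (w v w1 v1 u1 u2 : int -> R) (c d c1 d1 e1 e2 : int -> C) tau :
  qsummable w c -> qsummable v d -> qsummable w1 c1 -> qsummable v1 d1 -> qsummable u1 e1 -> qsummable u2 e2 ->
  0 < imC tau ->
  (forall a b, c (a + b) * d (a - b) = c1 a * d1 b) ->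
  (forall a b, w (a + b) + v (a - b) = 2 * w1 a + 2 * v1 b) ->
  (forall a b, c (a + b + 1) * d (a - b) = e1 a * e2 b) ->
  (forall a b, w (a + b + 1) + v (a - b) = 2 * u1 a + 2 * u2 b) ->
  qsum w c tau * qsum v d tau =
    qsum w1 c1 (dbl tau) * qsum v1 d1 (dbl tau) + qsum u1 e1 (dbl tau) * qsum u2 e2 (dbl tau).
Proof.
move=> hc hd hc1 hd1 he1 he2 y0 h1 h2 h3 h4.
rewrite {1 2}/qsum -tsumM; [|exact: hc|exact: hd].
rewrite tsum_diag; last exact: (asumM (hc _ y0) (hd _ y0)).
congr (_ + _); apply: tsum_prod_dbl => // a b /=.
  by rewrite -h1 -h2 qeDw; ring.
by rewrite -h3 -h4 qeDw; ring.
Qed.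

Definition wmul (w : int -> R) (c : int -> C) : int -> C := fun n => ofR (w n) * c n.

Lemma intRD m n : (m + n)%:~R = m%:~R + n%:~R :> R. Proof. exact: rmorphD. Qed.
Lemma intRB m n : (m - n)%:~R = m%:~R - n%:~R :> R. Proof. exact: rmorphB. Qed.
Lemma intR1 : (1 : int)%:~R = 1 :> R. Proof. by []. Qed.

Lemma qsum2_alt tau : 0 < imC tau -> qsum w2 alt tau = 0.
Proof.
move=> y0; have hs : asum (fun n => alt n * qe (w2 n) tau).
  exact: (qsummable_rkW (@w2_rk R) (@alt_le R)).
have E : qsum w2 alt tau = - qsum w2 alt tau.
  rewrite {1}/qsum (tsum_reindex (h := fun n : int => - 1 - n)) //; last 2 first.
  - by move=> m n; lia.
  - by move=> t ht; case: (ht (- 1 - t)); lia.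
  rewrite -tsumN//; apply: tsum_eq => n.
  rewrite altD !altN alt1 mulN1r mulNr; congr (- (_ * qe _ _)).
  by rewrite /w2 intRB (_ : (-1 : int)%:~R = -1 :> R) //; field.
have : 2%:R * qsum w2 alt tau = 0 by rewrite -[2%:R]/(1 + 1) mulrDl mul1r {1}E addNr.
by move/eqP; rewrite mulf_eq0 pnatr_eq0 /= => /eqP.
Qed.

Lemma theta3_shift tau : 0 < imC tau -> qsum (fun n => (n%:~R + 1) ^+ 2) one tau = theta3 tau.
Proof.
move=> y0; rewrite [RHS](tsum_reindex (h := fun n : int => n + 1)) //; last 3 first.
- by move=> m n; lia.
- by move=> t ht; case: (ht (t - 1)); lia.
- exact: qsummable3.
by apply: tsum_eq => n; rewrite /w3 intRD.
Qed.

Lemma qsummable3s : qsummable (fun n : int => (n%:~R + 1) ^+ 2) one.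
Proof.
move=> tau y0; have := asum_inj (h := fun n : int => n + 1) _ (@qsummable3 R tau y0).
rewrite /w3 => h; apply: eq_asum (h _) => [n|m n]; first by rewrite intRD.
by lia.
Qed.

Lemma theta3_dup tau : 0 < imC tau -> theta3 tau ^+ 2 = theta3 (dbl tau) ^+ 2 + theta2 (dbl tau) ^+ 2.
Proof.
move=> y0; rewrite !expr2; apply: theta_mul y0 _ _ _ _ => //;
  try exact: qsummable3; try exact: qsummable2; move=> a b; rewrite /w3 /w2 ?(intRD, intRB, intR1);
  by field.
Qed.

Lemma theta4_dup tau : 0 < imC tau -> theta4 tau ^+ 2 = theta3 (dbl tau) ^+ 2 - theta2 (dbl tau) ^+ 2.
Proof.
move=> y0; have E : theta2 (dbl tau) ^+ 2 = - (qsum w2 (fun n => - 1) (dbl tau) * theta2 (dbl tau)).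
  rewrite -mulNr expr2; congr (_ * _); rewrite /theta2 /qsum -tsumN; last first.
    by apply: qsummable_rkW (dbl_gt0 y0); [exact: w2_rk|move=> n; rewrite normRN normR1].
  by apply: tsum_eq => n; rewrite mulNr opprK.
have hm : qsummable w2 (fun n => -1 : C).
  by apply: qsummable_rkW; [exact: w2_rk|move=> n; rewrite normRN normR1].
rewrite E opprK !expr2; apply: theta_mul y0 _ _ _ _ => //;
  try exact: qsummable3; try exact: qsummable2; try exact: qsummable4; move=> a b; rewrite /w3 /w2 ?(intRD, intRB, intR1);
  try by field.
- by rewrite !altD altN mulrACA alt_sqr mulr1 alt_sqr /one mulr1.
- transitivity (alt a * alt a * (alt b * alt b) * -1); last by rewrite !alt_sqr /one; ring.
  by rewrite !altD altN alt1; ring.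
Qed.

Lemma theta34_dup tau : 0 < imC tau -> theta4 (dbl tau) ^+ 2 = theta3 tau * theta4 tau.
Proof.
move=> y0; have -> : theta4 (dbl tau) ^+ 2 =
    theta4 (dbl tau) * theta4 (dbl tau) + qsum w2 alt (dbl tau) * qsum w2 alt (dbl tau).
  by rewrite qsum2_alt ?mulr0 ?addr0 ?expr2//; exact: dbl_gt0.
symmetry; apply: theta_mul y0 _ _ _ _ => //;
  try exact: qsummable3; try exact: qsummable4; try exact: (qsummable_rkW (@w2_rk R) (@alt_le R));
  move=> a b; rewrite /w3 /w2 ?(intRD, intRB, intR1);
  try by field.
- by rewrite /one mul1r altD altN.
- by rewrite /one mul1r altD altN.
Qed.

Lemma theta2_dup tau : 0 < imC tau -> theta2 tau ^+ 2 = 2%:R * (theta2 (dbl tau) * theta3 (dbl tau)).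
Proof.
move=> y0; rewrite -[2%:R]/(1 + 1) mulrDl mul1r.
rewrite -{2}(theta3_shift (dbl_gt0 y0)) [X in _ + X]mulrC !expr2; apply: theta_mul y0 _ _ _ _ => //;
  try exact: qsummable3; try exact: qsummable3s; try exact: qsummable2; move=> a b;
  rewrite /w3 /w2 ?(intRD, intRB, intR1); by field.
Qed.

Lemma D2theta3_dup tau : 0 < imC tau ->
  qsum w3 (wmul w3 (wmul w3 one)) tau * theta3 tau - qsum w3 (wmul w3 one) tau ^+ 2 =
  8%:R * (qsum w3 (wmul w3 one) (dbl tau) ^+ 2 + qsum w2 (wmul w2 one) (dbl tau) ^+ 2).
Proof.
move=> y0; have h0 := @qsummable3 R; have h1 := qsummable_pow (@w3_ge0 R) h0.
have h2 := qsummable_pow (@w3_ge0 R) h1; have h1' := qsummable_pow (@w2_ge0 R) (@qsummable2 R).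
set D1 := qsum w3 (wmul w3 one); set D2 := qsum w3 (wmul w3 (wmul w3 one)).
have a1 := asumM (h2 _ y0) (h0 _ y0); have a2 := asumM (h0 _ y0) (h2 _ y0).
have a3 := asumM (h1 _ y0) (h1 _ y0).
have e1 := tsumM (h2 _ y0) (h0 _ y0); have e2 := tsumM (h0 _ y0) (h2 _ y0).
have e3 := tsumM (h1 _ y0) (h1 _ y0).
have a12 := asumD a1 a2; have a4 := asumMl (- 2%:R) a3; have a := asumD a12 a4.
have e := tsumD a12 a4; rewrite (tsumD a1 a2) (tsumMl _ a3) e1 e2 e3 in e.
rewrite (tsum_diag a) in e.
have qsummable_l (w : int -> R) c : qsummable w c -> qsummable w (fun n => 4%:R * c n).
  by move=> hc t ht; apply: eq_asum (asumMl 4%:R (hc t ht)) => n; rewrite mulrA.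
have qsum_l (w : int -> R) c t : qsummable w c -> 0 < imC t ->
    qsum w (fun n => 4%:R * c n) t = 4%:R * qsum w c t.
  by move=> hc ht; rewrite /qsum -tsumMl; [apply: tsum_eq => n; rewrite mulrA|exact: hc].
move: e; rewrite (@tsum_prod_dbl _ w3 w3 (fun n => 4%:R * wmul w3 one n) (fun n => 4%:R * wmul w3 one n) tau); first last.
- move=> p q /=; have -> : qe (2 * w3 p + 2 * w3 q) tau = qe (w3 (p + q)) tau * qe (w3 (p - q)) tau.
    by rewrite -qeDw /w3 intRB intRD; congr qe; ring.
  by rewrite /wmul /one /w3 !intRB !intRD !ofRX !ofRD !ofRN; ring.
- exact: y0.
- exact: qsummable_l.
- exact: qsummable_l.
rewrite (@tsum_prod_dbl _ w2 w2 (fun n => 4%:R * wmul w2 one n) (fun n => 4%:R * wmul w2 one n) tau); first last.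
- move=> p q /=; have -> : qe (2 * w2 p + 2 * w2 q) tau = qe (w3 (p + q + 1)) tau * qe (w3 (p - q)) tau.
    by rewrite -qeDw /w3 /w2 intRB !intRD intR1; congr qe; field.
  by rewrite /wmul /one /w3 /w2 !intRB !intRD intR1 !ofRX !ofRD !ofRN ofRV ofR1 !ofR_nat; field.
- exact: y0.
- exact: qsummable_l.
- exact: qsummable_l.
have z0 := dbl_gt0 y0.
rewrite !qsum_l// => e.
have {}e : 2%:R * (D2 tau * theta3 tau - D1 tau ^+ 2) = 2%:R * (8%:R * (D1 (dbl tau) ^+ 2 + qsum w2 (wmul w2 one) (dbl tau) ^+ 2)).
  transitivity (D2 tau * theta3 tau + theta3 tau * D2 tau + - 2%:R * (D1 tau * D1 tau)); first by ring.
  by rewrite -e /D1; ring.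
by apply: (mulfI _ e); rewrite pnatr_eq0.
Qed.

End Dup.

(** * Differentiation rules *)

Section DerivRules.
Variable K : numFieldType.
Implicit Types (f g : K -> K) (x a b : K).

Lemma isdM f g x a b : is_derive x 1 f a -> is_derive x 1 g b ->
  is_derive x 1 (fun t => f t * g t) (a * g x + f x * b).
Proof.
move=> fa gb; have h := is_deriveM fa gb.
apply: (is_derive_eq h); rewrite /=.
by rewrite /GRing.scale /= addrC; congr (_ + _); rewrite mulrC.
Qed.
Lemma isdD f g x a b : is_derive x 1 f a -> is_derive x 1 g b ->
  is_derive x 1 (fun t => f t + g t) (a + b).
Proof. by move=> fa gb; exact: (is_deriveD fa gb). Qed.
Lemma isdB f g x a b : is_derive x 1 f a -> is_derive x 1 g b ->
  is_derive x 1 (fun t => f t - g t) (a - b).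
Proof. by move=> fa gb; exact: (is_deriveB fa gb). Qed.
Lemma isd_cst c x : is_derive x 1 (fun _ : K => c : K) 0.
Proof. exact: is_derive_cst. Qed.
Lemma isd_id x : is_derive x 1 (fun t : K => t) 1.
Proof. exact: is_derive_id. Qed.
Lemma isdMl c f x a : is_derive x 1 f a -> is_derive x 1 (fun t => c * f t) (c * a).
Proof. by move=> fa; have := isdM (isd_cst c x) fa; rewrite mul0r add0r. Qed.
Lemma isdN f x a : is_derive x 1 f a -> is_derive x 1 (fun t => - f t) (- a).
Proof. by move=> fa; exact: (is_deriveN fa). Qed.
Lemma isdX f x a n : is_derive x 1 f a ->
  is_derive x 1 (fun t => f t ^+ n) (n%:R * f x ^+ n.-1 * a).
Proof.
move=> fa; elim: n => [|n IH]; first by rewrite !mul0r; exact: isd_cst.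
have -> : (fun t => f t ^+ n.+1) = (fun t => f t * f t ^+ n) by apply/funext => t; rewrite exprS.
apply: (is_derive_eq (isdM fa IH)); rewrite /= -natr1; case: n {IH} => [|n]; first by rewrite !expr0; ring.
by rewrite /= exprS; ring.
Qed.
Lemma isdV f x a : f x != 0 -> is_derive x 1 f a ->
  is_derive x 1 (fun t => (f t)^-1) (- a / f x ^+ 2).
Proof.
move=> f0 fa; have hd : derivable f x 1 by [].
have hv := derivableP (derivableV f0 hd).
apply: (is_derive_eq hv).
by rewrite deriveV// derive_val /GRing.scale /= mulNr mulrC mulNr.
Qed.
End DerivRules.

Section DerivC.
Variable R : realType.
Local Notation C := (Cplx R).
Implicit Types (f g : C -> C) (x a b : C).

Lemma isd_comp f g x a b : is_derive x 1 g a -> is_derive (g x) 1 f b ->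
  is_derive x 1 (fun t => f (g t)) (b * a).
Proof.
move=> /is_derive_cvg ga /is_derive_cvg/cvgCP fb; apply/is_derive_cvg.
pose phi (z : C) := if z == g x then b else (z - g x)^-1 * (f z - f (g x)).
have phiE h : h^-1 * (f (g (h + x)) - f (g x)) = phi (g (h + x)) * (h^-1 * (g (h + x) - g x)).
  rewrite /phi; case: eqP => [->|/eqP n]; first by rewrite !subrr !mulr0.
  rewrite -subr_eq0 in n; set u := g (h + x) - g x in n *; set v := f _ - _.
  by transitivity (u^-1 * u * (h^-1 * v)); [rewrite mulVf// mul1r|ring].
have gx : (fun h : C => g (h + x)) @ 0^' --> g x.
  have h1 : (fun h : C => h * (h^-1 * (g (h + x) - g x)) + g x) @ 0^' --> 0 * a + g x.
    have h0 : (fun h : C => h) @ 0^' --> (0 : C) by exact: cvg_within.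
    exact: (cvgD (cvgM h0 ga) (cvg_cst (g x))).
  rewrite mul0r add0r in h1; apply: cvg_trans h1; apply: near_eq_cvg.
  by apply: (@near_dnbhs0 R 1) => // h h0 _; rewrite mulrA divff// mul1r subrK.
have hphi : (fun h : C => phi (g (h + x))) @ 0^' --> b.
  apply/cvgCP => e e0; have [d d0 hd] : exists2 d : R, 0 < d & forall z, normR (z - g x) < d -> normR (phi z - b) < e.
    have [d d0 hd] := fb e e0; have [d' d'0 dE] := lt0_ofR d0; exists d' => // z hz.
    rewrite /phi; case: eqP => [_|/eqP n]; first by rewrite subrr normR0.
    have := hd (z - g x); rewrite subrK /=; apply; last by rewrite subr_eq0.
    by rewrite /= sub0r normrN dE ltr_norm_ofR.
  by move/cvgCP : gx => /(_ d d0); apply: filterS => h /hd.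
by under eq_fun => h do rewrite phiE; exact: (cvgM hphi ga).
Qed.
Lemma isd_eqH f g x a : 0 < imC x -> (forall z, 0 < imC z -> f z = g z) ->
  is_derive x 1 f a -> is_derive x 1 g a.
Proof.
move=> y0 fg; apply: near_eq_is_derive; apply: (near_nbhs0 y0) => z hz; apply: fg.
by have := le_lt_trans (ler_imC _) hz; rewrite imCB ltr_norml; lra.
Qed.
End DerivC.

(** * Jacobi's derivative formulas *)

Section Jacobi.
Variable R : realType.
Local Notation C := (Cplx R).
Implicit Types (tau : C).
Local Notation w3 := (@w3 R).
Local Notation w2 := (@w2 R).
Local Notation one := (@one R).
Local Notation alt := (@alt R).
Local Notation theta2 := (@theta2 R).
Local Notation theta3 := (@theta3 R).
Local Notation theta4 := (@theta4 R).

Definition dtheta2 := qsum w2 (wmul w2 one).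
Definition dtheta3 := qsum w3 (wmul w3 one).
Definition dtheta4 := qsum w3 (wmul w3 alt).
Definition ddtheta3 := qsum w3 (wmul w3 (wmul w3 one)).
Definition ipi : C := piC R * 'i.
Lemma ipiE : ipi = piC R * 'i. Proof. by []. Qed.

Lemma piC_neq0 : piC R != 0.
Proof. by rewrite /piC -normR_gt0 normR_ofR normr_gt0 gt_eqF ?pi_gt0. Qed.
Lemma ipi_neq0 : ipi != 0.
Proof. by rewrite /ipi mulf_neq0 ?piC_neq0 ?neq0Ci. Qed.

Lemma theta2_der tau : 0 < imC tau -> is_derive tau 1 theta2 (ipi * dtheta2 tau).
Proof. by move=> y0; apply: qsum_derive => //; [exact: w2_ge0|exact: qsummable2]. Qed.
Lemma theta3_der tau : 0 < imC tau -> is_derive tau 1 theta3 (ipi * dtheta3 tau).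
Proof. by move=> y0; apply: qsum_derive => //; [exact: w3_ge0|exact: qsummable3]. Qed.
Lemma theta4_der tau : 0 < imC tau -> is_derive tau 1 theta4 (ipi * dtheta4 tau).
Proof. by move=> y0; apply: qsum_derive => //; [exact: w3_ge0|exact: qsummable4]. Qed.
Lemma dtheta3_der tau : 0 < imC tau -> is_derive tau 1 dtheta3 (ipi * ddtheta3 tau).
Proof.
move=> y0; apply: qsum_derive => //; first exact: w3_ge0.
by apply: qsummable_pow; [exact: w3_ge0|exact: qsummable3].
Qed.

Definition iter_dbl (n : nat) tau : C := ofR (2 ^+ n) * tau.
Lemma iter_dblS n tau : iter_dbl n.+1 tau = dbl (iter_dbl n tau).
Proof. by rewrite /iter_dbl /dbl mulrA -ofRM exprS. Qed.
Lemma iter_dbl_gt0 n tau : 0 < imC tau -> 0 < imC (iter_dbl n tau).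
Proof. by move=> y0; rewrite /iter_dbl imC_ofRM mulr_gt0 ?exprn_gt0. Qed.

Lemma tsum_w3 (c : int -> C) : tsum (fun n => if w3 n == 0 then c n else 0) = c 0.
Proof.
rewrite (hasum_tsum (@hasum_finite _ _ _ [fset (0 : int)]%fset _)).
  by rewrite big_seq_fset1 /w3 /= mulr0z expr0n eqxx.
move=> n; rewrite inE => n0; rewrite /w3 expf_eq0 /= intr_eq0.
by rewrite (negPf n0).
Qed.

Definition w2' (n : int) : R := n%:~R * (n%:~R + 1).
Lemma w2'_ge0 n : 0 <= w2' n.
Proof.
rewrite /w2'; case: n => k.
  by rewrite -[k%:~R]/(k%:R) mulr_ge0 ?addr_ge0.
by rewrite NegzR; have : 0 <= k%:R :> R by []; nra.
Qed.
Lemma tsum_w2' (c : int -> C) :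
  tsum (fun n => if w2' n == 0 then c n else 0) = c 0 + c (-1).
Proof.
rewrite (hasum_tsum (@hasum_finite _ _ _ [fset (0 : int); (-1 : int)]%fset _)).
  rewrite big_fsetU1 ?inE //= big_seq_fset1 /w2' mulr0z mul0r eqxx.
  by rewrite (_ : (-1 : int)%:~R = -1)// addNr mulr0 eqxx.
move=> n; rewrite !inE negb_or => /andP[n0 n1]; rewrite /w2' mulf_eq0 intr_eq0 (negPf n0) /=.
have -> : n%:~R + 1 = (n + 1)%:~R :> R by rewrite intRD.
by rewrite intr_eq0 addr_eq0 (negPf n1).
Qed.

Lemma qsummable_w2' c : qsummable w2 c -> qsummable w2' c.
Proof.
move=> hc tau y0; apply: eq_asum (asumMl (qe (4^-1) tau)^-1 (hc tau y0)) => n.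
have -> : w2 n = 4^-1 + w2' n by rewrite /w2 /w2'; field.
transitivity ((qe (4^-1) tau)^-1 * qe (4^-1) tau * (c n * qe (w2' n) tau)).
  by rewrite qeDw; ring.
by rewrite mulVf ?qe_neq0// mul1r.
Qed.
Lemma qsum_w2' c tau : qsummable w2 c -> 0 < imC tau ->
  qsum w2 c tau = qe (4^-1) tau * qsum w2' c tau.
Proof.
move=> hc y0; rewrite /qsum -tsumMl; last exact: (qsummable_w2' hc).
apply: tsum_eq => n; have -> : w2 n = 4^-1 + w2' n by rewrite /w2 /w2'; field.
by rewrite qeDw mulrCA.
Qed.

Let qsummable2' := qsummable_w2' (@qsummable2 R).
Let qsummable2d := qsummable_pow (@w2_ge0 R) (@qsummable2 R).
Let qsummable3d := qsummable_pow (@w3_ge0 R) (@qsummable3 R).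

Lemma theta3_infty tau : 0 < imC tau -> (fun n => theta3 (iter_dbl n tau)) @ \oo --> (1 : C).
Proof.
move=> y0; have := qsum_infty (@w3_ge0 R) (@qsummable3 R) y0; by rewrite tsum_w3.
Qed.
Lemma theta4_infty tau : 0 < imC tau -> (fun n => theta4 (iter_dbl n tau)) @ \oo --> (1 : C).
Proof.
move=> y0; have := qsum_infty (@w3_ge0 R) (@qsummable4 R) y0; by rewrite tsum_w3 /alt expr0z.
Qed.
Lemma dtheta3_infty tau : 0 < imC tau -> (fun n => dtheta3 (iter_dbl n tau)) @ \oo --> (0 : C).
Proof.
move=> y0; have := qsum_infty (@w3_ge0 R) qsummable3d y0.
by rewrite (tsum_w3 (wmul w3 one)) /wmul /w3 mulr0z expr0n ofR0 mul0r.
Qed.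
Lemma theta2'_infty tau : 0 < imC tau -> (fun n => qsum w2' one (iter_dbl n tau)) @ \oo --> (2%:R : C).
Proof.
by move=> y0; have := qsum_infty w2'_ge0 qsummable2' y0; rewrite tsum_w2'.
Qed.
Lemma dtheta2'_infty tau : 0 < imC tau ->
  (fun n => qsum w2' (wmul w2 one) (iter_dbl n tau)) @ \oo --> (2%:R^-1 : C).
Proof.
move=> y0; have := qsum_infty w2'_ge0 (qsummable_w2' qsummable2d) y0; rewrite (tsum_w2' (wmul w2 one)).
have -> : wmul w2 one 0 + wmul w2 one (-1) = 2%:R^-1 :> C.
  rewrite /wmul /one !mulr1 /w2 mulr0z (_ : (-1 : int)%:~R = -1)// -ofRD -ofR_nat -ofRV.
  by congr ofR; field.
by [].
Qed.

Lemma cvg_cst_eq (u : nat -> C) (a b : C) : (forall n, u n = a) -> u @ \oo --> b -> a = b.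
Proof.
move=> ua ub; have uE : u = fun=> a by apply/funext.
rewrite uE in ub.
exact: (cvg_unique (@norm_hausdorff _ _) (cvg_cst a) ub).
Qed.

(* A zero would persist along 2^n tau, where both constants tend to 1. *)
Lemma theta34_neq0 tau : 0 < imC tau -> theta3 tau * theta4 tau != 0.
Proof.
move=> y0; apply/eqP => h0.
have h n : theta4 (iter_dbl n (dbl tau)) = 0.
  elim: n => [|n IH].
    have := theta34_dup y0; rewrite h0 /iter_dbl expr0 ofR1 mul1r => /eqP.
    by rewrite expf_eq0 => /eqP.
  have := theta34_dup (iter_dbl_gt0 n (dbl_gt0 y0)); rewrite -iter_dblS IH mulr0 => /eqP.
  by rewrite expf_eq0 => /eqP.
have /eqP := cvg_cst_eq h (theta4_infty (dbl_gt0 y0)).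
by rewrite eq_sym oner_eq0.
Qed.
Lemma theta3_neq0 tau : 0 < imC tau -> theta3 tau != 0.
Proof. by move=> /theta34_neq0; rewrite mulf_eq0 negb_or => /andP[]. Qed.
Lemma theta4_neq0 tau : 0 < imC tau -> theta4 tau != 0.
Proof. by move=> /theta34_neq0; rewrite mulf_eq0 negb_or => /andP[]. Qed.
Lemma theta2_neq0 tau : 0 < imC tau -> theta2 tau != 0.
Proof.
move=> y0; apply/eqP => h0.
have h n : theta2 (iter_dbl n tau) = 0.
  elim: n => [|n IH]; first by rewrite /iter_dbl expr0 ofR1 mul1r.
  have /eqP := theta2_dup (iter_dbl_gt0 n y0); rewrite -iter_dblS IH expr0n /= eq_sym !mulf_eq0 pnatr_eq0 /=.
  by rewrite (negPf (theta3_neq0 (iter_dbl_gt0 n.+1 y0))) orbF => /eqP.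
have h' n : qsum w2' one (iter_dbl n tau) = 0.
  have /eqP := h n; rewrite /theta2 (qsum_w2' (@qsummable2 R) (iter_dbl_gt0 n y0)) mulf_eq0.
  by rewrite (negPf (qe_neq0 _ _)) => /eqP.
have /eqP := cvg_cst_eq h' (theta2'_infty y0).
by rewrite eq_sym pnatr_eq0.
Qed.

Lemma dbl_der tau : is_derive tau 1 (@dbl R) (ofR 2).
Proof. by have := isdMl (ofR 2) (isd_id tau); rewrite mulr1. Qed.

Lemma comp_dbl_der (f : C -> C) tau a :
  is_derive (dbl tau) 1 f a -> is_derive tau 1 (fun t => f (dbl t)) (2%:R * a).
Proof. by move=> /(isd_comp (dbl_der tau)); rewrite ofR_nat mulrC. Qed.

Lemma dtheta3_dup tau : 0 < imC tau ->
  theta3 tau * dtheta3 tau = 2%:R * (theta3 (dbl tau) * dtheta3 (dbl tau) + theta2 (dbl tau) * dtheta2 (dbl tau)).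
Proof.
move=> y0; have z0 := dbl_gt0 y0.
have d3 := comp_dbl_der (theta3_der z0); have d2 := comp_dbl_der (theta2_der z0).
have h := is_derive_eqH y0 (@theta3_dup R) (isdX 2 (theta3_der y0)) (isdD (isdX 2 d3) (isdX 2 d2)).
rewrite /= !expr1 in h; apply: (mulfI (mulf_neq0 (_ : 2%:R != 0) ipi_neq0)); first by rewrite pnatr_eq0.
by transitivity (2%:R * theta3 tau * (ipi * dtheta3 tau)); [ring|rewrite h; ring].
Qed.
Lemma dtheta4_dup tau : 0 < imC tau ->
  theta4 tau * dtheta4 tau = 2%:R * (theta3 (dbl tau) * dtheta3 (dbl tau) - theta2 (dbl tau) * dtheta2 (dbl tau)).
Proof.
move=> y0; have z0 := dbl_gt0 y0.
have d3 := comp_dbl_der (theta3_der z0); have d2 := comp_dbl_der (theta2_der z0).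
have h := is_derive_eqH y0 (@theta4_dup R) (isdX 2 (theta4_der y0)) (isdB (isdX 2 d3) (isdX 2 d2)).
rewrite /= !expr1 in h; apply: (mulfI (mulf_neq0 (_ : 2%:R != 0) ipi_neq0)); first by rewrite pnatr_eq0.
by transitivity (2%:R * theta4 tau * (ipi * dtheta4 tau)); [ring|rewrite h; ring].
Qed.
Lemma dtheta2_dup tau : 0 < imC tau ->
  theta2 tau * dtheta2 tau = 2%:R * (dtheta2 (dbl tau) * theta3 (dbl tau) + theta2 (dbl tau) * dtheta3 (dbl tau)).
Proof.
move=> y0; have z0 := dbl_gt0 y0.
have d3 := comp_dbl_der (theta3_der z0); have d2 := comp_dbl_der (theta2_der z0).
have h := is_derive_eqH y0 (@theta2_dup R) (isdX 2 (theta2_der y0)) (isdMl 2%:R (isdM d2 d3)).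
rewrite /= !expr1 in h; apply: (mulfI (mulf_neq0 (_ : 2%:R != 0) ipi_neq0)); first by rewrite pnatr_eq0.
by transitivity (2%:R * theta2 tau * (ipi * dtheta2 tau)); [ring|rewrite h; ring].
Qed.

Definition log_ratio tau := (dtheta2 tau / theta2 tau - dtheta3 tau / theta3 tau) / theta4 tau ^+ 4.

(* Logarithmic differentiation of theta2^2/theta3^2 = 2w/(1+w^2), w = (theta2/theta3)(2 tau). *)
Lemma log_ratio_dbl tau : 0 < imC tau -> log_ratio (dbl tau) = log_ratio tau.
Proof.
move=> y0; have z0 := dbl_gt0 y0.
have n2 := theta2_neq0 y0; have n3 := theta3_neq0 y0; have n4 := theta4_neq0 y0.
have m2 := theta2_neq0 z0; have m3 := theta3_neq0 z0; have m4 := theta4_neq0 z0.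
have q3 := theta3_dup y0; have q4 := theta4_dup y0; have q34 := theta34_dup y0; have q2 := theta2_dup y0.
have r3 := dtheta3_dup y0; have r2 := dtheta2_dup y0.
rewrite /log_ratio.
have -> : dtheta2 tau / theta2 tau = dtheta2 (dbl tau) / theta2 (dbl tau) + dtheta3 (dbl tau) / theta3 (dbl tau).
  have -> : dtheta2 tau / theta2 tau = theta2 tau * dtheta2 tau / theta2 tau ^+ 2 by field.
  by rewrite r2 q2; field; rewrite m2 m3.
have s3 : theta3 (dbl tau) ^+ 2 + theta2 (dbl tau) ^+ 2 != 0 by rewrite -q3 expf_neq0.
have s4 : theta3 (dbl tau) ^+ 2 - theta2 (dbl tau) ^+ 2 != 0 by rewrite -q4 expf_neq0.
have -> : dtheta3 tau / theta3 tau = theta3 tau * dtheta3 tau / theta3 tau ^+ 2 by field.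
have -> : theta4 (dbl tau) ^+ 4 = theta3 tau ^+ 2 * theta4 tau ^+ 2.
  by rewrite -exprMn -q34 -exprM.
have -> : theta4 tau ^+ 4 = (theta4 tau ^+ 2) ^+ 2 by rewrite -exprM.
rewrite r3 q3 q4; move: (theta3 _) (theta2 _) (dtheta3 _) (dtheta2 _) m2 m3 s3 s4 => a b c d m2 m3 s3 s4.
by field; rewrite m2 m3 s3 s4.
Qed.

(* [log_ratio] is invariant under doubling, hence equal to its limit along 2^n tau. *)
Lemma log_ratioE tau : 0 < imC tau -> log_ratio tau = 4%:R^-1.
Proof.
move=> y0.
have h n : log_ratio (iter_dbl n tau) = log_ratio tau.
  elim: n => [|n IH]; first by rewrite /iter_dbl expr0 ofR1 mul1r.
  by rewrite iter_dblS log_ratio_dbl// iter_dbl_gt0.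
apply: (cvg_cst_eq h).
have E n : log_ratio (iter_dbl n tau) = (qsum w2' (wmul w2 one) (iter_dbl n tau) * (qsum w2' one (iter_dbl n tau))^-1
   - dtheta3 (iter_dbl n tau) * (theta3 (iter_dbl n tau))^-1) * (theta4 (iter_dbl n tau) * theta4 (iter_dbl n tau) * (theta4 (iter_dbl n tau) * theta4 (iter_dbl n tau)))^-1.
  rewrite /log_ratio /dtheta2 {1}/theta2 (qsum_w2' (@qsummable2 R) (iter_dbl_gt0 n y0)) (qsum_w2' qsummable2d (iter_dbl_gt0 n y0)).
  rewrite invfM mulrACA divff ?qe_neq0// mul1r.
  by congr (_ / _); ring.
have -> : 4%:R^-1 = (2%:R^-1 * 2%:R^-1 - 0 * 1^-1) * (1 * 1 * (1 * 1))^-1 :> C.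
  by field.
rewrite (funext E).
have c4 := theta4_infty y0; have n0 : (2%:R : C) != 0 by rewrite pnatr_eq0.
have n1 : (1 : C) != 0 by rewrite oner_eq0.
have n44 : (1 * 1 * (1 * 1) : C) != 0 by rewrite !mulr1.
exact: (cvgM (cvgB (cvgM (dtheta2'_infty y0) (cvgV n0 (theta2'_infty y0)))
  (cvgM (dtheta3_infty y0) (cvgV n1 (theta3_infty y0)))) (cvgV n44 (cvgM (cvgM c4 c4) (cvgM c4 c4)))).
Qed.

Lemma logder_theta2 tau : 0 < imC tau -> dtheta2 tau / theta2 tau = dtheta3 tau / theta3 tau + theta4 tau ^+ 4 / 4%:R.
Proof.
move=> y0; have := log_ratioE y0; rewrite /log_ratio => /(canRL (mulfVK (expf_neq0 4 (theta4_neq0 y0)))).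
by move/(canRL (subrK _)) => ->; ring.
Qed.

Lemma logder_theta4 tau : 0 < imC tau -> dtheta4 tau / theta4 tau = dtheta3 tau / theta3 tau - theta2 tau ^+ 4 / 4%:R.
Proof.
move=> y0; have z0 := dbl_gt0 y0.
have n2 := theta2_neq0 y0; have n3 := theta3_neq0 y0; have n4 := theta4_neq0 y0.
have m2 := theta2_neq0 z0; have m3 := theta3_neq0 z0; have m4 := theta4_neq0 z0.
have q3 := theta3_dup y0; have q4 := theta4_dup y0; have q34 := theta34_dup y0; have q2 := theta2_dup y0.
have -> : dtheta4 tau / theta4 tau = theta4 tau * dtheta4 tau / theta4 tau ^+ 2 by field.
have -> : dtheta3 tau / theta3 tau = theta3 tau * dtheta3 tau / theta3 tau ^+ 2 by field.
have -> : theta2 tau ^+ 4 = (theta2 tau ^+ 2) ^+ 2 by rewrite -exprM.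
rewrite (dtheta4_dup y0) (dtheta3_dup y0) q2.
have s3 : theta3 (dbl tau) ^+ 2 + theta2 (dbl tau) ^+ 2 != 0 by rewrite -q3 expf_neq0.
have s4 : theta3 (dbl tau) ^+ 2 - theta2 (dbl tau) ^+ 2 != 0 by rewrite -q4 expf_neq0.
have -> : dtheta2 (dbl tau) = theta2 (dbl tau) * (dtheta2 (dbl tau) / theta2 (dbl tau)) by field.
rewrite logder_theta2//.
have -> : theta4 (dbl tau) ^+ 4 = theta3 tau ^+ 2 * theta4 tau ^+ 2 by rewrite -exprMn -q34 -exprM.
rewrite q3 q4; move: (theta3 _) (theta2 _) (dtheta3 _) m2 m3 s3 s4 => a b c m2 m3 s3 s4.
by field; rewrite m3 s3 s4.
Qed.

Lemma logder_theta3_riccati tau : 0 < imC tau ->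
  ddtheta3 tau / theta3 tau - (dtheta3 tau / theta3 tau) ^+ 2 =
  2%:R * (dtheta3 tau / theta3 tau) ^+ 2 + theta2 tau ^+ 4 * theta4 tau ^+ 4 / 8%:R.
Proof.
move=> y0; have z0 := dbl_gt0 y0.
have n2 := theta2_neq0 y0; have n3 := theta3_neq0 y0; have n4 := theta4_neq0 y0.
have m2 := theta2_neq0 z0; have m3 := theta3_neq0 z0; have m4 := theta4_neq0 z0.
have q3 := theta3_dup y0; have q4 := theta4_dup y0; have q34 := theta34_dup y0; have q2 := theta2_dup y0.
have -> : ddtheta3 tau / theta3 tau - (dtheta3 tau / theta3 tau) ^+ 2 =
   (ddtheta3 tau * theta3 tau - dtheta3 tau ^+ 2) / theta3 tau ^+ 2 by field.
rewrite D2theta3_dup//.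
have -> : dtheta3 tau / theta3 tau = theta3 tau * dtheta3 tau / theta3 tau ^+ 2 by field.
have -> : theta2 tau ^+ 4 = (theta2 tau ^+ 2) ^+ 2 by rewrite -exprM.
have -> : theta4 tau ^+ 4 = (theta4 tau ^+ 2) ^+ 2 by rewrite -exprM.
rewrite (dtheta3_dup y0) q2 -/dtheta3 -/dtheta2.
have s3 : theta3 (dbl tau) ^+ 2 + theta2 (dbl tau) ^+ 2 != 0 by rewrite -q3 expf_neq0.
have -> : dtheta2 (dbl tau) = theta2 (dbl tau) * (dtheta2 (dbl tau) / theta2 (dbl tau)) by field.
rewrite logder_theta2//.
have -> : theta4 (dbl tau) ^+ 4 = theta3 tau ^+ 2 * theta4 tau ^+ 2 by rewrite -exprMn -q34 -exprM.
rewrite q3 q4; move: (theta3 _) (theta2 _) (dtheta3 _) m2 m3 s3 => a b c m2 m3 s3.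
by field; rewrite m3 s3.
Qed.
End Jacobi.

(** * The differential system for x, y and A *)

Section ThetaConstants.
Variable R : realType.
Local Notation C := (Cplx R).
Implicit Types (tau : C).
Local Notation w3 := (@w3 R).
Local Notation w2 := (@w2 R).
Local Notation one := (@one R).
Local Notation alt := (@alt R).
Local Notation theta2 := (@theta2 R).
Local Notation theta3 := (@theta3 R).
Local Notation theta4 := (@theta4 R).
Local Notation piC := (piC R).
Local Notation ipi := (ipi R).

Lemma thetaE tau : 0 < imC tau -> theta tau = theta3 tau.
Proof.
move=> y0; have E n : one n * qe (w3 n) tau = expC (piC * 'i * n%:~R ^+ 2 * tau).
  by rewrite qe_expC /w3 ofRX ofR_int mul1r.
rewrite /theta sumZE; first by apply: tsum_eq => n; rewrite E.
by apply: eq_asum (@qsummable3 R tau y0) => n; rewrite E.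
Qed.

Lemma xfunE tau : 0 < imC tau -> xfun tau = - theta4 tau ^+ 4.
Proof.
move=> y0; have E n : alt n * qe (w3 n) tau = (-1) ^ n * expC (piC * 'i * n%:~R ^+ 2 * tau).
  by rewrite qe_expC /w3 ofRX ofR_int.
rewrite /xfun sumZE; first by congr (- _ ^+ 4); apply: tsum_eq => n; rewrite E.
by apply: eq_asum (@qsummable4 R tau y0) => n; rewrite E.
Qed.

Lemma yfunE tau : 0 < imC tau -> yfun tau = theta2 tau ^+ 4.
Proof.
move=> y0; have E n : one n * qe (w2 n) tau = expC (piC * 'i * (n%:~R + 2%:R^-1) ^+ 2 * tau).
  by rewrite qe_expC /w2 ofRX ofRD ofRV ofR_int ofR_nat mul1r.
rewrite /yfun sumZE; first by congr (_ ^+ 4); apply: tsum_eq => n; rewrite E.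
by apply: eq_asum (@qsummable2 R tau y0) => n; rewrite E.
Qed.

Lemma theta_der tau : 0 < imC tau -> is_derive tau 1 (@theta R) (ipi * dtheta3 tau).
Proof.
move=> y0; apply: (isd_eqH y0 _ (theta3_der y0)) => z z0; by rewrite thetaE.
Qed.

Lemma theta_neq0 tau : 0 < imC tau -> theta tau != 0.
Proof. by move=> y0; rewrite thetaE// theta3_neq0. Qed.
Lemma xfun_neq0 tau : 0 < imC tau -> xfun tau != 0.
Proof. by move=> y0; rewrite xfunE// oppr_eq0 expf_neq0// theta4_neq0. Qed.

Lemma iC2 : ('i : C) * 'i = -1. Proof. by rewrite -expr2 sqrCi. Qed.
Lemma ipi2 : ipi * ipi = - piC ^+ 2.
Proof. by rewrite /ipi mulrACA iC2 expr2 mulrN1. Qed.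

Lemma AfunE tau : 0 < imC tau -> Afun tau = - 2%:R * piC ^+ 2 * (dtheta3 tau / theta3 tau).
Proof.
move=> y0; have hd : derive1 (@theta R) tau = ipi * dtheta3 tau.
  by rewrite derive1E; have h := theta_der y0; exact: derive_val.
rewrite /Afun /tfun hd thetaE//.
have := theta3_neq0 y0; have := piC_neq0 R; have := neq0Ci C; rewrite /ipi.
move: (theta3 _) (dtheta3 _) piC => t e p i0 p0 t0.
by field; rewrite i0 p0 t0.
Qed.

Lemma Afun_theta tau : 0 < imC tau -> is_derive tau 1 (@theta R) (theta tau * Afun tau / (2%:R * ipi)).
Proof.
move=> y0; apply: (is_derive_eq (theta_der y0)); rewrite AfunE// thetaE//.
have t0 := theta3_neq0 y0; have h := ipi2; have p0 := ipi_neq0 R.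
have -> : theta3 tau * (- 2%:R * piC ^+ 2 * (dtheta3 tau / theta3 tau)) = 2%:R * (- piC ^+ 2) * dtheta3 tau by field.
by rewrite -h; field.
Qed.

Lemma xfun_der tau : 0 < imC tau ->
  is_derive tau 1 (@xfun R) (xfun tau * (2%:R * Afun tau + piC ^+ 2 * yfun tau) / ipi).
Proof.
move=> y0; apply: (isd_eqH y0 (fun z hz => esym (xfunE hz))).
apply: (is_derive_eq (isdN (isdX 4 (theta4_der y0)))) => /=.
rewrite xfunE// yfunE// AfunE//; have t0 := theta4_neq0 y0.
have -> : dtheta4 tau = theta4 tau * (dtheta4 tau / theta4 tau) by field.
rewrite logder_theta4//; have t3 := theta3_neq0 y0; have p0 := ipi_neq0 R.
set P := dtheta3 tau / theta3 tau.
have -> : - theta4 tau ^+ 4 * (2%:R * (- 2%:R * piC ^+ 2 * P) + piC ^+ 2 * theta2 tau ^+ 4) =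
  - theta4 tau ^+ 4 * (4%:R * (- piC ^+ 2) * P - (- piC ^+ 2) * theta2 tau ^+ 4) by ring.
by rewrite -ipi2; field.
Qed.

Lemma yfun_der tau : 0 < imC tau ->
  is_derive tau 1 (@yfun R) (yfun tau * (2%:R * Afun tau + piC ^+ 2 * xfun tau) / ipi).
Proof.
move=> y0; apply: (isd_eqH y0 (fun z hz => esym (yfunE hz))).
apply: (is_derive_eq (isdX 4 (theta2_der y0))) => /=.
rewrite xfunE// yfunE// AfunE//; have t0 := theta2_neq0 y0.
have -> : dtheta2 tau = theta2 tau * (dtheta2 tau / theta2 tau) by field.
rewrite logder_theta2//; have t3 := theta3_neq0 y0; have p0 := ipi_neq0 R.
set P := dtheta3 tau / theta3 tau.
have -> : theta2 tau ^+ 4 * (2%:R * (- 2%:R * piC ^+ 2 * P) + piC ^+ 2 * (- theta4 tau ^+ 4)) =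
  theta2 tau ^+ 4 * (4%:R * (- piC ^+ 2) * P + (- piC ^+ 2) * theta4 tau ^+ 4) by ring.
by rewrite -ipi2; field.
Qed.

Lemma Afun_der tau : 0 < imC tau ->
  is_derive tau 1 (@Afun R) ((Afun tau ^+ 2 - piC ^+ 4 * xfun tau * yfun tau / 4%:R) / ipi).
Proof.
move=> y0; apply: (isd_eqH y0 (fun z hz => esym (AfunE hz))).
have t3 := theta3_neq0 y0.
apply: (is_derive_eq (isdMl _ (isdM (dtheta3_der y0) (isdV t3 (theta3_der y0))))).
rewrite xfunE// yfunE// AfunE//; have p0 := ipi_neq0 R.
have h := logder_theta3_riccati y0.
have -> : ipi * ddtheta3 tau / theta3 tau + dtheta3 tau * (- (ipi * dtheta3 tau) / theta3 tau ^+ 2) =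
  ipi * (ddtheta3 tau / theta3 tau - (dtheta3 tau / theta3 tau) ^+ 2) by field.
rewrite h; set P := dtheta3 tau / theta3 tau.
have -> : (- 2%:R * piC ^+ 2 * P) ^+ 2 - piC ^+ 4 * (- theta4 tau ^+ 4) * theta2 tau ^+ 4 / 4%:R =
  (- piC ^+ 2) ^+ 2 * (4%:R * P ^+ 2 + theta2 tau ^+ 4 * theta4 tau ^+ 4 / 4%:R) by field.
have -> : - 2%:R * piC ^+ 2 = 2%:R * (- piC ^+ 2) by ring.
by rewrite -ipi2; field.
Qed.

Lemma expC_2pi : expC (ofR (2 * pi) * 'i) = 1 :> C.
Proof.
rewrite mulrC expC_imR mulrC mulr_natr cos2pi sin2pi.
by rewrite ofR1 ofR0 mulr0 addr0.
Qed.
Lemma qe_nat_2 n : qe n%:R (2%:R : C) = 1.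
Proof.
rewrite qe_expC -[LHS](_ : expC (n%:R * (ofR (2 * pi) * 'i)) = _).
  by rewrite expCMn expC_2pi expr1n.
by congr expC; rewrite ofRM !ofR_nat /Defs.piC; ring.
Qed.
Lemma w3_nat n : w3 n = (absz n ^ 2)%:R.
Proof.
by rewrite /w3 natrX; case: n => k //; rewrite NegzR sqrrN -natr1.
Qed.
Lemma w2'_nat n : exists k : nat, w2' R n = k%:R.
Proof.
rewrite /w2'; case: n => k.
  by exists (k * (k + 1))%N; rewrite natrM natrD.
by exists ((k + 1) * k)%N; rewrite NegzR natrM natrD; ring.
Qed.
Lemma theta4_shift2 tau : theta4 (tau + 2%:R) = theta4 tau.
Proof. by apply: tsum_eq => n; rewrite qeD w3_nat qe_nat_2 mulr1. Qed.
Lemma theta2_shift2 tau : 0 < imC tau -> theta2 (tau + 2%:R) ^+ 4 = theta2 tau ^+ 4.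
Proof.
move=> y0; have -> : theta2 (tau + 2%:R) = qe (4^-1) 2%:R * theta2 tau.
  rewrite /theta2 /qsum -tsumMl; last exact: qsummable2.
  apply: tsum_eq => n; have [k hk] := w2'_nat n.
  rewrite qeD (_ : w2 n = 4^-1 + w2' R n); last by rewrite /w2 /w2'; field.
  by rewrite (qeDw _ _ 2%:R) hk qe_nat_2; ring.
rewrite exprMn; have -> : qe (4^-1) (2%:R : C) ^+ 4 = qe 1%:R 2%:R.
  rewrite !exprS expr0 mulr1 -!qeDw; congr qe; by field.
by rewrite qe_nat_2 mul1r.
Qed.

Lemma imC_nat n : imC (n%:R : C) = 0. Proof. by rewrite -ofR_nat imC_ofR. Qed.
Lemma xfun_shift2 tau : 0 < imC tau -> xfun (tau + 2%:R) = xfun tau.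
Proof. by move=> y0; rewrite !xfunE ?imCD ?imC_nat ?addr0// theta4_shift2. Qed.
Lemma yfun_shift2 tau : 0 < imC tau -> yfun (tau + 2%:R) = yfun tau.
Proof. by move=> y0; rewrite !yfunE ?imCD ?imC_nat ?addr0// theta2_shift2. Qed.

Lemma geo_aux (e y p : R) : 0 <= y -> y <= 1 -> 1 <= p -> e * (1 + p * y) <= 1 ->
  2 * y <= 2 * (1 + p) * (1 - e).
Proof.
move=> y0 y1 p1 h; have py : 0 <= p * y by rewrite mulr_ge0//; lra.
have h1 : 0 <= (1 + p * y) * ((1 + p) * (1 - e) - y).
  have : 0 <= (1 + p) * (1 - e * (1 + p * y)) by rewrite mulr_ge0//; lra.
  have : 0 <= y * (p ^+ 2 + p - 1 - p * y) by rewrite mulr_ge0//; nra.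
  by lra.
by rewrite pmulr_rge0 in h1; lra.
Qed.

Lemma qsum_bound (w : int -> R) (c : int -> C) tau :
  (forall n, (int_rk n)%:R <= w n) -> (forall n, normR (c n) <= 1) ->
  0 < imC tau < 1 -> normR (qsum w c tau) <= 2 * (1 + pi) / imC tau.
Proof.
move=> hw hc /andP[y0 y1].
apply: le_trans (hasum_norm_le (asum_tsum (qsummable_rkW hw hc y0)) (qsummable_rk hw hc y0)) _.
have p1 : 1 <= pi :> R by have := pi_ge2 R; lra.
have py : 0 < pi * imC tau by rewrite mulr_gt0// (lt_le_trans _ p1).
have h : expR (- (pi * imC tau)) * (1 + pi * imC tau) <= 1.
  rewrite expRN mulrC ler_pdivrMr ?expR_gt0// mul1r; exact: expR_ge1Dx.
have h1 : 0 < 1 - expR (- (pi * imC tau)) by rewrite subr_gt0 expR_lt1 oppr_lt0.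
rewrite ler_pdivrMr// mulrAC ler_pdivlMr//.
exact: (geo_aux (ltW y0) (ltW y1) p1 h).
Qed.

Lemma xfun_bound tau : 0 < imC tau < 1 -> normR (xfun tau) <= (2 * (1 + pi) / imC tau) ^+ 4.
Proof.
move=> hy; have y0 : 0 < imC tau by case/andP : hy.
by rewrite xfunE// normRN normRX lerXn2r ?nnegrE ?normR_ge0 ?(qsum_bound (@w3_rk R) (@alt_le R))//
 (le_trans (normR_ge0 (theta4 tau)))// (qsum_bound (@w3_rk R) (@alt_le R)).
Qed.
Lemma yfun_bound tau : 0 < imC tau < 1 -> normR (yfun tau) <= (2 * (1 + pi) / imC tau) ^+ 4.
Proof.
move=> hy; have y0 : 0 < imC tau by case/andP : hy.
by rewrite yfunE// normRX lerXn2r ?nnegrE ?normR_ge0 ?(qsum_bound (@w2_rk R) (@one_le R))//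
 (le_trans (normR_ge0 (theta2 tau)))// (qsum_bound (@w2_rk R) (@one_le R)).
Qed.
End ThetaConstants.

(** * Polya's proof of the theta functional equation *)

Section Wallis.
Variable R : realType.

Definition cbin (m : nat) : R := (m.*2)`!%:R / (m`!%:R ^+ 2).

Lemma cbin_gt0 m : 0 < cbin m.
Proof. by rewrite divr_gt0// ?exprn_gt0// ltr0n fact_gt0. Qed.

Lemma cbinS m : cbin m.+1 = cbin m * ((2 * m%:R + 2) * (2 * m%:R + 1) / (m%:R + 1) ^+ 2).
Proof.
rewrite /cbin doubleS !factS !natrM -(natr1 m) -(natr1 m.*2.+1) -(natr1 m.*2) -muln2 natrM.
have f0 : (m`!%:R : R) != 0 by rewrite pnatr_eq0 -lt0n fact_gt0.
have m0 : (m%:R + 1 : R) != 0 by rewrite natr1 pnatr_eq0.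
move: (m * 2)`!%:R (m`!%:R) (m%:R) f0 m0 => a b c f0 m0.
by field; rewrite f0 m0.
Qed.

Lemma cbin_bin m : 'C(m.*2, m)%:R = cbin m.
Proof.
have h : (m <= m.*2)%N by rewrite -addnn leq_addr.
rewrite /cbin -(bin_fact h) -addnn addnK !natrM.
have f0 : (m`!%:R : R) != 0 by rewrite pnatr_eq0 -lt0n fact_gt0.
by field.
Qed.

Definition wallis (m : nat) : R := m%:R * cbin m ^+ 2 / 16 ^+ m.

Lemma wallis_ndecr : nondecreasing_seq wallis.
Proof.
apply/nondecreasing_seqP => m; rewrite /wallis cbinS (exprS 16 m).
have c0 := cbin_gt0 m; have e0 : 0 < 16 ^+ m :> R by rewrite exprn_gt0.
move: (cbin m) (16 ^+ m) c0 e0 => c e c0 e0; rewrite -(natr1 m).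
have m0 : 0 <= m%:R :> R by []. move: (m%:R) m0 => x x0.
have -> : (x + 1) * (c * ((2 * x + 2) * (2 * x + 1) / (x + 1) ^+ 2)) ^+ 2 / (16 * e) =
  c ^+ 2 / e * ((2 * x + 1) ^+ 2 / (4 * (x + 1))).
  by field; apply/andP; split; rewrite gt_eqF//; lra.
have -> : x * c ^+ 2 / e = c ^+ 2 / e * x by field; rewrite gt_eqF.
apply: ler_wpM2l; first by rewrite divr_ge0 ?sqr_ge0// ltW.
rewrite ler_pdivlMr; nra.
Qed.

Lemma wallis_le1 m : wallis m <= 1.
Proof.
have h : (2 * m%:R + 1) * cbin m ^+ 2 / 16 ^+ m <= 1.
  elim: m => [|m IH]; first by rewrite /cbin /= expr0 mulr0 add0r mul1r !divr1 expr1n divr1 expr1n.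
  apply: le_trans IH; rewrite cbinS (exprS 16 m).
  have c0 := cbin_gt0 m; have e0 : 0 < 16 ^+ m :> R by rewrite exprn_gt0.
  move: (cbin m) (16 ^+ m) c0 e0 => c e c0 e0; rewrite -(natr1 m).
  have m0 : 0 <= m%:R :> R by []. move: (m%:R) m0 => x x0.
  have -> : (2 * (x + 1) + 1) * (c * ((2 * x + 2) * (2 * x + 1) / (x + 1) ^+ 2)) ^+ 2 / (16 * e) =
    c ^+ 2 / e * ((2 * x + 3) * (2 * x + 1) ^+ 2 / (4 * (x + 1) ^+ 2)).
    by field; apply/andP; split; rewrite gt_eqF//; lra.
  have -> : (2 * x + 1) * c ^+ 2 / e = c ^+ 2 / e * (2 * x + 1) by field; rewrite gt_eqF.
  apply: ler_wpM2l; first by rewrite divr_ge0 ?sqr_ge0// ltW.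
  rewrite ler_pdivrMr; last by rewrite mulr_gt0// exprn_gt0//; lra.
  have : 0 <= 2 * x + 1 by lra.
  nra.
apply: le_trans h; rewrite /wallis; apply: ler_wpM2r.
  by rewrite invr_ge0 exprn_ge0.
by apply: ler_wpM2r; rewrite ?sqr_ge0//; have : 0 <= m%:R :> R by []; lra.
Qed.

Lemma wallis_cvg : exists W : R, wallis @ \oo --> W.
Proof.
have h : cvgn wallis.
  apply: (nondecreasing_is_cvgn wallis_ndecr); exists 1 => x [m _ <-].
  exact: wallis_le1.
by exists (limn wallis).
Qed.
End Wallis.

Section Trig.
Variable R : realType.
Implicit Types (x : R).

Lemma der_ge0_le (f df : R -> R) (a b : R) : a <= b ->
  (forall t : R, a <= t <= b -> is_derive t 1 f (df t)) ->
  (forall t, a <= t <= b -> 0 <= df t) -> f a <= f b.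
Proof.
move=> ab hd h0; have hc : {within `[a, b], continuous f}.
  by apply: derivable_within_continuous => t; rewrite in_itv /= => /hd[].
have hi t : t \in `]a, b[ -> is_derive t 1 f (df t).
  by rewrite in_itv /= => /andP[ta tb]; apply: hd; rewrite !ltW.
have [c] := MVT_segment ab hi hc; rewrite in_itv /= => /h0 c0 e.
by rewrite -subr_ge0 e mulr_ge0// subr_ge0.
Qed.

Lemma sin_lex x : 0 <= x -> sin x <= x.
Proof.
move=> x0; suff : (fun t : R => t - sin t) 0 <= (fun t => t - sin t) x by rewrite /= sin0; lra.
have hd (t : R) : is_derive t 1 (fun t : R => t - sin t) (1 - cos t).
  exact: (is_deriveB (is_derive_id t (1 : R)) (is_derive_sin t)).
apply: (der_ge0_le (f := fun t => t - sin t) (df := fun t => 1 - cos t)) ; first exact: x0.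
by move=> t _; have := cos_le1 t; lra.
Qed.

Lemma xcos_lesin x : 0 <= x <= pi -> x * cos x <= sin x.
Proof.
move=> /andP[x0 x1].
suff : (fun t : R => sin t - t * cos t) 0 <= (fun t => sin t - t * cos t) x by rewrite /= sin0; lra.
have hd (t : R) : is_derive t 1 (fun t : R => sin t - t * cos t) (t * sin t).
  apply: (is_derive_eq (is_deriveB (is_derive_sin t) (is_deriveM (is_derive_id t (1 : R)) (is_derive_cos t)))).
  by rewrite /GRing.scale /=; ring.
apply: (der_ge0_le (f := fun t => sin t - t * cos t) (df := fun t => t * sin t)); first exact: x0.
move=> t /andP[t0 t1].
by rewrite mulr_ge0// sin_ge0_pi// t0 (le_trans t1).
Qed.

Lemma cos2_upper x : 0 <= x <= pi / 2 -> cos x ^+ 2 <= expR (- (x ^+ 2 / (1 + x ^+ 2))).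
Proof.
move=> /andP[x0 x1]; have p0 := pi_ge0 R.
have c0 : 0 <= cos x by apply: cos_ge0_pihalf; apply/andP; split => //; lra.
have h : x * cos x <= sin x by apply: xcos_lesin; apply/andP; split => //; lra.
have h2 : x ^+ 2 * cos x ^+ 2 <= sin x ^+ 2.
  by rewrite -exprMn lerXn2r ?nnegrE ?mulr_ge0// (le_trans _ h)// mulr_ge0.
have h3 : cos x ^+ 2 * (1 + x ^+ 2) <= 1 by have := cos2Dsin2 x; lra.
apply: le_trans (expR_ge1Dx _).
have p1 : 0 < 1 + x ^+ 2 by have := sqr_ge0 x; lra.
have -> : 1 + - (x ^+ 2 / (1 + x ^+ 2)) = (1 + x ^+ 2)^-1 by field; rewrite gt_eqF.
by rewrite -[leRHS]mul1r ler_pdivlMr.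
Qed.

Lemma expR_lower (a : R) : a < 1 -> expR (- (a / (1 - a))) <= 1 - a.
Proof.
move=> a1; have h := expR_ge1Dx (a / (1 - a)).
have p : 0 < 1 - a by lra.
have e : 1 + a / (1 - a) = (1 - a)^-1 by field; rewrite gt_eqF.
rewrite e in h; by rewrite expRN -[leRHS]invrK lef_pV2 ?posrE ?expR_gt0 ?invr_gt0.
Qed.

Lemma cos2_lower x : 0 <= x < 1 -> expR (- (x ^+ 2 / (1 - x ^+ 2))) <= cos x ^+ 2.
Proof.
move=> /andP[x0 x1]; apply: le_trans (expR_lower _) _; first by rewrite expr_lt1.
have p0 := pi_ge2 R.
have s0 : 0 <= sin x by apply: sin_ge0_pi; apply/andP; split => //; lra.
have : sin x ^+ 2 <= x ^+ 2 by rewrite lerXn2r ?nnegrE// sin_lex.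
by have := cos2Dsin2 x; lra.
Qed.

Lemma inv_quad_sum (c : R) n : 0 < c ->
  \sum_(0 <= j < n) (1 + c * j%:R ^+ 2)^-1 <= 2 + 4 / c.
Proof.
move=> c0; pose K : R := 2 + 4 / c; have K0 : 0 < K by rewrite addr_gt0// divr_gt0.
apply: le_trans (_ : K * (1 - (n%:R + 1)^-1) <= _); last first.
  by apply: ler_piMr; [exact: ltW|rewrite lerBlDr lerDl invr_ge0 addr_ge0].
elim: n => [|n IH]; first by rewrite big_geq// add0r invr1 subrr mulr0.
rewrite big_nat_recr //=; apply: le_trans (lerD IH (lexx _)) _.
rewrite -(natr1 n); have n0 : 0 <= n%:R :> R by [].
have nn : n%:R <= n%:R ^+ 2 :> R by rewrite -natrX ler_nat; case: (n) => // k; rewrite leq_pmulr.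
move: (n%:R) n0 nn => x x0 xx {IH}.
have -> : K * (1 - (x + 1 + 1)^-1) = K * (1 - (x + 1)^-1) + K / ((x + 1) * (x + 1 + 1)).
  by field; apply/andP; split; rewrite gt_eqF//; lra.
have q0 : 0 < 1 + c * x ^+ 2 by have := mulr_ge0 (ltW c0) (sqr_ge0 x); lra.
rewrite lerD2l -[leLHS]mul1r ler_pdivrMr// mulrAC ler_pdivlMr ?mulr_gt0//; try lra.
have cK : K * c = 2 * c + 4 by rewrite /K; field; rewrite gt_eqF.
have -> : K * (1 + c * x ^+ 2) = K + K * c * x ^+ 2 by ring.
rewrite cK; have : 2 <= K by rewrite /K lerDl divr_ge0// ltW.
have := mulr_ge0 (ltW c0) (sqr_ge0 x); nra.
Qed.
End Trig.

Section FiniteFourier.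
Variable R : realType.
Local Notation C := (Cplx R).

Lemma asum_finite (T : choiceType) (f : T -> C) (A : {fset T}) :
  (forall i, i \notin A -> f i = 0) -> asum f.
Proof.
move=> h; exists (\sum_(i <- A) normR (f i)) => B.
apply: le_trans (ler_fsum _ (fsubsetUr A B)) _; first by move=> i; exact: normR_ge0.
rewrite (big_fsetDr _ (fsubsetUl A B)) [X in _ + X](_ : _ = 0) ?addr0//.
by rewrite big_seq big1// => i; rewrite !inE => /andP[/h ->]; rewrite normR0.
Qed.

Lemma tsum_nat_fin (n : nat) (f : nat -> C) : (forall i, (n <= i)%N -> f i = 0) ->
  asum f /\ tsum f = \sum_(0 <= i < n) f i.
Proof.
move=> h; have memL (L0 : seq nat) x : (x \in [fset x in L0]%fset) = (x \in L0) by rewrite inE.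
have h' i : i \notin [fset i in index_iota 0 n]%fset -> f i = 0.
  by rewrite memL mem_index_iota leq0n /= -leqNgt => /h.
split; first exact: asum_finite h'.
rewrite (hasum_tsum (hasum_finite h')); apply: perm_big; apply: uniq_perm.
- exact: fset_uniq.
- exact: iota_uniq.
- by move=> x; rewrite memL.
Qed.

Lemma root_sum l (z : C) : z ^+ l = 1 ->
  \sum_(0 <= j < l) z ^+ j = if z == 1 then l%:R else 0.
Proof.
move=> zl; case: eqP => [->|/eqP z1].
  by under eq_bigr do rewrite expr1n; rewrite sumr_const_nat subn0.
have h : (z - 1) * \sum_(0 <= j < l) z ^+ j = 0.
  by rewrite big_mkord -subrX1 zl subrr.
by move/eqP : h; rewrite mulf_eq0 subr_eq0 (negPf z1) => /eqP.
Qed.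

Definition zeta (l : nat) : C := expC ('i * ofR (2 * pi / l%:R)).

Lemma zetaX l e : zeta l ^+ e = expC ('i * ofR (2 * pi * (e%:R / l%:R))).
Proof. by rewrite -expCMn; congr expC; rewrite !ofRM !ofR_nat; ring. Qed.

Lemma zetal l : (0 < l)%N -> zeta l ^+ l = 1.
Proof.
move=> l0; rewrite zetaX divff ?pnatr_eq0 -?lt0n// mulr1 expC_imR.
by rewrite mulrC mulr_natr cos2pi sin2pi ofR1 ofR0 mulr0 addr0.
Qed.

Lemma zeta_eq1 l e : (0 < l)%N -> (zeta l ^+ e == 1) = (l %| e)%N.
Proof.
move=> l0; have E : zeta l ^+ e = zeta l ^+ (e %% l).
  by rewrite {1}(divn_eq e l) exprD mulnC exprM zetal// expr1n mul1r.
rewrite E /dvdn; case: (posnP (e %% l)) => [->|r0]; first by rewrite expr0 eqxx.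
have rl := ltn_pmod e l0; move: (e %% l)%N r0 rl => r r0 rl {E}.
apply/eqP => h.
have h1 := congr1 (@reC R) h; rewrite zetaX expC_imR in h1.
pose y := pi * (r%:R / l%:R) : R.
have lp : 0 < l%:R :> R by rewrite ltr0n.
have y0 : 0 < y by rewrite mulr_gt0 ?pi_gt0// divr_gt0// ltr0n.
have y1 : y < pi.
  by rewrite gtr_pMr ?pi_gt0// ltr_pdivrMr// mul1r ltr_nat.
have s0 : 0 < sin y by apply: sin_gt0_pi; rewrite y0 y1.
have e2 : 2 * pi * (r%:R / l%:R) = y *+ 2 by rewrite mulr2n /y; ring.
rewrite e2 cos_mulr2n reCD reC_ofR reCM reCi imCi imC_ofR -ofR1 reC_ofR in h1.
have := cos2Dsin2 y; have : 0 < sin y ^+ 2 by rewrite exprn_gt0.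
have h2 : cos y ^+ 2 *+ 2 = 2 * cos y ^+ 2 by rewrite mulr_natl.
rewrite h2 reC_ofR mul0r mulr0 in h1; lra.
Qed.

Lemma cos_zeta l j : (0 < l)%N ->
  ofR (2 * cos (pi * (j%:R / l%:R))) ^+ 2 = zeta l ^+ ((l - 1) * j) * (1 + zeta l ^+ j) ^+ 2 :> C.
Proof.
move=> l0; set x := pi * (j%:R / l%:R).
pose E : C := expC ('i * ofR x).
have E0 : E != 0 by exact: expC_neq0.
have zE : zeta l ^+ j = E ^+ 2.
  by rewrite zetaX -expCMn; congr expC; rewrite /x !ofRM !ofR_nat; ring.
have zi : zeta l ^+ ((l - 1) * j) = (E ^+ 2)^-1.
  rewrite -zE; apply: (mulIf (expf_neq0 j (expC_neq0 ('i * ofR (2 * pi / l%:R))))).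
  rewrite -/(zeta l) mulVf ?expf_neq0 ?expC_neq0// -exprD -mulSnr subn1 prednK//.
  by rewrite exprM zetal// expr1n.
have cE : ofR (2 * cos x) = E + E^-1.
  rewrite /E -expCN -mulrN -ofRN !expC_imR cosN sinN ofRN mulrN ofRM ofR_nat; ring.
by rewrite zi zE cE; field.
Qed.

Lemma cos_sum l m : (0 < l)%N ->
  \sum_(0 <= j < l) ofR ((2 * cos (pi * (j%:R / l%:R))) ^+ (m.*2)) =
  l%:R * \sum_(0 <= k < (m.*2).+1) (if (l %| k + (l - 1) * m)%N then 'C(m.*2, k)%:R else 0) :> C.
Proof.
move=> l0.
have E j : ofR ((2 * cos (pi * (j%:R / l%:R))) ^+ (m.*2)) =
   \sum_(0 <= k < (m.*2).+1) 'C(m.*2, k)%:R * (zeta l ^+ (k + (l - 1) * m)) ^+ j :> C.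
  rewrite -mul2n exprM ofRX ofRX cos_zeta// exprMn -!exprM big_mkord.
  rewrite exprDn big_distrr /=; apply: eq_bigr => i _.
  rewrite expr1n mul1r -mulr_natl mulrCA -!exprM -exprD; congr (_ * _ ^+ _).
  by rewrite mulnDl addnC -mulnA (mulnC j m) mulnA (mulnC j i).
under eq_bigr do rewrite E.
rewrite exchange_big /= big_distrr /=; apply: eq_bigr => k _.
rewrite -big_distrr /= root_sum; last by rewrite -exprM mulnC exprM zetal// expr1n.
by rewrite zeta_eq1//; case: ifP => _; [rewrite mulrC|rewrite !mulr0].
Qed.

Lemma cos_sum_fold N m : let l := (N.*2).+1 in
  \sum_(0 <= j < l) ofR ((2 * cos (pi * (j%:R / l%:R))) ^+ (m.*2)) =
  2%:R * (\sum_(0 <= j < N.+1) ofR ((2 * cos (pi * (j%:R / l%:R))) ^+ (m.*2))) - ofR (4 ^+ m) :> C.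
Proof.
move=> l; pose a j : C := ofR ((2 * cos (pi * (j%:R / l%:R))) ^+ (m.*2)).
have l0 : (l%:R : R) != 0 by rewrite pnatr_eq0.
have sym j : (j <= l)%N -> a (l - j)%N = a j.
  move=> jl; rewrite /a natrB// mulrBl divff// mulrBr mulr1 cosB cospi sinpi.
  by rewrite mul0r addr0 mulN1r mulrN -mul2n !exprM sqrrN.
have a0 : a 0%N = ofR (4 ^+ m).
  rewrite /a mul0r mulr0 cos0 mulr1 -mul2n exprM; congr (ofR (_ ^+ m)); ring.
have lE : l = (N.+1 + N)%N by rewrite /l -addnn addSn.
rewrite -/(a) (@big_cat_nat _ _ _ N.+1)//=; last by rewrite lE leq_addr.
have -> : \sum_(N.+1 <= j < l) a j = \sum_(0 <= j < N) a j.+1.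
  rewrite big_nat_rev /= -{1}[N.+1]add0n big_addn.
  rewrite (_ : (l - N.+1)%N = N); last by rewrite lE addKn.
  rewrite big_nat_cond [RHS]big_nat_cond; apply: eq_bigr => j; rewrite andbT => /andP[_ jN].
  rewrite -sym; first by congr a; lia.
  by lia.
have -> : \sum_(0 <= j < N) a j.+1 = \sum_(0 <= j < N.+1) a j - a 0%N.
  by rewrite [in RHS]big_nat_recl//= addrAC subrr add0r.
by rewrite a0; ring.
Qed.

Lemma bin_sum_fold l m : (0 < l)%N ->
  \sum_(0 <= k < (m.*2).+1) (if (l %| k + (l - 1) * m)%N then 'C(m.*2, k)%:R else 0) =
  2%:R * tsum (fun i => 'C(m.*2, m + i * l)%:R) - 'C(m.*2, m)%:R :> C.
Proof.
move=> l0; pose f (k : nat) : C := if (l %| k + (l - 1) * m)%N then 'C(m.*2, k)%:R else 0.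
transitivity (\sum_(0 <= k < (m.*2).+1) f k) => //.
pose h (K : nat) : C := if (l %| K)%N then 'C(m.*2, m + K)%:R else 0.
have lm : ((l - 1) * m + m = l * m)%N by rewrite -mulSnr subn1 prednK.
have hz i : (m.+1 <= i)%N -> h i = 0.
  by move=> mi; rewrite /h bin_small ?if_same//; lia.
have [ha hs] := tsum_nat_fin hz.
have -> : tsum (fun i : nat => 'C(m.*2, m + i * l)%:R) = tsum h.
  rewrite [RHS](tsum_reindex (h := fun i : nat => (i * l)%N)) //.
  - by apply: tsum_eq => i; rewrite /h dvdn_mull.
  - by move=> i j /eqP; rewrite eqn_pmul2r// => /eqP.
  - move=> t ht; rewrite /h; case: ifP => // /dvdnP[q tq].
    by case: (ht q).
have -> : 'C(m.*2, m)%:R = h 0%N by rewrite /h dvdn0 addn0.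
rewrite (@big_cat_nat _ _ _ m)//=; last by lia.
have -> : \sum_(m <= k < (m.*2).+1) f k = \sum_(0 <= k < m.+1) h k.
  rewrite -{1}[m]add0n big_addn (_ : ((m.*2).+1 - m)%N = m.+1); last by lia.
  apply: eq_bigr => K _; rewrite /f /h -addnA (addnC m) lm dvdn_addl ?dvdn_mulr//.
  by rewrite addnC.
have -> : \sum_(0 <= k < m) f k = \sum_(0 <= k < m) h k.+1.
  rewrite big_nat_rev /= big_nat_cond [RHS]big_nat_cond; apply: eq_bigr => k; rewrite andbT => /andP[_ km].
  rewrite /f /h add0n -(bin_sub (m := m + k.+1)); last by lia.
  rewrite (_ : (m.*2 - (m + k.+1))%N = (m - k.+1)%N); last by lia.
  congr (if _ then _ else _); apply: dvdn_add_eq.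
  have -> : (m - k.+1 + (l - 1) * m + k.+1 = l * m)%N by rewrite -lm; lia.
  by rewrite dvdn_mulr.
have -> : \sum_(0 <= k < m) h k.+1 = \sum_(0 <= k < m.+1) h k - h 0%N.
  by rewrite [in RHS]big_nat_recl//= addrAC subrr add0r.
by rewrite hs; ring.
Qed.

Definition poly_u (N m : nat) (j : nat) : R :=
  if (j <= N)%N then cos (pi * (j%:R / (N.*2).+1%:R)) ^+ (m.*2) else 0.
Definition poly_v (N m : nat) (i : nat) : R :=
  'C(m.*2, m + i * (N.*2).+1)%:R / cbin R m.

(* Both sides count binomial coefficients along a residue class mod 2N+1, once by
   roots of unity and once directly; [poly_u] and [poly_v] are extended by 0. *)
Lemma polya_identity N m :
  2%:R * tsum (fun j => ofR (poly_u N m j)) - 1 =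
  ofR ((N.*2).+1%:R * cbin R m / 4 ^+ m) * (2%:R * tsum (fun i => ofR (poly_v N m i)) - 1) :> C.
Proof.
set l := (N.*2).+1; have l0 : (0 < l)%N by [].
have h1 := cos_sum_fold N m; rewrite /= -/l cos_sum// bin_sum_fold// in h1.
have f0 : (4 ^+ m : R) != 0 by rewrite expf_neq0// pnatr_eq0.
have F0 : (ofR (4 ^+ m) : C) != 0 by rewrite -ofR0 (inj_eq (@ofR_inj _)).
have c0 : cbin R m != 0 by rewrite gt_eqF// cbin_gt0.
have C0 : (ofR (cbin R m) : C) != 0 by rewrite -ofR0 (inj_eq (@ofR_inj _)).
have uz i : (N.+1 <= i)%N -> ofR (poly_u N m i) = 0 :> C.
  by move=> hi; rewrite /poly_u leqNgt hi /= ofR0.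
have [ua us] := tsum_nat_fin uz.
have su : \sum_(0 <= j < N.+1) ofR ((2 * cos (pi * (j%:R / l%:R))) ^+ (m.*2)) =
    ofR (4 ^+ m) * tsum (fun j => ofR (poly_u N m j)) :> C.
  rewrite us big_distrr /= big_nat_cond [RHS]big_nat_cond; apply: eq_bigr => j; rewrite andbT => /andP[_ jN].
  rewrite -ofRM; congr ofR; rewrite /poly_u -ltnS jN exprMn; congr (_ * _).
  by rewrite -mul2n exprM; congr (_ ^+ m); ring.
have sv : tsum (fun i : nat => 'C(m.*2, m + i * l)%:R) = ofR (cbin R m) * tsum (fun i => ofR (poly_v N m i)) :> C.
  rewrite -tsumMl.
    apply: tsum_eq => i; rewrite -ofRM /poly_v -ofR_nat; congr ofR.
    by rewrite mulrC divfK.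
  have vz i : (m.+1 <= i)%N -> ofR (poly_v N m i) = 0 :> C.
    by move=> hi; rewrite /poly_v bin_small ?mul0r ?ofR0//; nia.
  by have [] := tsum_nat_fin vz.
rewrite su sv -(@ofR_nat R 'C(m.*2, m)) cbin_bin in h1.
rewrite (ofRM (l%:R * cbin R m)) (ofRM l%:R) ofRV ofR_nat.
by apply: (mulfI F0); rewrite mulrBr mulr1 mulrCA -h1; field.
Qed.
End FiniteFourier.

Section BinBounds.
Variable R : realType.
Implicit Types m K M : nat.

Definition bin_ratio m K : R := 'C(m.*2, m + K)%:R / cbin R m.

Lemma bin_ratio0 m : bin_ratio m 0 = 1.
Proof. by rewrite /bin_ratio addn0 cbin_bin divff// gt_eqF// cbin_gt0. Qed.

Lemma bin_ratioS m K : (K <= m)%N -> bin_ratio m K.+1 = bin_ratio m K * ((m%:R - K%:R) / (m%:R + K%:R + 1)).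
Proof.
move=> Km; have c0 : cbin R m != 0 by rewrite gt_eqF// cbin_gt0.
have h := mul_bin_left m.*2 (m + K); rewrite (_ : (m.*2 - (m + K))%N = (m - K)%N) in h; last by lia.
have {h} := congr1 (fun n : nat => n%:R : R) h; rewrite /= !natrM natrB// -(natr1 (m + K)) natrD.
rewrite /bin_ratio addnS => h.
have m0 : m%:R + K%:R + 1 != 0 :> R by rewrite -natrD natr1 pnatr_eq0.
apply: (mulfI m0); move: h; set d := _ + _ + 1 in m0 *; clearbody d => h.
by rewrite mulrA h; field; rewrite c0 m0.
Qed.

Lemma bin_ratio_ge0 m K : 0 <= bin_ratio m K.
Proof. by rewrite divr_ge0// ltW// cbin_gt0. Qed.

Lemma bin_ratio_upper m M K : (K <= M)%N -> (M <= m)%N -> (0 < m)%N ->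
  bin_ratio m K <= expR (- (K%:R ^+ 2 / (m%:R + M%:R))).
Proof.
move=> + Mm m0; elim: K => [|K IH] KM; first by rewrite bin_ratio0 expr0n mul0r oppr0 expR0.
have m1 : 1 <= m%:R :> R by rewrite ler1n.
have k0 : 0 <= K%:R :> R by []. have kM : K%:R + 1 <= M%:R :> R by rewrite natr1 ler_nat.
have mM : M%:R <= m%:R :> R by rewrite ler_nat.
rewrite bin_ratioS ?(leq_trans (ltnW KM))// -(natr1 K).
apply: le_trans (_ : expR (- (K%:R ^+ 2 / (m%:R + M%:R))) * expR (- ((2 * K%:R + 1) / (m%:R + M%:R))) <= _); last first.
  rewrite -expRD ler_expR le_eqVlt; apply/orP; left; apply/eqP.
  by field; rewrite gt_eqF//; lra.
apply: ler_pM; [exact: bin_ratio_ge0| |exact: IH (ltnW KM)|].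
  by rewrite divr_ge0//; lra.
apply: le_trans (expR_ge1Dx _).
have -> : (m%:R - K%:R) / (m%:R + K%:R + 1) = 1 - (2 * K%:R + 1) / (m%:R + K%:R + 1) :> R.
  by field; rewrite gt_eqF//; lra.
rewrite lerD2l lerN2; apply: ler_wpM2l; first by lra.
by rewrite lef_pV2 ?posrE; lra.
Qed.

Lemma bin_ratio_lower m M K : (K <= M)%N -> (M < m)%N ->
  expR (- (K%:R ^+ 2 / (m%:R - M%:R))) <= bin_ratio m K.
Proof.
move=> + Mm; elim: K => [|K IH] KM; first by rewrite bin_ratio0 expr0n mul0r oppr0 expR0.
have k0 : 0 <= K%:R :> R by []. have kM : K%:R + 1 <= M%:R :> R by rewrite natr1 ler_nat.
have mM : M%:R + 1 <= m%:R :> R by rewrite natr1 ler_nat.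
have Km : (K <= m)%N by lia.
rewrite bin_ratioS// -(natr1 K).
apply: le_trans (_ : expR (- (K%:R ^+ 2 / (m%:R - M%:R))) * expR (- ((2 * K%:R + 1) / (m%:R - M%:R))) <= _).
  rewrite -expRD ler_expR le_eqVlt; apply/orP; left; apply/eqP.
  by field; rewrite gt_eqF//; lra.
apply: ler_pM; [exact: expR_ge0|exact: expR_ge0|exact: IH (ltnW KM)|].
have -> : (m%:R - K%:R) / (m%:R + K%:R + 1) = (1 + (2 * K%:R + 1) / (m%:R - K%:R))^-1 :> R.
  by field; apply/andP; split; rewrite gt_eqF//; lra.
rewrite expRN lef_pV2 ?posrE ?expR_gt0//; last first.
  by rewrite addr_gt0// divr_gt0//; lra.
apply: le_trans (expR_ge1Dx _) _; rewrite ler_expR; apply: ler_wpM2l; first by lra.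
by rewrite lef_pV2 ?posrE; lra.
Qed.

Lemma expR_quad (a b : R) : 0 <= b <= a -> expR (- a) <= (1 + b)^-1.
Proof.
move=> /andP[b0 ba]; rewrite expRN lef_pV2 ?posrE ?expR_gt0//; last by lra.
by apply: le_trans (expR_ge1Dx _); lra.
Qed.
End BinBounds.

Section Limit.
Variables (R : realType) (s : R).
Hypothesis s0 : 0 < s.
Local Notation C := (Cplx R).
Let t := s / pi.
Let l (N : nat) : nat := (N.*2).+1.
Let m (N : nat) : nat := (Num.truncn ((l N)%:R ^+ 2 * t)).+1.
Let mu N : R := (m N)%:R / (l N)%:R ^+ 2.
Let la N : R := (l N)%:R^-1.

Let t0 : 0 < t. Proof. by rewrite divr_gt0// pi_gt0. Qed.
Let l0 N : 0 < (l N)%:R :> R. Proof. by rewrite ltr0n. Qed.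
Let la_gt0 N : 0 < la N. Proof. by rewrite invr_gt0. Qed.
Let la_le1 N : la N <= 1. Proof. by rewrite invf_le1// ler1n. Qed.

Let m_itv N : (l N)%:R ^+ 2 * t <= (m N)%:R <= (l N)%:R ^+ 2 * t + 1.
Proof.
have h := truncn_itv (mulr_ge0 (sqr_ge0 (l N)%:R) (ltW t0)).
by case/andP: h => h1 h2; rewrite (ltW h2) /= /m -natr1 lerD2r.
Qed.

Let la_cvg : la @ \oo --> (0 : R).
Proof.
apply: (squeeze_cvgr _ (cvg_cst 0) (@cvg_harmonic R)); apply: nearW => N.
rewrite (ltW (la_gt0 N)) /= /la /harmonic /= lef_pV2 ?posrE// ler_nat /l; lia.
Qed.

Let mu_itv N : t <= mu N <= t + la N.
Proof.
have /andP[h1 h2] := m_itv N; have lp : 0 < (l N)%:R ^+ 2 :> R by rewrite exprn_gt0.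
rewrite /mu ler_pdivlMr// mulrC h1 /= ler_pdivrMr// mulrDl (mulrC t).
apply: le_trans h2 _; rewrite lerD2l expr2 mulrA mulVf ?gt_eqF// mul1r ler1n //.
Qed.

Let mu_cvg : mu @ \oo --> t.
Proof.
have h : (fun N => t + la N) @ \oo --> t + 0 by exact: (cvgD (cvg_cst t) la_cvg).
rewrite addr0 in h.
by apply: (squeeze_cvgr _ (cvg_cst t) h); apply: nearW => N; exact: mu_itv.
Qed.

Lemma expR_cvgN (f : nat -> R) a : f @ \oo --> a -> (fun n => expR (- f n)) @ \oo --> expR (- a).
Proof. by move=> fa; apply: continuous_cvg; [exact: continuous_expR|exact: (cvgN fa)]. Qed.

Lemma asum_quad (c : R) : 0 < c -> asum (fun j : nat => ofR ((1 + c * j%:R ^+ 2)^-1) : C).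
Proof.
move=> c0; apply: (asum_nat (M := 2 + 4 / c)) => n.
apply: le_trans (inv_quad_sum n c0); apply: ler_sum => j _.
by rewrite normR_ofR ger0_norm// invr_ge0 addr_ge0// mulr_ge0 ?sqr_ge0// ltW.
Qed.

Definition th_term (r : R) (j : nat) : C := ofR (expR (- (pi * j%:R ^+ 2 * r))).

Lemma polya_u_cvg : (fun N => tsum (fun j => ofR (poly_u R N (m N) j))) @ \oo --> tsum (th_term s).
Proof.
have p2 := pi_ge2 R; have p0 := pi_gt0 R.
pose x N j : R := pi * (j%:R / (l N)%:R).
have x0 N j : 0 <= x N j by rewrite mulr_ge0 ?pi_ge0// divr_ge0.
have mx N j : (m N)%:R * x N j ^+ 2 = pi ^+ 2 * j%:R ^+ 2 * mu N.
  by rewrite /x /mu; have := gt_eqF (l0 N) => h; move: ((l N)%:R) h (pi : R) => a h p; field; rewrite h.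
have up N j : (j <= N)%N -> poly_u R N (m N) j <= expR (- (pi ^+ 2 * j%:R ^+ 2 * mu N / (1 + x N j ^+ 2))).
  move=> jN; rewrite /poly_u jN -mx -(mul2n (m N)) exprM.
  have xp : 0 <= x N j <= pi / 2.
    rewrite x0 /x ler_wpM2l ?pi_ge0// ler_pdivrMr// mulrC -ler_pdivrMr// invrK -natrM ler_nat /l; lia.
  have h := lerXn2r (m N) (_ : _ \in Num.nneg) (_ : _ \in Num.nneg) (cos2_upper xp).
  have {}h := h (sqr_ge0 _) (expR_ge0 _).
  apply: le_trans h _; rewrite -expRM_natr ler_expR le_eqVlt; apply/orP; left; apply/eqP.
  by field; rewrite gt_eqF//; have := sqr_ge0 (x N j); lra.
have lo N j : (j <= N)%N -> x N j < 1 -> expR (- (pi ^+ 2 * j%:R ^+ 2 * mu N / (1 - x N j ^+ 2))) <= poly_u R N (m N) j.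
  move=> jN x1; rewrite /poly_u jN -mx -(mul2n (m N)) exprM.
  have xp : 0 <= x N j < 1 by rewrite x0.
  have h := lerXn2r (m N) (_ : _ \in Num.nneg) (_ : _ \in Num.nneg) (cos2_lower xp).
  have {}h := h (expR_ge0 _) (sqr_ge0 _).
  apply: le_trans _ h; rewrite -expRM_natr ler_expR le_eqVlt; apply/orP; left; apply/eqP.
  have : x N j ^+ 2 < 1 by rewrite expr_lt1.
  by move=> h1; field; rewrite gt_eqF//; lra.
have u0 N j : 0 <= poly_u R N (m N) j.
  by rewrite /poly_u; case: ifP => // _; rewrite -(mul2n (m N)) exprM exprn_ge0 ?sqr_ge0.
pose c := t * pi ^+ 2 / 5; have c0 : 0 < c by rewrite divr_gt0// mulr_gt0// exprn_gt0.
apply: (proj2 (tannery (asum_quad c0) _ _)) => [N j|j].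
  rewrite !normR_ofR !ger0_norm ?u0//; last first.
    by rewrite invr_ge0 addr_ge0// mulr_ge0 ?sqr_ge0// ltW.
  have [jN|jN] := leqP j N; last first.
    rewrite /poly_u leqNgt jN /= invr_ge0 addr_ge0// mulr_ge0 ?sqr_ge0// ltW//.
  apply: le_trans (up N j jN) _; apply: expR_quad.
  rewrite mulr_ge0 ?sqr_ge0 ?(ltW c0)//= ler_pdivlMr; last by have := sqr_ge0 (x N j); lra.
  have x2 : x N j ^+ 2 <= 2 ^+ 2.
    rewrite lerXn2r ?nnegrE//; apply: le_trans (ltW (@pihalf_lt2 R)).
    rewrite /x ler_wpM2l ?pi_ge0// ler_pdivrMr// mulrC -ler_pdivrMr// invrK -natrM ler_nat /l; lia.
  apply: le_trans (_ : c * j%:R ^+ 2 * 5 <= _).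
    by apply: ler_wpM2l; [rewrite mulr_ge0 ?sqr_ge0// ltW|lra].
  have -> : c * j%:R ^+ 2 * 5 = pi ^+ 2 * j%:R ^+ 2 * t by rewrite /c; field.
  by apply: ler_wpM2l; [rewrite mulr_ge0 ?sqr_ge0|case/andP: (mu_itv N)].
apply: cvg_ofR.
have hx : (fun N => x N j) @ \oo --> (0 : R).
  have -> : (fun N => x N j) = (fun N => pi * j%:R * la N) by apply/funext => N; rewrite /x /la mulrA.
  rewrite -[0](mulr0 (pi * j%:R)); exact: (cvgM (cvg_cst (pi * j%:R)) la_cvg).
have hmu : (fun N => pi ^+ 2 * j%:R ^+ 2 * mu N) @ \oo --> pi * j%:R ^+ 2 * s.
  have -> : pi * j%:R ^+ 2 * s = pi ^+ 2 * j%:R ^+ 2 * t.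
    by rewrite /t; move: p0; move: (pi : R) => p p0; field; rewrite gt_eqF.
  exact: (cvgM (cvg_cst (pi ^+ 2 * j%:R ^+ 2)) mu_cvg).
have n1 : (1 + 0 * 0 : R) != 0 by rewrite mulr0 addr0 oner_eq0.
have n2 : (1 - 0 * 0 : R) != 0 by rewrite mulr0 subr0 oner_eq0.
have hup : (fun N => expR (- (pi ^+ 2 * j%:R ^+ 2 * mu N / (1 + x N j * x N j)))) @ \oo --> expR (- (pi * j%:R ^+ 2 * s)).
  have h : (fun N => pi ^+ 2 * j%:R ^+ 2 * mu N / (1 + x N j * x N j)) @ \oo --> pi * j%:R ^+ 2 * s / (1 + 0 * 0).
    exact: (cvgM hmu (cvgV n1 (cvgD (cvg_cst (1 : R)) (cvgM hx hx)))).
  by rewrite mulr0 addr0 divr1 in h; exact: expR_cvgN.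
have hlo : (fun N => expR (- (pi ^+ 2 * j%:R ^+ 2 * mu N / (1 - x N j * x N j)))) @ \oo --> expR (- (pi * j%:R ^+ 2 * s)).
  have h : (fun N => pi ^+ 2 * j%:R ^+ 2 * mu N / (1 - x N j * x N j)) @ \oo --> pi * j%:R ^+ 2 * s / (1 - 0 * 0).
    exact: (cvgM hmu (cvgV n2 (cvgB (cvg_cst (1 : R)) (cvgM hx hx)))).
  by rewrite mulr0 subr0 divr1 in h; exact: expR_cvgN.
apply: (squeeze_cvgr _ hlo hup).
near=> N; have jN : (j <= N)%N by near: N; exact: nbhs_infty_ge.
have x1 : x N j < 1 by near: N; exact: (cvgr_lt 0 hx 1 ltr01).
by rewrite -!expr2 lo// up.
Unshelve. all: by end_near. Qed.

Lemma polya_v_cvg : (fun N => tsum (fun i => ofR (poly_v R N (m N) i))) @ \oo --> tsum (th_term s^-1).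
Proof.
have p0 := pi_gt0 R.
have vE N i : poly_v R N (m N) i = bin_ratio R (m N) (i * l N) by [].
have E1 N i : (i * l N)%:R ^+ 2 / ((m N)%:R + (i * l N)%:R) = i%:R ^+ 2 / (mu N + i%:R * la N) :> R.
  have m1 : 0 < (m N)%:R :> R by rewrite ltr0n.
  have i0 : 0 <= i%:R :> R by [].
  have := l0 N; rewrite natrM /mu /la; move: ((l N)%:R) ((m N)%:R) (i%:R) m1 i0 => a b c b0 c0 a0.
  have ca : 0 <= c * a by rewrite mulr_ge0// ltW.
  by field; rewrite gt_eqF//=; rewrite gt_eqF//; lra.
have E2 N i : (i * l N < m N)%N -> (i * l N)%:R ^+ 2 / ((m N)%:R - (i * l N)%:R) = i%:R ^+ 2 / (mu N - i%:R * la N) :> R.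
  rewrite -(ltr_nat R) natrM /mu /la => h.
  have := l0 N; move: ((l N)%:R) ((m N)%:R) (i%:R) h => a b c h a0.
  by field; rewrite (gt_eqF a0) /=; rewrite gt_eqF//; lra.
have up N i : (i * l N <= m N)%N -> bin_ratio R (m N) (i * l N) <= expR (- (i%:R ^+ 2 / (mu N + i%:R * la N))).
  by move=> h; rewrite -E1; exact: bin_ratio_upper.
have lo N i : (i * l N < m N)%N -> expR (- (i%:R ^+ 2 / (mu N - i%:R * la N))) <= bin_ratio R (m N) (i * l N).
  by move=> h; rewrite -E2//; exact: bin_ratio_lower.
pose c := (2 * (t + 1))^-1; have c0 : 0 < c by rewrite invr_gt0 mulr_gt0// addr_gt0.
apply: (proj2 (tannery (asum_quad c0) _ _)) => [N i|i].
  have ci : 0 <= c * i%:R ^+ 2 by rewrite mulr_ge0 ?sqr_ge0// ltW.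
  rewrite !normR_ofR !ger0_norm; last 2 first.
  - by rewrite invr_ge0 addr_ge0.
  - exact: bin_ratio_ge0.
  have [iN|iN] := leqP (i * l N) (m N); last first.
    by rewrite vE /bin_ratio bin_small ?mul0r ?invr_ge0 ?addr_ge0//; lia.
  rewrite vE; apply: le_trans (up N i iN) _; apply: expR_quad; rewrite ci /=.
  have /andP[m1 m2] := mu_itv N.
  have il : i%:R * la N <= mu N.
    rewrite /mu /la ler_pdivlMr ?exprn_gt0// expr2 -mulrA mulKf ?gt_eqF//.
    by rewrite -natrM ler_nat.
  have i0 : 0 <= i%:R * la N by rewrite mulr_ge0// ltW.
  have la1 := la_le1 N.
  rewrite /c mulrC; apply: ler_wpM2l; first exact: sqr_ge0.
  move: t0 m1 m2 il i0 la1; move: (la N) (i%:R * la N) (mu N) (t) => a b d e ? ? ? ? ? ?.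
  by rewrite lef_pV2 ?posrE; lra.
apply: cvg_ofR.
have hi : (fun N => i%:R * la N) @ \oo --> (i%:R * 0 : R).
  exact: (cvgM (cvg_cst (i%:R : R)) la_cvg).
rewrite mulr0 in hi.
have tE : pi * i%:R ^+ 2 * s^-1 = i%:R ^+ 2 / t.
  by rewrite /t; move: (pi : R) p0 => p p0; field; rewrite !gt_eqF.
have hp : (fun N => mu N + i%:R * la N) @ \oo --> t + 0 by exact: (cvgD mu_cvg hi).
have hm : (fun N => mu N - i%:R * la N) @ \oo --> t - 0 by exact: (cvgB mu_cvg hi).
rewrite addr0 in hp; rewrite subr0 in hm.
have tn : t != 0 by rewrite gt_eqF.
have hup : (fun N => expR (- (i%:R ^+ 2 / (mu N + i%:R * la N)))) @ \oo --> expR (- (pi * i%:R ^+ 2 * s^-1)).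
  by apply: expR_cvgN; rewrite tE; exact: (cvgM (cvg_cst ((i%:R : R) ^+ 2)) (cvgV tn hp)).
have hlo : (fun N => expR (- (i%:R ^+ 2 / (mu N - i%:R * la N)))) @ \oo --> expR (- (pi * i%:R ^+ 2 * s^-1)).
  by apply: expR_cvgN; rewrite tE; exact: (cvgM (cvg_cst ((i%:R : R) ^+ 2)) (cvgV tn hm)).
apply: (squeeze_cvgr _ hlo hup).
near=> N; have hN : 0 < mu N - i%:R * la N by near: N; exact: (cvgr_gt t hm 0 t0).
have iN : (i * l N < m N)%N.
  rewrite -(ltr_nat R) natrM; move: hN; rewrite subr_gt0 /mu /la ltr_pdivlMr ?exprn_gt0//.
  by rewrite expr2 -mulrA mulKf ?gt_eqF.
by rewrite vE lo//= up// ltnW.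
Unshelve. all: by end_near. Qed.

Lemma wallis_m_cvg (W : R) : wallis R @ \oo --> W -> (fun N => wallis R (m N)) @ \oo --> W.
Proof.
move=> hW; apply/cvgrPdist_lt => e e0; move/cvgrPdist_lt : hW => /(_ e e0) [M _ hM].
near=> N; apply: hM => /=; rewrite -(ler_nat R).
case/andP: (m_itv N) => h _; apply: le_trans h.
have hN : M%:R / t <= N%:R by near: N; exact: nbhs_infty_ger.
move: hN; rewrite ler_pdivrMr// => hN; apply: le_trans hN _; apply: ler_wpM2r; first exact: ltW.
rewrite -natrX ler_nat /l; nia.
Unshelve. all: by end_near. Qed.

Lemma polya_limit (W : R) : wallis R @ \oo --> W ->
  (2%:R * tsum (th_term s) - 1) ^+ 2 = ofR (pi * W / s) * (2%:R * tsum (th_term s^-1) - 1) ^+ 2.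
Proof.
move=> hW; have p0 := pi_gt0 R.
have hk : (fun N => ofR ((mu N)^-1 * wallis R (m N)) : C) @ \oo --> (ofR (t^-1 * W) : C).
  by apply: cvg_ofR; exact: (cvgM (cvgV (lt0r_neq0 t0) mu_cvg) (wallis_m_cvg hW)).
have hl := polya_u_cvg; have hr := polya_v_cvg.
have c2 := cvg_cst (2%:R : C); have c1 := cvg_cst (1 : C).
pose F N : C := 2%:R * tsum (fun j => ofR (poly_u R N (m N) j)) - 1.
pose G N : C := 2%:R * tsum (fun j => ofR (poly_v R N (m N) j)) - 1.
have hF : (fun N => F N * F N) @ \oo --> (2%:R * tsum (th_term s) - 1) * (2%:R * tsum (th_term s) - 1).
  have h1 : F @ \oo --> 2%:R * tsum (th_term s) - 1.
    exact: (cvgB (cvgM (cvg_cst (2%:R : C)) hl) (cvg_cst (1 : C))).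
  exact: (cvgM h1 h1).
have hG : (fun N => ofR ((mu N)^-1 * wallis R (m N)) * (G N * G N)) @ \oo -->
    ofR (t^-1 * W) * ((2%:R * tsum (th_term s^-1) - 1) * (2%:R * tsum (th_term s^-1) - 1)).
  have h1 : G @ \oo --> 2%:R * tsum (th_term s^-1) - 1.
    exact: (cvgB (cvgM (cvg_cst (2%:R : C)) hr) (cvg_cst (1 : C))).
  exact: (cvgM hk (cvgM h1 h1)).
have FG N : F N * F N = ofR ((mu N)^-1 * wallis R (m N)) * (G N * G N).
  rewrite /F polya_identity -/(G N) mulrACA -ofRM; congr (ofR _ * _).
  rewrite /wallis /mu.
  have l1 := l0 N; have m1 : 0 < (m N)%:R :> R by rewrite ltr0n.
  have -> : (16 : R) ^+ m N = (4 ^+ m N) ^+ 2 by rewrite -exprM mulnC exprM; congr (_ ^+ _); ring.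
  have e1 : 0 < 4 ^+ m N :> R by rewrite exprn_gt0.
  move: ((l N)%:R) ((m N)%:R) (4 ^+ m N) (cbin R (m N)) l1 m1 e1 => a b d e a0 b0 d0.
  by field; rewrite !gt_eqF.
rewrite (funext FG) in hF.
have := cvg_unique (@norm_hausdorff _ _) hF hG; rewrite -!expr2 => ->.
by congr (ofR _ * _); rewrite /t; move: (pi : R) p0 => p p0; field; rewrite !gt_eqF.
Qed.
End Limit.

(** * Values at i *)

Section RealPath.
Variable R : realType.
Local Notation C := (Cplx R).

Lemma is_derive_cvgR (f : R -> R) (x l : R) : is_derive x 1 f l <->
  (fun h => h^-1 * (f (h + x) - f x)) @ 0^' --> l.
Proof.
have E : (fun h => h^-1 *: ((f \o shift x) (h *: (1 : R)) - f x)) = (fun h => h^-1 * (f (h + x) - f x)).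
  by apply/funext => h; rewrite /= /GRing.scale /= mulr1.
split=> [[hd <-]|h]; first by move: hd; rewrite /derivable /derive E.
have hc : cvg ((fun h => h^-1 *: ((f \o shift x) (h *: (1 : R)) - f x)) @ 0^').
  by rewrite E; apply/cvg_ex; exists l.
apply: DeriveDef; first exact: hc.
by rewrite /derive E; apply: cvg_lim; [exact: norm_hausdorff|exact: h].
Qed.

Lemma path_cvg (F : C -> C) (a d : C) (r : R) (l : C) : is_derive (a + ofR r * d) 1 F l ->
  (fun h : R => ofR h^-1 * (F (a + ofR (h + r) * d) - F (a + ofR r * d))) @ 0^' --> l * d.
Proof.
move=> /is_derive_cvg/cvgCP hF; set x := a + ofR r * d in hF *.
have E h : a + ofR (h + r) * d = ofR h * d + x by rewrite /x ofRD mulrDl addrCA.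
have [d0|d0] := eqVneq d 0.
  rewrite (_ : (fun h => _) = fun=> 0); last by apply/funext => h; rewrite E d0 mulr0 add0r subrr mulr0.
  by rewrite d0 mulr0; exact: cvg_cst.
apply/cvgCP => e e0; have nd : 0 < normR d by rewrite normR_gt0.
have [g g0 hg] := hF _ (divr_gt0 e0 nd).
have [g' g'0 gE] := lt0_ofR g0.
exists (g' / normR d); first by rewrite /= divr_gt0.
move=> h /=; rewrite sub0r normrN ltr_pdivlMr// => hh h0.
have ofh0 : ofR h != 0 :> C by rewrite -ofR0 (inj_eq (@ofR_inj _)).
have := hg (ofR h * d); rewrite /= sub0r normrN gE ltr_norm_ofR normRM normR_ofR => /(_ hh).
rewrite mulf_neq0// => /(_ isT); rewrite E ltr_pdivlMr// -normRM.
by congr (normR _ < _); rewrite mulrBl ofRV; field; rewrite ofh0 d0.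
Qed.

Lemma path_derive_re (F : C -> C) (a d : C) (r : R) (l : C) : is_derive (a + ofR r * d) 1 F l ->
  is_derive r 1 (fun r : R => reC (F (a + ofR r * d))) (reC (l * d)).
Proof.
move=> /path_cvg h; apply/is_derive_cvgR; have := @cvg_reC _ _ _ _ _ _ h.
rewrite (_ : (fun x : R => reC _) = (fun h => h^-1 * (reC (F (a + ofR (h + r) * d)) - reC (F (a + ofR r * d))))).
  by apply.
by apply/funext => x; rewrite reC_ofRM reCB.
Qed.
Lemma path_derive_im (F : C -> C) (a d : C) (r : R) (l : C) : is_derive (a + ofR r * d) 1 F l ->
  is_derive r 1 (fun r : R => imC (F (a + ofR r * d))) (imC (l * d)).
Proof.
move=> /path_cvg h; apply/is_derive_cvgR; have := @cvg_imC _ _ _ _ _ _ h.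
rewrite (_ : (fun x : R => imC _) = (fun h => h^-1 * (imC (F (a + ofR (h + r) * d)) - imC (F (a + ofR r * d))))).
  by apply.
by apply/funext => x; rewrite imC_ofRM imCB.
Qed.
End RealPath.

Section AtI.
Variable R : realType.
Local Notation C := (Cplx R).
Local Notation theta2 := (@theta2 R).
Local Notation theta3 := (@theta3 R).
Local Notation theta4 := (@theta4 R).
Local Notation ipi := (ipi R).
(* Written with [0 +] to be an instance of the paths a + r d of the previous section. *)
Definition imag_axis (r : R) : C := 0 + ofR r * 'i.

Lemma imC_imag_axis r : imC (imag_axis r) = r.
Proof. by rewrite /imag_axis add0r imC_ofRM imCi mulr1. Qed.

Lemma tsum_int (f : int -> C) : asum f ->
  tsum f = tsum (fun k => f (Posz k)) + tsum (fun k => f (Negz k)).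
Proof.
move=> hf; have hp : asum (fun k => f (Posz k)) by apply: asum_inj hf => ? ? [].
have hn : asum (fun k => f (Negz k)) by apply: asum_inj hf => ? ? [].
by rewrite -sumZE// /sumZ (cvg_lim _ (tsum_nat hp)) ?(cvg_lim _ (tsum_nat hn)) //; exact: norm_hausdorff.
Qed.

Lemma theta3_imag_axis r : 0 < r -> theta3 (imag_axis r) = 2%:R * tsum (th_term r) - 1.
Proof.
move=> r0; have y0 : 0 < imC (imag_axis r) by rewrite imC_imag_axis.
have E k : one R (Posz k) * qe (w3 R (Posz k)) (imag_axis r) = th_term r k.
  rewrite /one mul1r qe_expC /th_term -expC_ofR; congr expC.
  rewrite /imag_axis add0r /w3 -[(Posz k)%:~R]/(k%:R) /Defs.piC.
  transitivity ('i * 'i * (ofR pi * ofR (k%:R ^+ 2) * ofR r) : C); first by ring.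
  by rewrite iC2 -!ofRM mulN1r ofRN.
have hp : asum (@th_term R r).
  have h := asum_inj (h := Posz) _ (qsummable3 y0); apply: eq_asum (h _); last by move=> ? ? [].
  by move=> k; exact: E.
rewrite /theta3 /qsum (tsum_int (qsummable3 y0)); under [tsum _]tsum_eq => k do rewrite E.
have -> : tsum (fun k => one R (Negz k) * qe (w3 R (Negz k)) (imag_axis r)) = tsum (fun k => th_term r k.+1).
  apply: tsum_eq => k; rewrite -E /w3 NegzR sqrrN natr1 //.
have -> : tsum (fun k => th_term r k.+1) = tsum (th_term r) - 1.
  have t0 : th_term r 0 = 1 by rewrite /th_term expr0n /= mulr0 mul0r oppr0 expR0 ofR1.
  by rewrite [in RHS](tsum_recl hp) t0 addrAC subrr add0r.
by ring.
Qed.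

Lemma theta3_functional r : 0 < r -> theta3 (imag_axis r) ^+ 2 = ofR r^-1 * theta3 (imag_axis r^-1) ^+ 2.
Proof.
have [W hW] := wallis_cvg R.
have h s : 0 < s -> theta3 (imag_axis s) ^+ 2 = ofR (pi * W / s) * theta3 (imag_axis s^-1) ^+ 2.
  by move=> s0; rewrite !theta3_imag_axis ?invr_gt0//; exact: polya_limit.
have pW : pi * W = 1.
  apply: (@ofR_inj R); have := h 1 ltr01; rewrite invr1 mulr1 ofR1.
  have n3 : theta3 (imag_axis 1) ^+ 2 != 0 by rewrite expf_neq0// theta3_neq0// imC_imag_axis.
  by move=> e; apply: (mulIf n3); rewrite -e mul1r.
by move=> r0; rewrite h// pW mul1r.
Qed.

Lemma imag_axis1 : imag_axis 1 = 'i. Proof. by rewrite /imag_axis add0r ofR1 mul1r. Qed.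
Lemma dbl_imag_axis r : dbl (imag_axis r) = imag_axis (2 * r).
Proof. by rewrite /dbl /imag_axis !add0r mulrA -ofRM. Qed.

Lemma xfun_i : xfun 'i = - yfun 'i :> C.
Proof.
rewrite -imag_axis1 xfunE ?yfunE ?imC_imag_axis//; congr (- _).
have -> : theta4 (imag_axis 1) ^+ 4 = (theta4 (imag_axis 1) ^+ 2) ^+ 2 by rewrite -exprM.
have -> : theta2 (imag_axis 1) ^+ 4 = (theta2 (imag_axis 1) ^+ 2) ^+ 2 by rewrite -exprM.
congr (_ ^+ 2).
have p1 : 0 < imC (imag_axis 1) by rewrite imC_imag_axis.
have p2 : 0 < imC (imag_axis 2^-1) by rewrite imC_imag_axis.
have e1 := theta3_dup p1; have e2 := theta4_dup p1; have e3 := theta3_dup p2.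
rewrite !dbl_imag_axis mulr1 in e1 e2; rewrite dbl_imag_axis divff ?pnatr_eq0// in e3.
have e4 : theta3 (imag_axis 2^-1) ^+ 2 = ofR 2 * theta3 (imag_axis 2) ^+ 2.
  by rewrite theta3_functional ?invr_gt0// invrK.
rewrite e4 in e3; rewrite e2.
have -> : theta2 (imag_axis 1) ^+ 2 = ofR 2 * theta3 (imag_axis 2) ^+ 2 - theta3 (imag_axis 1) ^+ 2 by rewrite e3 addrAC subrr add0r.
by rewrite e1 ofR_nat; ring.
Qed.

(* The hypothesis is differentiated at its fixed point r = 1. *)
Lemma fun_eq_deriv (f : R -> R) (a : R) : is_derive (1 : R) 1 f a ->
  (forall r, 0 < r -> f r = r^-1 * f r^-1) -> a = - f 1 - a.
Proof.
move=> fa h; have n1 : (1 : R) != 0 by exact: oner_neq0.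
have dv : is_derive (1 : R) 1 (fun r : R => r^-1) (- 1 / 1 ^+ 2) := isdV n1 (isd_id (1 : R)).
have fa' : is_derive ((1 : R)^-1) 1 f a by rewrite invr1.
have dc : is_derive (1 : R) 1 (fun r : R => f r^-1) (a * (- 1 / 1 ^+ 2)).
  exact: (is_derive1_comp fa' dv).
have dm := isdM dv dc.
have dg : is_derive (1 : R) 1 f (- 1 / 1 ^+ 2 * f 1^-1 + 1^-1 * (a * (- 1 / 1 ^+ 2))).
  apply: near_eq_is_derive dm; near=> r; rewrite -h//.
  by near: r; apply: lt_nbhsr; exact: ltr01.
have := @derive_val _ _ _ _ _ _ _ dg; rewrite (@derive_val _ _ _ _ _ _ _ fa) => EE.
by rewrite {1}EE !invr1 expr1n divr1; ring.
Unshelve. all: by end_near. Qed.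

Lemma Afun_i : Afun 'i = - ofR (pi / 2) :> C.
Proof.
have p1 : 0 < imC (imag_axis 1) by rewrite imC_imag_axis.
pose L := 2%:R * theta3 (imag_axis 1) ^+ 1 * (ipi * dtheta3 (imag_axis 1)).
have hd : is_derive (imag_axis 1) 1 (fun t => theta3 t ^+ 2) L := isdX 2 (theta3_der p1).
have hr := fun_eq_deriv (path_derive_re hd); have hi := fun_eq_deriv (path_derive_im hd).
have {}hr : reC (L * 'i) = - reC (theta3 (imag_axis 1) ^+ 2) - reC (L * 'i).
  apply: hr => r r0; rewrite -/(imag_axis r) -/(imag_axis r^-1) theta3_functional// reC_ofRM //.
have {}hi : imC (L * 'i) = - imC (theta3 (imag_axis 1) ^+ 2) - imC (L * 'i).
  apply: hi => r r0; rewrite -/(imag_axis r) -/(imag_axis r^-1) theta3_functional// imC_ofRM //.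
have hL : L * 'i = - theta3 (imag_axis 1) ^+ 2 - L * 'i.
  by apply: Cplx_eq; rewrite ?reCB ?reCN ?imCB ?imCN.
rewrite -imag_axis1 AfunE//; have n3 := theta3_neq0 p1.
have e : dtheta3 (imag_axis 1) / theta3 (imag_axis 1) * (4%:R * (piC R)) = 1.
  have hL2 : 2%:R * (L * 'i) = - theta3 (imag_axis 1) ^+ 2 by rewrite mulr_natl mulr2n {1}hL subrK.
  have : 4%:R * theta3 (imag_axis 1) * dtheta3 (imag_axis 1) * piC R * ('i * 'i) = - theta3 (imag_axis 1) ^+ 2.
    by rewrite -hL2 /L ipiE; ring.
  rewrite iC2 => hE; apply: (mulIf (expf_neq0 2 n3)); rewrite mul1r -[RHS]opprK -hE.
  by field.
transitivity (- piC R / 2%:R * (dtheta3 (imag_axis 1) / theta3 (imag_axis 1) * (4%:R * piC R))); first by field.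
by rewrite e mulr1 ofRM ofRV ofR_nat /Defs.piC mulNr.
Qed.
End AtI.

(** * Uniqueness for the differential system *)

Section Uniqueness.
Variable R : realType.
Local Notation C := (Cplx R).

Lemma gronwall0 (N dN : R -> R) (K : R) :
  (forall t : R, 0 <= t <= 1 -> is_derive t 1 N (dN t)) ->
  (forall t, 0 <= t <= 1 -> dN t <= K * N t) -> N 0 = 0 -> N 1 <= 0.
Proof.
move=> hN hK N0; pose F (t : R) := - (N t * expR (- K * t)).
have hF (t : R) : 0 <= t <= 1 -> is_derive t 1 F (- (dN t * expR (- K * t) + N t * (- K * 1 * expR (- K * t)))).
  move=> ht; apply: isdN; apply: isdM; first exact: hN.
  have h := is_derive1_comp (is_derive_expR (- K * t)) (isdMl (- K) (isd_id t)).
  by rewrite mulrC; exact: h.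
have : F 0 <= F 1.
  apply: (der_ge0_le ler01 hF) => t ht.
  rewrite [X in 0 <= - X](_ : _ = (dN t - K * N t) * expR (- K * t)); last by ring.
  by rewrite oppr_ge0 mulr_le0_ge0 ?expR_ge0 ?subr_le0 ?hK.
rewrite /F N0 mul0r oppr0 oppr_ge0 pmulr_lle0// expR_gt0 //.
Qed.

Definition dotC (z w : C) : R := reC z * reC w + imC z * imC w.

Lemma dotC_le z w : dotC z w <= normR z * normR w.
Proof.
have [h|h] := leP 0 (dotC z w); last by rewrite (le_trans (ltW h))// mulr_ge0 ?normR_ge0.
rewrite -(@ler_pXn2r _ 2) ?nnegrE ?mulr_ge0 ?normR_ge0// exprMn !sqr_normR /dotC.
have := sqr_ge0 (reC z * imC w - imC z * reC w); nra.
Qed.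

Lemma path_derive_sqn (F : C -> C) (a d : C) (r : R) (l : C) : is_derive (a + ofR r * d) 1 F l ->
  is_derive r 1 (fun r : R => normR (F (a + ofR r * d)) ^+ 2) (2%:R * dotC (F (a + ofR r * d)) (l * d)).
Proof.
move=> h; have hr := isdX 2 (path_derive_re h); have hi := isdX 2 (path_derive_im h).
rewrite (_ : (fun r : R => _) = (fun r : R => reC (F (a + ofR r * d)) ^+ 2 + imC (F (a + ofR r * d)) ^+ 2)).
  by rewrite /dotC mulrDr !mulrA; exact: (isdD hr hi).
by apply/funext => t; rewrite sqr_normR.
Qed.

Lemma path_bound (F l : C -> C) (a d : C) :
  (forall r : R, 0 <= r <= 1 -> is_derive (a + ofR r * d) 1 F (l (a + ofR r * d))) ->
  exists2 M : R, 0 <= M & forall r, 0 <= r <= 1 -> normR (F (a + ofR r * d)) <= M.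
Proof.
move=> h; have hc : {within `[(0 : R), 1], continuous (fun r : R => normR (F (a + ofR r * d)) ^+ 2)}.
  by apply: derivable_within_continuous => t; rewrite in_itv /= => /h/path_derive_sqn[].
have [c _ hM] := EVT_max ler01 hc; exists (normR (F (a + ofR c * d)) ^+ 2 + 1) => [|r hr].
  by rewrite addr_ge0// sqr_ge0.
have /hM : r \in `[0, 1] by rewrite in_itv.
have := normR_ge0 (F (a + ofR r * d)); nra.
Qed.

Lemma normRM_le (z w : C) (a b : R) : normR z <= a -> normR w <= b -> normR (z * w) <= a * b.
Proof. by move=> h1 h2; rewrite normRM ler_pM ?normR_ge0. Qed.
Lemma normRD_le (z w : C) (a b : R) : normR z <= a -> normR w <= b -> normR (z + w) <= a + b.
Proof. by move=> h1 h2; rewrite (le_trans (normRD _ _))// lerD. Qed.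

Lemma sqr_sum3_le (a b c : R) : (a + b + c) ^+ 2 <= 3%:R * (a ^+ 2 + b ^+ 2 + c ^+ 2).
Proof.
have := sqr_ge0 (a - b); have := sqr_ge0 (a - c); have := sqr_ge0 (b - c); lra.
Qed.

Definition halphen (x y A : C -> C) := forall tau, 0 < imC tau ->
  [/\ is_derive tau 1 x (x tau * (2%:R * A tau + piC R ^+ 2 * y tau) / ipi R),
      is_derive tau 1 y (y tau * (2%:R * A tau + piC R ^+ 2 * x tau) / ipi R) &
      is_derive tau 1 A ((A tau ^+ 2 - piC R ^+ 4 * x tau * y tau / 4%:R) / ipi R)].

(* Gronwall for the squared distance of the two solutions along the segment [a, b]. *)
Lemma halphen_unique (x y A x' y' A' : C -> C) (a b : C) :
  halphen x y A -> halphen x' y' A' -> 0 < imC a -> 0 < imC b ->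
  x a = x' a -> y a = y' a -> A a = A' a -> x b = x' b /\ y b = y' b.
Proof.
move=> h h' a0 b0 xa ya Aa; pose d := b - a; pose g (r : R) := a + ofR r * d.
have g0 : g 0 = a by rewrite /g ofR0 mul0r addr0.
have g1 : g 1 = b by rewrite /g ofR1 mul1r addrC subrK.
have gH r : 0 <= r <= 1 -> 0 < imC (g r).
  move=> /andP[r0 r1]; rewrite imCD imC_ofRM imCB.
  rewrite (_ : _ + _ = (1 - r) * imC a + r * imC b); last by ring.
  have [->|rn] := eqVneq r 0; first by rewrite subr0 mul1r mul0r addr0.
  have rp : 0 < r by rewrite lt_def rn.
  by rewrite ltr_wpDl ?(mulr_gt0 rp b0)// mulr_ge0 ?subr_ge0// ltW.
pose bounded F := exists2 M : R, 0 <= M & forall r, 0 <= r <= 1 -> normR (F (g r)) <= M.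
have bd (F l : C -> C) : (forall tau, 0 < imC tau -> is_derive tau 1 F (l tau)) -> bounded F.
  by move=> hF; apply: (path_bound (l := l)) => r /gH; exact: hF.
pose lx (X Y B : C -> C) t := X t * (2%:R * B t + piC R ^+ 2 * Y t) / ipi R.
pose lA (X Y B : C -> C) t := (B t ^+ 2 - piC R ^+ 4 * X t * Y t / 4%:R) / ipi R.
have [Mx pMx hMx] : bounded x by apply: (bd x (lx x y A)) => t /h[].
have [My pMy hMy] : bounded y by apply: (bd y (lx y x A)) => t /h[].
have [MA pMA hMA] : bounded A by apply: (bd A (lA x y A)) => t /h[].
have [Mx' pMx' hMx'] : bounded x' by apply: (bd x' (lx x' y' A')) => t /h'[].
have [My' pMy' hMy'] : bounded y' by apply: (bd y' (lx y' x' A')) => t /h'[].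
have [MA' pMA' hMA'] : bounded A' by apply: (bd A' (lA x' y' A')) => t /h'[].
pose u r := normR (x (g r) - x' (g r)); pose v r := normR (y (g r) - y' (g r)).
pose w r := normR (A (g r) - A' (g r)).
pose q := normR (piC R); pose i := normR (ipi R)^-1.
pose Mt := Mx + My + MA + Mx' + My' + MA'.
have Mt0 : 0 <= Mt by rewrite !addr_ge0.
have hdx (p p' q0 q0' B B' : C) (U V W : R) : normR p' <= Mt -> normR B <= Mt -> normR q0 <= Mt ->
  normR (p - p') = U -> normR (q0 - q0') = V -> normR (B - B') = W ->
  normR (p * (2%:R * B + piC R ^+ 2 * q0) / ipi R - p' * (2%:R * B' + piC R ^+ 2 * q0') / ipi R)
     <= (U * (2%:R * Mt + q ^+ 2 * Mt) + Mt * (2%:R * W + q ^+ 2 * V)) * i.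
  move=> hp' hB hq hU hV hW; rewrite -mulrBl; apply: normRM_le => //.
  rewrite (_ : _ - _ = (p - p') * (2%:R * B + piC R ^+ 2 * q0) + p' * (2%:R * (B - B') + piC R ^+ 2 * (q0 - q0'))).
    apply: normRD_le; apply: normRM_le; rewrite ?hU//; apply: normRD_le; apply: normRM_le;
      by rewrite ?normR_nat ?normRX ?hV ?hW.
  by ring.
have hdA (p p' q0 q0' B B' : C) (U V W : R) : normR p' <= Mt -> normR B <= Mt -> normR B' <= Mt -> normR q0 <= Mt ->
  normR (p - p') = U -> normR (q0 - q0') = V -> normR (B - B') = W ->
  normR ((B ^+ 2 - piC R ^+ 4 * p * q0 / 4%:R) / ipi R - (B' ^+ 2 - piC R ^+ 4 * p' * q0' / 4%:R) / ipi R)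
     <= (W * (Mt + Mt) + (q ^+ 4 / 4%:R) * (U * Mt + Mt * V)) * i.
  move=> hp' hB hB' hq hU hV hW; rewrite -mulrBl; apply: normRM_le => //.
  rewrite (_ : _ - _ = (B - B') * (B + B') + - ((piC R ^+ 4 / 4%:R) * ((p - p') * q0 + p' * (q0 - q0')))).
    apply: normRD_le; [|rewrite normRN]; apply: normRM_le; rewrite ?hW//; [exact: normRD_le| |].
      by rewrite normRM normRV normRX normR_nat.
    by apply: normRD_le; apply: normRM_le; rewrite ?hU ?hV.
  by field.
pose k := i * Mt * (2%:R + q ^+ 2 + q ^+ 4); pose D := normR d.
have i0 : 0 <= i by exact: normR_ge0.
have D0 : 0 <= D by exact: normR_ge0.
have q2 : 0 <= q ^+ 2 by exact: sqr_ge0.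
have q4 : 0 <= q ^+ 4 by rewrite exprn_ge0// normR_ge0.
have k0 : 0 <= k by rewrite !mulr_ge0// !addr_ge0.
pose N r := u r ^+ 2 + v r ^+ 2 + w r ^+ 2.
pose dN r := 2%:R * dotC (x (g r) - x' (g r)) ((lx x y A (g r) - lx x' y' A' (g r)) * d)
  + 2%:R * dotC (y (g r) - y' (g r)) ((lx y x A (g r) - lx y' x' A' (g r)) * d)
  + 2%:R * dotC (A (g r) - A' (g r)) ((lA x y A (g r) - lA x' y' A' (g r)) * d).
have hN (r : R) : 0 <= r <= 1 -> is_derive r 1 N (dN r).
  move=> /gH gr; have [e1 e2 e3] := h _ gr; have [e1' e2' e3'] := h' _ gr.
  apply: isdD; first apply: isdD.
  - exact: path_derive_sqn (isdB e1 e1').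
  - exact: path_derive_sqn (isdB e2 e2').
  - exact: path_derive_sqn (isdB e3 e3').
have N0 : N 0 = 0 by rewrite /N /u /v /w g0 xa ya Aa !subrr normR0 expr0n !addr0.
have := gronwall0 (K := 6%:R * k * D) hN _ N0; rewrite /N /u /v /w g1 => hN1.
have {hN1} : normR (x b - x' b) ^+ 2 + normR (y b - y' b) ^+ 2 + normR (A b - A' b) ^+ 2 <= 0.
  apply: hN1 => r hr.
  have bx : normR (x (g r)) <= Mt by have := hMx _ hr; rewrite /Mt; lra.
  have bx' : normR (x' (g r)) <= Mt by have := hMx' _ hr; rewrite /Mt; lra.
  have by_ : normR (y (g r)) <= Mt by have := hMy _ hr; rewrite /Mt; lra.
  have by' : normR (y' (g r)) <= Mt by have := hMy' _ hr; rewrite /Mt; lra.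
  have bA : normR (A (g r)) <= Mt by have := hMA _ hr; rewrite /Mt; lra.
  have bA' : normR (A' (g r)) <= Mt by have := hMA' _ hr; rewrite /Mt; lra.
  have u0 : 0 <= u r by exact: normR_ge0.
  have v0 : 0 <= v r by exact: normR_ge0.
  have w0 : 0 <= w r by exact: normR_ge0.
  pose S := u r + v r + w r.
  have S0 : 0 <= S by rewrite !addr_ge0.
  have kx (U V : R) : 0 <= U -> 0 <= V -> U + V + w r = S ->
      (U * (2%:R * Mt + q ^+ 2 * Mt) + Mt * (2%:R * w r + q ^+ 2 * V)) * i <= k * S.
    move=> U0 V0 <-.
    rewrite [leLHS](_ : _ = i * Mt * (U * (2 + q ^+ 2) + (2 * w r + q ^+ 2 * V))); last by ring.
    rewrite /k -[leRHS]mulrA ler_wpM2l ?mulr_ge0//.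
    have := mulr_ge0 q4 U0; have := mulr_ge0 q4 V0; have := mulr_ge0 q4 w0.
    have := mulr_ge0 q2 U0; have := mulr_ge0 q2 V0; have := mulr_ge0 q2 w0; lra.
  have kA : (w r * (Mt + Mt) + (q ^+ 4 / 4%:R) * (u r * Mt + Mt * v r)) * i <= k * S.
    rewrite [leLHS](_ : _ = i * Mt * (2 * w r + (q ^+ 4 / 4%:R) * (u r + v r))); last by ring.
    rewrite /k -[leRHS]mulrA ler_wpM2l ?mulr_ge0// /S.
    have := mulr_ge0 q4 u0; have := mulr_ge0 q4 v0; have := mulr_ge0 q4 w0.
    have := mulr_ge0 q2 u0; have := mulr_ge0 q2 v0; have := mulr_ge0 q2 w0; lra.
  have dotS (z l : C) : normR l <= k * S -> 2%:R * dotC z (l * d) <= 2%:R * (normR z * (k * S * D)).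
    move=> hl; rewrite ler_wpM2l// (le_trans (dotC_le _ _))// ler_wpM2l ?normR_ge0//.
    exact: normRM_le.
  have sx : normR (lx x y A (g r) - lx x' y' A' (g r)) <= k * S.
    by apply: le_trans (hdx _ _ _ _ _ _ (u r) (v r) (w r) _ _ _ _ _ _) (kx _ _ _ _ _).
  have sy : normR (lx y x A (g r) - lx y' x' A' (g r)) <= k * S.
    apply: le_trans (hdx _ _ _ _ _ _ (v r) (u r) (w r) _ _ _ _ _ _) (kx _ _ _ _ _) => //.
    by rewrite /S [v r + _]addrC.
  have sA : normR (lA x y A (g r) - lA x' y' A' (g r)) <= k * S.
    by apply: le_trans (hdA _ _ _ _ _ _ (u r) (v r) (w r) _ _ _ _ _ _ _) kA.
  apply: le_trans (lerD (lerD (dotS (x (g r) - x' (g r)) _ sx) (dotS (y (g r) - y' (g r)) _ sy))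
    (dotS (A (g r) - A' (g r)) _ sA)) _.
  rewrite -/(u r) -/(v r) -/(w r).
  rewrite [leLHS](_ : _ = 2 * (k * D) * S ^+ 2); last by rewrite /S; ring.
  rewrite [leRHS](_ : _ = 2 * (k * D) * (3 * (u r ^+ 2 + v r ^+ 2 + w r ^+ 2))); last by ring.
  have kD : 0 <= 2 * (k * D) by rewrite mulr_ge0// (mulr_ge0 k0 D0).
  rewrite (ler_wpM2l kD)// /S.
  exact: sqr_sum3_le.
have := sqr_ge0 (normR (x b - x' b)); have := sqr_ge0 (normR (y b - y' b)); have := sqr_ge0 (normR (A b - A' b)).
move=> h1 h2 h3 h4.
by split; apply/eqP; rewrite -subr_eq0 -normR_eq0 -sqrf_eq0; apply/eqP; lra.
Qed.
End Uniqueness.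

(** * Modularity under Gamma(2) *)

Section Modular.
Variable R : realType.
Local Notation C := (Cplx R).
Local Notation x := (@xfun R).
Local Notation y := (@yfun R).
Local Notation A := (@Afun R).
Local Notation ipi := (ipi R).

Lemma imC_gt0_neq0 (tau : C) : 0 < imC tau -> tau != 0.
Proof. by apply: contraTN => /eqP->; rewrite -ofR0 imC_ofR ltxx. Qed.

Lemma CplxV (w : C) : w != 0 -> w^-1 = ofR (normR w ^+ 2)^-1 * (ofR (reC w) - 'i * ofR (imC w)).
Proof.
move=> w0; have n0 : ofR (normR w ^+ 2) != 0 :> C.
  by rewrite -ofR0 (inj_eq (@ofR_inj _)) expf_neq0// normR_eq0.
apply: (mulfI w0); rewrite divff// {1}[w]Cplx_dec ofRV mulrCA; apply: (mulfI n0).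
rewrite mulr1 mulVKf// sqr_normR ofRD !ofRX.
transitivity (ofR (reC w) ^+ 2 - ('i * 'i) * ofR (imC w) ^+ 2 : C); last by ring.
by rewrite iC2 mulN1r opprK.
Qed.

Lemma reCV (w : C) : w != 0 -> reC w^-1 = reC w / normR w ^+ 2.
Proof.
move=> w0; rewrite CplxV// reC_ofRM reCB reC_ofR mulrC; congr (_ * _).
by rewrite reCM reCi mul0r imC_ofR mulr0 !subr0.
Qed.
Lemma imCV (w : C) : w != 0 -> imC w^-1 = - imC w / normR w ^+ 2.
Proof.
move=> w0; rewrite CplxV// imC_ofRM imCB imC_ofR mulrC; congr (_ * _).
by rewrite imCM reCi mul0r imCi reC_ofR mul1r !add0r.
Qed.

Lemma reC_int (k : int) : reC (k%:~R : C) = k%:~R. Proof. by rewrite -ofR_int reC_ofR. Qed.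
Lemma imC_int (k : int) : imC (k%:~R : C) = 0. Proof. by rewrite -ofR_int imC_ofR. Qed.
Lemma reC_intM (k : int) (z : C) : reC (k%:~R * z) = k%:~R * reC z.
Proof. by rewrite -ofR_int reC_ofRM. Qed.
Lemma imC_intM (k : int) (z : C) : imC (k%:~R * z) = k%:~R * imC z.
Proof. by rewrite -ofR_int imC_ofRM. Qed.

Lemma mob_den_neq0 (a b c d : int) (tau : C) : a * d - b * c = 1 -> 0 < imC tau ->
  c%:~R * tau + d%:~R != 0.
Proof.
move=> hdet t0; apply/eqP => e; have ei := congr1 (@imC R) e; have er := congr1 (@reC R) e.
move: ei er; rewrite imCD imC_intM imC_int addr0 reCD reC_intM reC_int.
move=> /eqP; rewrite -ofR0 imC_ofR mulf_eq0 (gt_eqF t0) orbF intr_eq0 => /eqP c0.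
rewrite c0 mul0r add0r reC_ofR => /eqP; rewrite intr_eq0 => /eqP d0.
by move: hdet; rewrite c0 d0 !mulr0.
Qed.

Lemma imC_mob (a b c d : int) (tau : C) : a * d - b * c = 1 -> 0 < imC tau ->
  0 < imC ((a%:~R * tau + b%:~R) / (c%:~R * tau + d%:~R)).
Proof.
move=> hdet t0; have w0 := mob_den_neq0 hdet t0; rewrite imCM imCV// reCV//.
have n0 : 0 < normR (c%:~R * tau + d%:~R) ^+ 2 by rewrite exprn_gt0// normR_gt0.
rewrite !mulrA -mulrDl divr_gt0// !(imCD, reCD) !(reC_intM, imC_intM) !(reC_int, imC_int).
rewrite (_ : _ + _ = (a * d - b * c)%:~R * imC tau); first by rewrite hdet mul1r.
by rewrite intrB !intrM; ring.
Qed.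

Lemma imC_Sinv (tau : C) : 0 < imC tau -> 0 < imC (- tau^-1).
Proof.
move=> t0; rewrite imCN imCV ?imC_gt0_neq0// mulNr opprK divr_gt0// exprn_gt0// normR_gt0 imC_gt0_neq0 //.
Qed.

Lemma halphen_theta : halphen x y A.
Proof. by move=> t t0; split; [exact: xfun_der|exact: yfun_der|exact: Afun_der]. Qed.

Lemma isd_S (F : C -> C) (tau l : C) : 0 < imC tau -> is_derive (- tau^-1) 1 F l ->
  is_derive tau 1 (fun t => F (- t^-1)) (l / tau ^+ 2).
Proof.
move=> t0 hF; have n0 := imC_gt0_neq0 t0.
have h := isdN (isdV n0 (isd_id tau)).
have := isd_comp (f := F) h hF; rewrite -mulNr opprK mul1r; exact.
Qed.

Lemma halphen_S : halphen (fun t => y (- t^-1) / t ^+ 2) (fun t => x (- t^-1) / t ^+ 2)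
   (fun t => A (- t^-1) / t ^+ 2 - ipi / t).
Proof.
move=> t t0; have n0 := imC_gt0_neq0 t0; have s0 := imC_Sinv t0; have i0 := ipi_neq0 R.
have t20 : t ^+ 2 != 0 by rewrite expf_neq0.
have hv := isdV n0 (isd_id t).
have hv2 := isdV (f := fun t : C => t ^+ 2) t20 (isdX 2 (isd_id t)).
split.
- have h := isdM (isd_S t0 (yfun_der s0)) hv2.
  apply: is_derive_eq h _; rewrite expr1; field; rewrite i0 n0 //.
- have h := isdM (isd_S t0 (xfun_der s0)) hv2.
  apply: is_derive_eq h _; rewrite expr1; field; rewrite i0 n0 //.
- have h := isdB (isdM (isd_S t0 (Afun_der s0)) hv2) (isdMl ipi hv).
  apply: is_derive_eq h _; rewrite expr1; field; rewrite i0 n0 //.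
Qed.

Lemma xyfun_S (tau : C) : 0 < imC tau ->
  x (- tau^-1) = tau ^+ 2 * y tau /\ y (- tau^-1) = tau ^+ 2 * x tau.
Proof.
move=> t0; have t2 : tau ^+ 2 != 0 by rewrite expf_neq0// imC_gt0_neq0.
have i1 : 0 < imC ('i : C) by rewrite imCi.
have iS : - ('i : C)^-1 = 'i.
  by rewrite -[- _]mul1r -[1]opprK -iC2 mulrNN -mulrA divff ?mulr1// imC_gt0_neq0.
have i2 : ('i : C) ^+ 2 = - 1 by rewrite expr2 iC2.
have [] := halphen_unique halphen_theta halphen_S i1 t0.
- by rewrite iS i2 invrN invr1 mulrN1 xfun_i.
- by rewrite iS i2 invrN invr1 mulrN1 xfun_i opprK.
- rewrite iS i2 invrN invr1 mulrN1 ipiE mulfK ?imC_gt0_neq0//.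
  by rewrite Afun_i /Defs.piC ofRM ofRV ofR_nat; field.
by move=> -> ->; split; field; rewrite imC_gt0_neq0.
Qed.

Lemma xyfun_T (k : int) (tau : C) : 0 < imC tau ->
  x (tau + (2%:R * k)%:~R) = x tau /\ y (tau + (2%:R * k)%:~R) = y tau.
Proof.
have hn (n : nat) (t : C) : 0 < imC t ->
    x (t + (2 * n)%N%:R) = x t /\ y (t + (2 * n)%N%:R) = y t.
  elim: n t => [|n IH] t t0; first by rewrite muln0 addr0.
  rewrite mulnS natrD addrA; have t0' : 0 < imC (t + 2%:R) by rewrite imCD imC_nat addr0.
  by have [-> ->] := IH _ t0'; rewrite xfun_shift2 ?yfun_shift2.
have E (n : nat) : (2%:R * n%:Z)%:~R = (2 * n)%N%:R :> C by rewrite intrM natrM.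
move=> t0; case: k => n; first by rewrite E; exact: hn.
have t1 : 0 < imC (tau + (2%:R * Negz n)%:~R) by rewrite imCD imC_int addr0.
have [e1 e2] := hn n.+1 _ t1; rewrite -e1 -e2 -addrA.
have -> : (2%:R * Negz n)%:~R + (2 * n.+1)%N%:R = 0 :> C by rewrite NegzE mulrN intrN E addNr.
by rewrite addr0.
Qed.

(* tau / (1 - 2 k tau) is S^-1 T^(2k) S tau, with S tau = - 1 / tau. *)
Lemma xyfun_V (k : int) (tau : C) : 0 < imC tau ->
  let w := 1 - (2%:R * k)%:~R * tau in
  [/\ w != 0, 0 < imC (tau / w), x (tau / w) = w ^+ 2 * x tau & y (tau / w) = w ^+ 2 * y tau].
Proof.
move=> t0 w; have hd : 1 * 1 - 0 * (- (2%:R * k)) = 1 :> int by rewrite mul0r subr0.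
have n0 := imC_gt0_neq0 t0.
have hw : w = (- (2%:R * k))%:~R * tau + 1%:~R by rewrite /w intrN mulNr addrC.
have w0 : w != 0 by rewrite hw; exact: mob_den_neq0 hd t0.
have im0 : 0 < imC (tau / w).
  by have := imC_mob hd t0; rewrite -hw /= mulr0z addr0 mul1r.
have s0 := imC_Sinv t0; pose s := - tau^-1 + (2%:R * k)%:~R.
have s1 : 0 < imC s by rewrite imCD imC_int addr0.
have -> : tau / w = - s^-1.
  have -> : s = - (w / tau) by rewrite /s /w; field.
  by rewrite invrN opprK invf_div.
have [xs ys] := xyfun_S s1; have [xt yt] := xyfun_T k s0; have [x1 y1] := xyfun_S t0.
split; rewrite ?imC_Sinv// ?xs ?ys -/s ?xt ?yt ?x1 ?y1 /s /w; by field.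
Qed.

Definition weight2 (f : C -> C) (a b c d : int) := forall tau, 0 < imC tau ->
  f ((a%:~R * tau + b%:~R) / (c%:~R * tau + d%:~R)) = (c%:~R * tau + d%:~R) ^+ 2 * f tau.

(* Descent on |c| + |d|: multiplying on the right by tau + 2k changes d by 4 k c, and
   by tau / (2 k tau + 1) changes c by k d; |2c| and |d| differ in parity. *)
Lemma xy_weight2 (a b c d : int) : a * d - (2%:R * b) * (2%:R * c) = 1 ->
  weight2 x a (2%:R * b) (2%:R * c) d /\ weight2 y a (2%:R * b) (2%:R * c) d.
Proof.
have [n] := ubnP (absz c + absz d)%N; elim: n a b c d => // n IH a b c d hn hdet.
have stepT (k : int) : (absz (d + 4 * k * c)%R < absz d)%N ->
   weight2 x a (2%:R * b) (2%:R * c) d /\ weight2 y a (2%:R * b) (2%:R * c) d.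
  move=> hk; have hdet' : a * (d + 4 * k * c) - (2%:R * (b + k * a)) * (2%:R * c) = 1 by rewrite -[RHS]hdet; ring.
  have [|hx hy] := IH _ _ _ _ _ hdet'; first by lia.
  suff h f : (forall tau, 0 < imC tau -> f (tau + (2%:R * k)%:~R) = f tau) ->
      weight2 f a (2%:R * (b + k * a)) (2%:R * c) (d + 4 * k * c) -> weight2 f a (2%:R * b) (2%:R * c) d.
    by split; [apply: h hx|apply: h hy] => t /(xyfun_T k)[].
  move=> hf hw tau t0; have t1 : 0 < imC (tau - (2%:R * k)%:~R) by rewrite imCB imC_int subr0.
  have := hw _ t1; rewrite -(hf _ t1) subrK.
  have -> : a%:~R * (tau - (2%:R * k)%:~R) + (2%:R * (b + k * a))%:~R = a%:~R * tau + (2%:R * b)%:~R.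
    by rewrite !(intrM, intrD); ring.
  have -> // : (2%:R * c)%:~R * (tau - (2%:R * k)%:~R) + (d + 4%:R * k * c)%:~R = (2%:R * c)%:~R * tau + d%:~R.
  by rewrite !(intrM, intrD); ring.
have stepV (k : int) : (absz (c + k * d)%R < absz c)%N ->
   weight2 x a (2%:R * b) (2%:R * c) d /\ weight2 y a (2%:R * b) (2%:R * c) d.
  move=> hk; have hdet' : (a + 4 * k * b) * d - (2%:R * b) * (2%:R * (c + k * d)) = 1 by rewrite -[RHS]hdet; ring.
  have [|hx hy] := IH _ _ _ _ _ hdet'; first by lia.
  suff h f : (forall tau, 0 < imC tau -> let w := 1 - (2%:R * k)%:~R * tau in
                f (tau / w) = w ^+ 2 * f tau) ->
      weight2 f (a + 4 * k * b) (2%:R * b) (2%:R * (c + k * d)) d -> weight2 f a (2%:R * b) (2%:R * c) d.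
    by split; [apply: h hx|apply: h hy] => t /(xyfun_V k)[].
  move=> hf hw tau t0; have [w0 t1 _ _] := xyfun_V k t0.
  have := hw _ t1; rewrite (hf _ t0); move: w0; set w := 1 - _ => w0.
  pose D := (2%:R * c)%:~R * tau + d%:~R; have D0 : D != 0 := mob_den_neq0 hdet t0.
  rewrite -/D.
  have -> : (2%:R * (c + k * d))%:~R * (tau / w) + d%:~R = D / w.
    by apply: (mulIf w0); rewrite mulrDl -[_ * (tau / w) * w]mulrA !divfK// /D /w !(intrM, intrD); ring.
  have -> : (a + 4%:R * k * b)%:~R * (tau / w) + (2%:R * b)%:~R = (a%:~R * tau + (2%:R * b)%:~R) / w.
    by apply: (mulIf w0); rewrite mulrDl -[_ * (tau / w) * w]mulrA !divfK// /w !(intrM, intrD); ring.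
  by rewrite invf_div mulrA divfK// => ->; field.
have [c0|c0] := eqVneq c 0.
  have had : (a = 1 /\ d = 1) \/ (a = -1 /\ d = -1).
    move: hdet; rewrite c0 !mulr0 subr0 => h1.
    have : (absz a * absz d = 1)%N by rewrite -abszM h1.
    move=> /eqP; rewrite muln_eq1 => /andP[/eqP ea /eqP ed].
    by move: h1 ea ed; case: (intP a) => [|?|?] ; lia.
  have hf (f : C -> C) : (forall (k : int) tau, 0 < imC tau -> f (tau + (2%:R * k)%:~R) = f tau) ->
     weight2 f a (2%:R * b) (2%:R * c) d.
    move=> hf tau t0; rewrite c0 mulr0 mul0r add0r; case: had => -[-> ->].
      by rewrite divr1 mul1r expr1n mul1r hf.
    by rewrite intrN sqrrN expr1n mul1r invrN invr1 mulrN1 opprD mulN1r opprK -intrN -mulrN hf.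
  by split; apply: hf => k t /(xyfun_T k)[].
have [h1|h1] := ltnP (2 * absz c)%N (absz d).
  have [h2|h2] : (absz (d + 4 * 1 * c)%R < absz d)%N \/ (absz (d + 4 * (-1) * c)%R < absz d)%N by lia.
    exact: stepT h2.
  exact: stepT h2.
have hd : (2 * absz c != absz d)%N.
  apply/eqP => e.
  have e2 : d = 2 * c \/ d = - (2 * c) by lia.
  by case: e2 hdet => ->; lia.
have d0 : d != 0 by apply/eqP => d0; move: hdet; rewrite d0; lia.
have [h2|h2] : (absz (c + 1 * d)%R < absz c)%N \/ (absz (c + (-1) * d)%R < absz c)%N by lia.
  exact: stepV h2.
exact: stepV h2.
Qed.

Lemma Gamma2_weight2 (g : 'M[int]_2) : Gamma2 g ->
  [/\ weight2 x (g 0 0) (g 0 1) (g 1 0) (g 1 1), weight2 y (g 0 0) (g 0 1) (g 1 0) (g 1 1) &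
  g 0 0 * g 1 1 - g 0 1 * g 1 0 = 1].
Proof.
move=> [hd hm]; have {}hd : g 0 0 * g 1 1 - g 0 1 * g 1 0 = 1 by rewrite -[RHS]hd (expand_det_row _ 0) !big_ord_recl big_ord0 /cofactor !det_mx11 !mxE /= addr0 !expr0 !expr1 mul1r mulN1r mulrN; congr (g _ _ * g _ _ - g _ _ * g _ _); apply/val_inj.
have hb : g 0 1 = 2 * divz (g 0 1) 2.
  have := hm 0%R 1%R; rewrite !mxE /= => /eqP; rewrite mod0z => /eqP h.
  by rewrite {1}(divz_eq (g 0 1) 2) h addr0 mulrC.
have hc : g 1 0 = 2 * divz (g 1 0) 2.
  have := hm 1%R 0%R; rewrite !mxE /= => /eqP; rewrite mod0z => /eqP h.
  by rewrite {1}(divz_eq (g 1 0) 2) h addr0 mulrC.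
have hd' := hd; rewrite hb hc in hd'.
by have [h1 h2] := xy_weight2 hd'; rewrite -hb -hc in h1 h2.
Qed.
End Modular.

(** * The polynomials p_n and the functions f_n *)

Section PolyRec.

Definition next_poly (n : nat) (q p : {poly rat}) : {poly rat} :=
  (n.+1%:R ^+ 2)^-1 *: (n%:R *: ('X * p) - p^`() * ('X ^+ 2 - 'X) - 4%:R^-1 *: ('X * q)).

Fixpoint rec_pair (n : nat) : {poly rat} * {poly rat} :=
  if n is m.+1 then let qp := rec_pair m in (qp.2, next_poly m qp.1 qp.2) else (0, 1).

Definition rec_poly (n : nat) : {poly rat} := (rec_pair n).2.

Lemma prev_rec_poly n : prev_poly rec_poly n = (rec_pair n).1.
Proof. by case: n. Qed.

Lemma rec_poly_unique : unique p_recurrence rec_poly.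
Proof.
have sq (n : nat) : (n.+1%:R ^+ 2 : rat) != 0 by rewrite expf_neq0// pnatr_eq0.
split=> [|p [p0 hp]].
  split=> // n; rewrite /rec_poly /= prev_rec_poly -/(rec_poly n) /next_poly scalerA mulfV// scale1r.
  by ring.
apply/funext => n; suff: rec_poly n = p n /\ prev_poly rec_poly n = prev_poly p n by case.
elim: n => [|n [IH1 IH2]]; first by rewrite p0.
split=> //; apply: (scalerI (sq n)).
transitivity (n%:R *: ('X * p n) - (p n)^`() * ('X ^+ 2 - 'X) - 4%:R^-1 *: ('X * prev_poly p n)).
  by rewrite /rec_poly /= -prev_rec_poly -/(rec_poly n) /next_poly scalerA mulfV// scale1r IH1 IH2.
by apply/eqP; rewrite eq_sym -subr_eq0 -[X in _ == X](hp n); apply/eqP; ring.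
Qed.

Lemma size_rec_poly n : (size (rec_poly n) <= n.+1)%N.
Proof.
suff: (size (rec_pair n).1 <= n)%N && (size (rec_pair n).2 <= n.+1)%N by case/andP.
elim: n => [|n /andP[IH1 IH2]]; first by rewrite size_poly0 size_poly1.
rewrite /= IH2 /= /next_poly (leq_trans (size_scale_leq _ _))//.
have hX (q : {poly rat}) m : (size q <= m)%N -> (size ('X * q)%R <= m.+1)%N.
  by move=> h; rewrite (leq_trans (size_polyMleq _ _))// size_polyX.
rewrite (leq_trans (size_polyD _ _))// geq_max size_polyN; apply/andP; split; last first.
  by rewrite (leq_trans (size_scale_leq _ _))// (leq_trans (hX _ _ IH1)).
rewrite (leq_trans (size_polyD _ _))// geq_max size_polyN; apply/andP; split.
  by rewrite (leq_trans (size_scale_leq _ _))// hX.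
have h3 : (size ('X ^+ 2 - 'X : {poly rat})%R <= 3)%N.
  by rewrite (leq_trans (size_polyD _ _))// geq_max size_polyN size_polyXn size_polyX.
have hd : (size ((rec_pair n).2)^`()%R <= n)%N.
  have [->|p0] := eqVneq (rec_pair n).2 0; first by rewrite deriv0 size_poly0.
  by rewrite -ltnS (leq_trans (lt_size_deriv p0)).
rewrite (leq_trans (size_polyMleq _ _))//.
by have := leq_add hd h3; rewrite addn3; case: (_ + _)%N.
Qed.
End PolyRec.

Section FCoef.
Variable R : realType.
Local Notation C := (Cplx R).
Local Notation x := (@xfun R).
Local Notation y := (@yfun R).
Local Notation A := (@Afun R).
Local Notation u := (@ufun R).
Local Notation ipi := (ipi R).
Local Notation piC := (piC R).
Local Notation f := (@f_coef R rec_poly).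

Lemma isd_horner (p : {poly C}) (t : C) : is_derive t 1 (fun t => p.[t]) (p^`()).[t].
Proof.
elim/poly_ind: p => [|p c IH].
  rewrite deriv0 horner0 (_ : (fun t : C => _) = fun=> 0); first exact: isd_cst.
  by apply/funext => z; rewrite horner0.
rewrite (_ : (fun t : C => _) = fun t => p.[t] * t + c); last first.
  by apply/funext => z; rewrite hornerMXaddC.
rewrite derivMXaddC hornerD hornerMX; have := isdD (isdM IH (isd_id t)) (isd_cst c t).
by rewrite mulr1 addr0 addrC.
Qed.

Definition halphen_rec (F : nat -> C -> C) := exists dF : nat -> C -> C,
  forall n t, 0 < imC t -> is_derive t 1 (F n) (dF n t) /\
   n.+1%:R ^+ 2 * F n.+1 t = ipi * dF n t - 2%:R * n%:R * A t * F n t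
     - piC ^+ 4 * x t * y t / 4%:R * (if n is m.+1 then F m t else 0).

Lemma halphen_rec_unique (F G : nat -> C -> C) : halphen_rec F -> halphen_rec G ->
  (forall t, 0 < imC t -> F 0%N t = G 0%N t) -> forall n t, 0 < imC t -> F n t = G n t.
Proof.
move=> [dF hF] [dG hG] h0 n.
suff: (forall t, 0 < imC t -> F n t = G n t) /\
   (forall t, 0 < imC t -> (if n is m.+1 then F m t else 0) = (if n is m.+1 then G m t else 0)) by case.
elim: n => [|n [IH1 IH2]]; first by [].
split=> // t t0; have [df ef] := hF n _ t0; have [dg eg] := hG n _ t0.
have n2 : (n.+1%:R ^+ 2 : C) != 0 by rewrite expf_neq0// pnatr_eq0.
apply: (mulfI n2); rewrite ef eg IH1// IH2//.
have := isd_eqH t0 IH1 df; case: dg => _ <- [_ <-]; by [].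
Qed.

Lemma ufun_der t : 0 < imC t -> is_derive t 1 u (piC ^+ 2 * x t * (u t - u t ^+ 2) / ipi).
Proof.
move=> t0; have x0 := xfun_neq0 t0; have i0 := ipi_neq0 R.
apply: is_derive_eq (isdM (yfun_der t0) (isdV x0 (xfun_der t0))) _.
by rewrite /ufun; field; rewrite x0 i0.
Qed.

Definition df_coef n t : C :=
  piC ^+ (2 * n) * (n%:R * x t ^+ n * (2%:R * A t + piC ^+ 2 * y t) / ipi * (map_poly ratr (rec_poly n)).[u t]
   + x t ^+ n * ((map_poly ratr (rec_poly n)^`()).[u t] * (piC ^+ 2 * x t * (u t - u t ^+ 2) / ipi))).

Lemma f_coef_der n t : 0 < imC t -> is_derive t 1 (f n) (df_coef n t).
Proof.
move=> t0; have x0 := xfun_neq0 t0; have i0 := ipi_neq0 R.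
rewrite (_ : f n = fun t => piC ^+ (2 * n) * (x t ^+ n * (map_poly ratr (rec_poly n)).[u t])); last first.
  by apply/funext => z; rewrite mulrA.
rewrite /df_coef -deriv_map; apply: isdMl.
have h := isdM (isdX n (xfun_der t0)) (isd_comp (ufun_der t0) (isd_horner (map_poly ratr (rec_poly n)) (u t))).
apply: is_derive_eq h _; congr (_ * _ + _).
case: n => [|n]; first by rewrite !mul0r.
by rewrite /= [x t ^+ n.+1]exprS; field.
Qed.

Definition rat_eval (p : {poly rat}) (v : C) : C := (map_poly ratr p).[v].

Lemma rec_poly_rat_eval (p : nat -> {poly rat}) n (v : C) : p_recurrence p ->
  n.+1%:R ^+ 2 * rat_eval (p n.+1) v =
  n%:R * (v * rat_eval (p n) v) - rat_eval (p n)^`() v * (v ^+ 2 - v)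
   - v * rat_eval (prev_poly p n) v / 4%:R.
Proof.
move=> [_ hr]; have evD q r : rat_eval (q + r) v = rat_eval q v + rat_eval r v by rewrite /rat_eval rmorphD hornerD.
have evN q : rat_eval (- q) v = - rat_eval q v by rewrite /rat_eval rmorphN hornerN.
have evM q r : rat_eval (q * r) v = rat_eval q v * rat_eval r v by rewrite /rat_eval rmorphM hornerM.
have evX : rat_eval 'X v = v by rewrite /rat_eval map_polyX hornerX.
have evZ a q : rat_eval (a *: q) v = ratr a * rat_eval q v by rewrite /rat_eval map_polyZ hornerZ.
have ev0 : rat_eval 0 v = 0 by rewrite /rat_eval rmorph0 horner0.
have := congr1 (fun q => rat_eval q v) (hr n); rewrite ev0 !evD !evN !evZ !evM !evD !evN.
rewrite [rat_eval ('X ^+ 2) v]/rat_eval map_polyXn hornerXn evX.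
have -> : ratr (n.+1%:R ^+ 2) = n.+1%:R ^+ 2 :> C by rewrite -!natrX ratr_nat.
have -> : ratr 4%:R^-1 = 4%:R^-1 :> C by rewrite fmorphV /= ratr_nat.
rewrite ratr_nat => /eqP; rewrite -addrA -addrA addr_eq0 => /eqP ->.
by ring.
Qed.

Lemma f_coef_rec : halphen_rec f.
Proof.
exists df_coef => n t t0; split; first exact: f_coef_der.
have x0 := xfun_neq0 t0; have i0 := ipi_neq0 R.
have [e0 eS] : (forall m, f m t = piC ^+ (2 * m) * x t ^+ m * rat_eval (rec_poly m) (u t)) /\
   n.+1%:R ^+ 2 * f n.+1 t = piC ^+ (2 * n.+1) * x t ^+ n.+1 * (n.+1%:R ^+ 2 * rat_eval (rec_poly n.+1) (u t)).
  by split=> //; rewrite mulrCA.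
rewrite eS (rec_poly_rat_eval _ _ rec_poly_unique.1) /df_coef -!/(rat_eval _ _).
have -> : piC ^+ (2 * n.+1) = piC ^+ (2 * n) * piC ^+ 2 by rewrite mulnS addnC exprD.
have -> : x t ^+ n.+1 = x t ^+ n * x t by rewrite exprSr.
have yE : y t = u t * x t by rewrite /ufun divfK.
set W := (if n is m.+1 then f m t else 0).
have hW : W * (piC ^+ 2 * x t) = piC ^+ (2 * n) * x t ^+ n * rat_eval (prev_poly rec_poly n) (u t).
  rewrite /W; case: n {e0 eS W} => [|n] /=.
    by rewrite /rat_eval rmorph0 horner0 mulr0 mul0r.
  rewrite -[f n t]/(piC ^+ (2 * n) * x t ^+ n * rat_eval (rec_poly n) (u t)).
  by rewrite mulnS [piC ^+ (2 + _)]exprD [x t ^+ n.+1]exprS; ring.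
rewrite e0 yE; have -> : piC ^+ 4 * x t * (u t * x t) / 4%:R * W = piC ^+ 2 * x t * u t / 4%:R * (W * (piC ^+ 2 * x t)).
  by ring.
rewrite hW; move: (rat_eval _ _) (rat_eval _ _) (rat_eval _ _) (piC ^+ (2 * n)) (x t ^+ n) => e1 e2 e3 e4 e5.
by field.
Qed.

Lemma f_coef0 t : f 0 t = 1.
Proof. by rewrite /f_coef muln0 !expr0 !mul1r rmorph1 hornerC. Qed.

Lemma f_coef_sum n t : 0 < imC t ->
  f n t = \sum_(k < n.+1) piC ^+ (2 * n) * (ratr (rec_poly n)`_k * (x t ^+ (n - k) * y t ^+ k)).
Proof.
move=> t0; have x0 := xfun_neq0 t0.
have sz : (size (map_poly (ratr : rat -> C) (rec_poly n)) <= n.+1)%N.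
  exact: leq_trans (size_poly _ _) (size_rec_poly n).
rewrite /f_coef (horner_coef_wide _ sz) mulr_sumr; apply: eq_bigr => k _.
rewrite -mulrA; congr (_ * _); rewrite coef_map /= mulrCA; congr (_ * _).
rewrite /ufun expr_div_n mulrCA mulrC; congr (_ * _).
by rewrite -expfB_cond ?(negPf x0) ?add0n // -ltnS ltn_ord.
Qed.

Lemma imC_rat (r : rat) (h : R) : imC (ratr r + 'i * ofR h : C) = h.
Proof.
have -> : ratr r = ofR (ratr r) :> C by rewrite /ratr ofRM ofRV !ofR_int.
by rewrite imCD imC_ofR add0r imCM imCi reCi imC_ofR reC_ofR mulr0 mul1r add0r.
Qed.

Lemma f_coef_growth n (r : rat) : exists (N : nat) (c : R), \forall h \near 0^'+,
  `|f n (ratr r + 'i * ofR h)| <= ofR (c * (h^-1) ^+ N).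
Proof.
pose B : R := (2 * (1 + pi)) ^+ 4; pose S : R := \sum_(k < n.+1) normR (piC ^+ (2 * n) * ratr (rec_poly n)`_k).
exists (4 * n)%N, (S * B ^+ n); near=> h.
have h0 : 0 < h by near: h; exact: nbhs_right_gt.
have h1 : h < 1 by near: h; exact: nbhs_right_lt.
set t : C := ratr r + _; have ti : imC t = h by exact: imC_rat.
have ht : 0 < imC t < 1 by rewrite ti h0.
have t0 : 0 < imC t by case/andP: ht.
have bx := xfun_bound ht; have by_ := yfun_bound ht; rewrite ti in bx by_.
have hB : (2 * (1 + pi) / h) ^+ 4 = B * h^-1 ^+ 4 by rewrite exprMn.
rewrite hB in bx by_.
rewrite normRE ler_ofR f_coef_sum// [_^-1 ^+ (4 * n)]exprM -mulrA -exprMn /S mulr_suml.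
rewrite (le_trans (normR_sum _ _))// ler_sum// => k _; rewrite mulrA normRM ler_wpM2l ?normR_ge0//.
have kn : (k <= n)%N by rewrite -ltnS.
rewrite -[in leRHS](subnK kn) exprD normRM ler_pM ?normR_ge0// normRX lerXn2r// ?nnegrE ?normR_ge0//.
  exact: le_trans (normR_ge0 _) bx.
exact: le_trans (normR_ge0 _) bx.
Unshelve. all: by end_near. Qed.

Lemma f_coef_modular n : modular_form_Gamma2 (2 * n) (f n).
Proof.
split; last exact: f_coef_growth.
- by move=> t t0; have [] := f_coef_der n t0.
- move=> g t gG t0; have [hx hy hdet] := Gamma2_weight2 R gG; have w0 := mob_den_neq0 hdet t0.
  rewrite /f_coef /ufun hx// hy//; set w := _ + _ in w0 *.
  have -> : w ^+ 2 * y t / (w ^+ 2 * x t) = y t / x t by field; rewrite w0 xfun_neq0.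
  by rewrite exprMn [w ^+ (2 * n)]exprM !mulrA; congr (_ * _ * _); exact: mulrC.
Qed.
End FCoef.

(** * The Taylor coefficients of s *)

Section Moments.
Variable R : realType.
Local Notation C := (Cplx R).
Local Notation x := (@xfun R).
Local Notation y := (@yfun R).
Local Notation A := (@Afun R).
Local Notation ipi := (ipi R).
Local Notation piC := (piC R).

Definition sq_norm (ab : int * int) : nat := absz (ab.1 ^+ 2 + ab.2 ^+ 2)%R.
Definition wt (ab : int * int) : R := (sq_norm ab)%:R.
Definition wt_pow (k : nat) (ab : int * int) : C := ofR (wt ab) ^+ k.

Lemma wt_sq_norm ab : wt ab = (sq_norm ab)%:R. Proof. by []. Qed.
Lemma wt_powE k ab : wt_pow k ab = ofR (wt ab) ^+ k. Proof. by []. Qed.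

Lemma wtE ab : wt ab = w3 R ab.1 + w3 R ab.2.
Proof.
rewrite /wt /sq_norm /w3 -!rmorphXn -rmorphD /= -[RHS]/(_%:~R).
have : 0 <= ab.1 ^+ 2 + ab.2 ^+ 2 by rewrite addr_ge0// sqr_ge0.
by case: (ab.1 ^+ 2 + ab.2 ^+ 2).
Qed.
Lemma wt_ge0 ab : 0 <= wt ab. Proof. exact: ler0n. Qed.

Lemma qe_wt ab (tau : C) : qe (wt ab) tau = (one R ab.1 * qe (w3 R ab.1) tau) * (one R ab.2 * qe (w3 R ab.2) tau).
Proof. by rewrite wtE qeDw /one !mul1r. Qed.

Lemma qsummable_wt_pow k : qsummable wt (wt_pow k).
Proof.
elim: k => [|k IH] tau t0.
  apply: eq_asum (asumM (qsummable3 t0) (qsummable3 t0)) => ab.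
  by rewrite /wt_pow expr0 mul1r qe_wt.
by apply: eq_asum (qsummable_pow wt_ge0 IH t0) => ab; rewrite /wt_pow exprS.
Qed.

Lemma asum_qe_wt (tau : C) : 0 < imC tau -> asum (fun ab => qe (wt ab) tau).
Proof. by move=> t0; apply: eq_asum (qsummable_wt_pow 0 t0) => ab; rewrite /wt_pow expr0 mul1r. Qed.

Definition bessel_coef (k : nat) : C := (- piC ^+ 2) ^+ k / (k`!%:R) ^+ 2.
Definition moment (k : nat) (tau : C) : C := bessel_coef k * qsum wt (wt_pow k) tau.

Lemma moment0 (tau : C) : 0 < imC tau -> moment 0 tau = theta tau ^+ 2.
Proof.
move=> t0; rewrite /moment /bessel_coef expr0 fact0 expr1n divr1 mul1r thetaE// expr2.
rewrite -(tsumM (qsummable3 t0) (qsummable3 t0)); apply: tsum_eq => ab.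
by rewrite /wt_pow expr0 mul1r qe_wt.
Qed.

Lemma bessel_coefS k : k.+1%:R ^+ 2 * bessel_coef k.+1 = ipi * ipi * bessel_coef k.
Proof.
have k0 : k.+1%:R != 0 :> C by rewrite pnatr_eq0.
have f0 : k`!%:R != 0 :> C by rewrite pnatr_eq0 -lt0n fact_gt0.
rewrite ipi2 /bessel_coef factS natrM [(- piC ^+ 2) ^+ k.+1]exprS.
move: (- piC ^+ 2) => v; move: (v ^+ k) (k.+1%:R) k0 (k`!%:R) f0 => u n n0 m m0.
by field; rewrite n0 m0.
Qed.

Lemma moment_der k (tau : C) : 0 < imC tau -> is_derive tau 1 (moment k) (k.+1%:R ^+ 2 * moment k.+1 tau / ipi).
Proof.
move=> t0; have i0 := ipi_neq0 R.
have h := isdMl (bessel_coef k) (qsum_derive wt_ge0 (qsummable_wt_pow k) t0).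
apply: is_derive_eq h _; rewrite -/ipi /moment mulrA -/(wt_pow k) bessel_coefS.
have -> : qsum wt (fun t => ofR (wt t) * wt_pow k t) tau = qsum wt (wt_pow k.+1) tau.
  by apply: tsum_eq => ab; rewrite /wt_pow [_ ^+ k.+1]exprS.
by field.
Qed.

Lemma isd_sum n (F : nat -> C -> C) (dF : nat -> C) (tau : C) :
  (forall k, is_derive tau 1 (F k) (dF k)) ->
  is_derive tau 1 (fun t => \sum_(k < n) F k t) (\sum_(k < n) dF k).
Proof.
move=> h; elim: n => [|n IH].
  rewrite big_ord0 (_ : (fun t : C => _) = fun=> 0); first exact: isd_cst.
  by apply/funext => t; rewrite big_ord0.
rewrite big_ord_recr /= (_ : (fun t : C => _) = fun t => \sum_(k < n) F k t + F n t); last first.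
  by apply/funext => t; rewrite big_ord_recr.
exact: (isdD IH (h n)).
Qed.

(* [gauss_coef a n k] is the coefficient of z^(2(n - k)) in exp (a z^2), and 0 if [n < k]. *)
Definition gauss_coef (a : C) (n k : nat) : C := if (k <= n)%N then expt a (n - k) else 0.
Definition gauss_coef1 (a : C) (n k : nat) : C := if (k < n)%N then expt a (n - k).-1 else 0.

Lemma gauss_coef_mul a n k : (k <= n.+1)%N -> a * gauss_coef a n k = (n.+1%:R - k%:R) * gauss_coef a n.+1 k.
Proof.
rewrite /gauss_coef => kn; rewrite kn; have [h|h] := leqP k n.
  rewrite subSn// -natrB// subSn// /expt factS natrM exprS.
  have f0 : (n - k)`!%:R != 0 :> C by rewrite pnatr_eq0 -lt0n fact_gt0.
  have k0 : (n - k).+1%:R != 0 :> C by rewrite pnatr_eq0.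
  by rewrite invfM; move: (_ .+1%:R) k0 (_ `!%:R) f0 => u u0 v v0; field; rewrite u0 v0.
have -> : k = n.+1 by apply/eqP; rewrite eqn_leq kn.
by rewrite subrr mul0r mulr0.
Qed.

Lemma gauss_coef1_mul a n k : (k <= n.+1)%N -> a * gauss_coef1 a n k = (n%:R - k%:R) * gauss_coef a n k.
Proof.
move=> kn; rewrite /gauss_coef1 /gauss_coef; have [h|h] := ltnP k n.
  rewrite (ltnW h) -natrB ?(ltnW h)//.
  have -> : (n - k)%N = (n - k).-1.+1 by rewrite prednK// subn_gt0.
  move: (n - k).-1 => m; rewrite /= /expt factS natrM exprS.
  have f0 : m`!%:R != 0 :> C by rewrite pnatr_eq0 -lt0n fact_gt0.
  have k0 : m.+1%:R != 0 :> C by rewrite pnatr_eq0.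
  by rewrite invfM; move: (_ .+1%:R) k0 (_ `!%:R) f0 => u u0 v v0; field; rewrite u0 v0.
rewrite mulr0; have [h'|h'] := leqP k n; last by rewrite mulr0.
have -> : k = n by apply/eqP; rewrite eqn_leq h' h.
by rewrite subrr mul0r.
Qed.

Lemma gauss_coef_der n k (tau a' : C) (F : C -> C) : is_derive tau 1 F a' ->
  is_derive tau 1 (fun t => gauss_coef (F t) n k) (a' * gauss_coef1 (F tau) n k).
Proof.
move=> hF; rewrite /gauss_coef /gauss_coef1; case: (ltngtP k n) => [h|h|->]; rewrite ?mulr0; try exact: isd_cst.
  have -> : (n - k)%N = (n - k).-1.+1 by rewrite prednK// subn_gt0.
  move: (n - k).-1 => m /=.
  rewrite /expt (_ : (fun t : C => _) = fun t => (m.+1`!%:R)^-1 * F t ^+ m.+1); last first.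
    by apply/funext => t; rewrite mulrC.
  have k0 : m.+1%:R != 0 :> C by rewrite pnatr_eq0.
  apply: is_derive_eq (isdMl _ (isdX m.+1 hF)) _.
  have f0 : m`!%:R != 0 :> C by rewrite pnatr_eq0 -lt0n fact_gt0.
  by rewrite /= factS natrM; move: (m.+1%:R) k0 (m`!%:R) f0 => u u0 v v0; field; rewrite u0 v0.
rewrite subnn (_ : (fun t : C => _) = fun=> 1); first exact: isd_cst.
by apply/funext => t; rewrite /expt expr0 divr1.
Qed.

Definition gfun (n : nat) (tau : C) : C :=
  (theta tau ^+ 2)^-1 * \sum_(k < n.+2) moment k tau * gauss_coef (- A tau) n k.

Lemma gfun0 (tau : C) : 0 < imC tau -> gfun 0 tau = 1.
Proof.
move=> t0; rewrite /gfun !big_ord_recl big_ord0 /gauss_coef /= /expt expr0 divr1 mulr0 !addr0 mulr1 moment0//.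
by rewrite mulVf// expf_neq0// theta_neq0.
Qed.

Lemma gfun_prev n (tau : C) : (theta tau ^+ 2)^-1 * \sum_(k < n.+2) moment k tau * gauss_coef1 (- A tau) n k
  = if n is m.+1 then gfun m tau else 0.
Proof.
case: n => [|n].
  by rewrite big1 ?mulr0// => k _; rewrite /gauss_coef1 ltn0 mulr0.
rewrite /gfun big_ord_recr /= {2}/gauss_coef1 ltnNge leqnSn mulr0 addr0; congr (_ * _).
apply: eq_bigr => k _; congr (_ * _); rewrite /gauss_coef1 /gauss_coef ltnS; case: leqP => // h.
by rewrite subSn.
Qed.

Lemma gfun_rec : halphen_rec gfun.
Proof.
pose dA t := (A t ^+ 2 - piC ^+ 4 * x t * y t / 4%:R) / ipi.
pose th (t : C) := (theta t ^+ 2)^-1.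
pose S n t := \sum_(k < n.+2) moment k t * gauss_coef (- A t) n k.
pose dS n t := \sum_(k < n.+2) (k.+1%:R ^+ 2 * moment k.+1 t / ipi * gauss_coef (- A t) n k
   + moment k t * (- dA t * gauss_coef1 (- A t) n k)).
exists (fun n t => - (A t / ipi) * th t * S n t + th t * dS n t) => n t t0.
have i0 := ipi_neq0 R; have h0 := theta_neq0 t0.
have hth : is_derive t 1 th (- (A t / ipi) * th t).
  have n0 : theta t ^+ 2 != 0 by rewrite expf_neq0.
  have h := isdV (f := fun t : C => theta t ^+ 2) n0 (isdX 2 (Afun_theta t0)).
  by apply: is_derive_eq h _; rewrite /th expr1; field; rewrite h0 i0.
split.
  have hS : is_derive t 1 (S n) (dS n t).
    apply: (@isd_sum n.+2 (fun k t => moment k t * gauss_coef (- A t) n k)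
      (fun k => k.+1%:R ^+ 2 * moment k.+1 t / ipi * gauss_coef (- A t) n k + moment k t * (- dA t * gauss_coef1 (- A t) n k))) => k.
    exact: isdM (moment_der k t0) (gauss_coef_der _ _ (isdN (Afun_der t0))).
  exact: (isdM hth hS).
pose P := \sum_(k < n.+2) moment k t * gauss_coef1 (- A t) n k.
rewrite -gfun_prev -/(th t) -/P /gfun -/(th t) -/(S n t).
have -> : dS n t = (\sum_(k < n.+3) k%:R ^+ 2 * moment k t * gauss_coef (- A t) n.+1 k) / ipi - dA t * P.
  rewrite /dS big_split /= /P mulr_sumr [\sum_(k < n.+3) _]big_ord_recl /= expr0n /= !mul0r add0r.
  rewrite mulr_suml -sumrN; congr (_ + _); apply: eq_bigr => k _.
    rewrite /bump /= add1n; have -> : gauss_coef (- A t) n.+1 k.+1 = gauss_coef (- A t) n k by rewrite /gauss_coef ltnS subSS.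
    by ring.
  by ring.
have -> : \sum_(k < n.+3) moment k t * gauss_coef (- A t) n.+1 k = \sum_(k < n.+2) moment k t * gauss_coef (- A t) n.+1 k.
  by rewrite big_ord_recr /= {2}/gauss_coef ltnn mulr0 addr0.
have -> : \sum_(k < n.+3) k%:R ^+ 2 * moment k t * gauss_coef (- A t) n.+1 k = \sum_(k < n.+2) k%:R ^+ 2 * moment k t * gauss_coef (- A t) n.+1 k.
  by rewrite big_ord_recr /= {2}/gauss_coef ltnn mulr0 addr0.
have hS : - A t * S n t = \sum_(k < n.+2) moment k t * ((n.+1%:R - k%:R) * gauss_coef (- A t) n.+1 k).
  by rewrite mulr_sumr; apply: eq_bigr => k _; rewrite mulrCA gauss_coef_mul// -ltnS.
have hP : A t ^+ 2 * P = \sum_(k < n.+2) moment k t * ((n%:R - k%:R) * ((n.+1%:R - k%:R) * gauss_coef (- A t) n.+1 k)).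
  rewrite mulr_sumr; apply: eq_bigr => k _; have kn : (k <= n.+1)%N by rewrite -ltnS.
  by rewrite -gauss_coef_mul// [(n%:R - _) * _]mulrCA -gauss_coef1_mul//; ring.
set M2 := \sum_(k < n.+2) k%:R ^+ 2 * _ * _; set M0 := \sum_(k < n.+2) moment k t * gauss_coef _ n.+1 k.
have key : n.+1%:R ^+ 2 * M0 = (2%:R * n%:R + 1) * (- A t * S n t) + M2 - A t ^+ 2 * P.
  rewrite hS hP /M0 /M2 !mulr_sumr -big_split /= -sumrB; apply: eq_bigr => k _.
  by rewrite -natr1; ring.
rewrite mulrCA key /dA; move: (th t) (S n t) => u v; by field.
Qed.

Lemma f_coef_gfun n (tau : C) : 0 < imC tau -> @f_coef R rec_poly n tau = gfun n tau.
Proof.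
apply: halphen_rec_unique; [exact: f_coef_rec|exact: gfun_rec|].
by move=> t t0; rewrite f_coef0 gfun0.
Qed.
End Moments.

(** * Convergence and Fubini *)

Section Series.
Variable R : realType.
Local Notation C := (Cplx R).
Local Notation A := (@Afun R).
Local Notation piC := (piC R).
Local Notation wt := (@wt R).
Local Notation wt_pow := (@wt_pow R).

Variables (z tau : C).
Hypothesis tau_gt0 : 0 < imC tau.

Definition moment_term (u : (int * int) * nat) : C :=
  bessel_coef R u.2 * z ^+ (2 * u.2) * (wt_pow u.2 u.1 * qe (wt u.1) tau).

Lemma normR_bessel_coef k : normR (bessel_coef R k) = (pi ^+ 2) ^+ k / k`!%:R ^+ 2.
Proof.
rewrite /bessel_coef normRM normRV !normRX normRN normRX normR_nat /Defs.piC normR_ofR.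
by rewrite ger0_norm// pi_ge0.
Qed.

Lemma expt_ofR_le (r : R) k : 0 <= r -> r ^+ k / k`!%:R <= expR r.
Proof.
move=> r0; have := expt_bound (ofR r : C) k.+1; rewrite normR_ofR ger0_norm//; apply: le_trans.
rewrite big_nat_recr //= /expt normRM normRV normRX normR_nat normR_ofR ger0_norm// lerDr.
by rewrite sumr_ge0// => i _; exact: normR_ge0.
Qed.

(* X^k / k!^2 with X = pi^2 |z|^2 (a^2 + b^2) is split as ((e w)^k / k!) (D^k / k!)
   where w = a^2 + b^2, e = pi Im tau / 2 and D = pi^2 |z|^2 / e. *)
Lemma asum_moment_term : asum moment_term.
Proof.
have p0 := pi_gt0 R; pose e := pi * imC tau / 2; pose D := pi ^+ 2 * normR z ^+ 2 / e.
have e0 : 0 < e by rewrite /e divr_gt0// mulr_gt0.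
have D0 : 0 <= D by apply: divr_ge0; [rewrite mulr_ge0 ?sqr_ge0|exact: ltW].
have h0 : 0 < imC (ofR (1 / 2) * tau) by rewrite imC_ofRM mulr_gt0.
apply: (asum_pair (g := fun ab => ofR (expR D) * qe (wt ab) (ofR (1 / 2) * tau))).
  exact: asumMl (asum_qe_wt h0).
move=> ab B; have w0 := wt_ge0 R ab.
rewrite normRM normR_ofR ger0_norm ?expR_ge0// normR_qe.
have hb k : normR (moment_term (ab, k)) <= expR (- (pi * wt ab * imC (ofR (1 / 2) * tau))) * normR (expt (ofR D : C) k).
  rewrite /moment_term /= normRM [normR (bessel_coef _ _ * _)]normRM [normR (wt_pow _ _ * _)]normRM normR_qe normR_bessel_coef wt_powE !normRX normR_ofR ger0_norm//.
  rewrite /expt normRM normRV normRX normR_nat normR_ofR ger0_norm//.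
  have h1 := expt_ofR_le k (mulr_ge0 (ltW e0) w0).
  have f0 : k`!%:R != 0 :> R by rewrite pnatr_eq0 -lt0n fact_gt0.
  have -> : (pi ^+ 2) ^+ k / k`!%:R ^+ 2 * normR z ^+ (2 * k) * (wt ab ^+ k * expR (- (pi * wt ab * imC tau)))
     = ((e * wt ab) ^+ k / k`!%:R) * expR (- (pi * wt ab * imC tau)) * (D ^+ k / k`!%:R).
    have -> : (e * wt ab) ^+ k / k`!%:R * expR (- (pi * wt ab * imC tau)) * (D ^+ k / k`!%:R)
       = (e * D) ^+ k * wt ab ^+ k / k`!%:R ^+ 2 * expR (- (pi * wt ab * imC tau)).
      rewrite !exprMn; move: (k`!%:R : R) f0 => m m0; by field.
    have -> : e * D = pi ^+ 2 * normR z ^+ 2 by rewrite /D mulrC divfK// gt_eqF.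
    by rewrite [(pi ^+ 2 * _) ^+ k]exprMn [normR z ^+ (2 * k)]exprM; ring.
  rewrite ler_wpM2r ?divr_ge0 ?exprn_ge0//.
  apply: le_trans (ler_wpM2r (expR_ge0 _) h1) _; rewrite -expRD ler_expR imC_ofRM /e; lra.
apply: le_trans (ler_sum _ (fun k _ => hb k)) _.
rewrite -mulr_sumr mulrC ler_wpM2r ?expR_ge0//.
have := asum_expt (ofR D : C); have := tsum_expt_ofR D => ht ha.
have hh : hasum (fun k => ofR (normR (expt (ofR D : C) k)) : C) (ofR (expR D)).
  apply: eq_hasum (_ : hasum (expt (ofR D : C)) _) => [k|].
    by rewrite /expt normRM normRV normRX normR_nat normR_ofR ger0_norm// ofRM ofRV ofRX ofR_nat.
  by rewrite -ht; exact: asum_tsum.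
exact: (asum_ge0_hasum (fun k => normR_ge0 _) hh).
Qed.

Definition bessel_term (n : nat) : C :=
  besselJ0 (2%:R * piC * ofR (Num.sqrt n%:R) * z) * expC (piC * 'i * n%:R * tau).

Lemma tsum_row ab : tsum (fun k => moment_term (ab, k)) = bessel_term (sq_norm ab).
Proof.
have ha := asum_row ab asum_moment_term.
have hq : qe (wt ab) tau = expC (piC * 'i * (sq_norm ab)%:R * tau) by rewrite qe_expC wt_sq_norm ofR_nat.
have q0 : qe (wt ab) tau != 0 by exact: qe_neq0.
have ha' : asum (fun k => (qe (wt ab) tau)^-1 * moment_term (ab, k)) by exact: asumMl.
have E k : (-1) ^+ k * (2%:R * piC * ofR (Num.sqrt (sq_norm ab)%:R) * z / 2%:R) ^+ (2 * k) / (k`!%:R) ^+ 2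
   = (qe (wt ab) tau)^-1 * moment_term (ab, k).
  rewrite /moment_term /= /bessel_coef wt_powE wt_sq_norm.
  have -> : 2%:R * piC * ofR (Num.sqrt (sq_norm ab)%:R) * z / 2%:R = piC * ofR (Num.sqrt (sq_norm ab)%:R) * z by field.
  rewrite [(_ * z) ^+ (2 * k)]exprMn [(piC * _) ^+ (2 * k)]exprMn.
  rewrite [piC ^+ (2 * k)]exprM [ofR _ ^+ (2 * k)]exprM -[ofR _ ^+ 2]ofRX sqr_sqrtr ?ler0n//.
  rewrite [(- piC ^+ 2) ^+ k]exprNn; rewrite wt_sq_norm in q0.
  by field; rewrite q0 pnatr_eq0 -lt0n fact_gt0.
rewrite /bessel_term /besselJ0 -hq; rewrite (_ : (fun k : nat => _) = (fun k => (qe (wt ab) tau)^-1 * moment_term (ab, k))); last first.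
  by apply/funext => k; exact: E.
rewrite (cvg_lim _ (tsum_nat ha')); last exact: norm_hausdorff.
by rewrite tsumMl// mulrC mulrA mulfV// mul1r.
Qed.

Lemma sq_norm_eq ab n : (sq_norm ab == n) = (ab.1 ^+ 2 + ab.2 ^+ 2 == n%:Z).
Proof.
rewrite /sq_norm; have : 0 <= ab.1 ^+ 2 + ab.2 ^+ 2 by rewrite addr_ge0// sqr_ge0.
by case: (_ + _).
Qed.

Lemma finite_sum_squares n : finite_set [set ab : int * int | ab.1 ^+ 2 + ab.2 ^+ 2 = n%:Z].
Proof.
pose l := [seq i%:Z - n%:Z | i <- iota 0 (2 * n).+1].
apply: (@sub_finite_set _ _ [set` [seq (a, b) | a <- l, b <- l]]); last exact: finite_seq.
have hl (a b : int) : a ^+ 2 + b ^+ 2 = n%:Z -> a \in l.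
  move=> h; have ha : (absz a <= n)%N by nia.
  apply/mapP; exists (absz (a + n%:Z)%R); last by lia.
  by rewrite mem_iota; lia.
case=> a b h; apply/allpairsP; exists (a, b); split; [exact: (hl a b h)| |by []].
by apply: (hl b a); rewrite addrC; exact: h.
Qed.

Lemma s_termE n : s_term z tau n = tsum (fun ab => if sq_norm ab == n then bessel_term (sq_norm ab) else 0).
Proof.
rewrite (hasum_tsum (hasum_finite (A := fset_set [set ab : int * int | ab.1 ^+ 2 + ab.2 ^+ 2 = n%:Z]) _)); last first.
  move=> ab; rewrite in_fset_set; last exact: finite_sum_squares.
  by rewrite sq_norm_eq notin_setE /=; case: eqP.
rewrite big_seq (eq_bigr (fun=> bessel_term n)); last first.
  move=> ab; rewrite in_fset_set ?inE; last exact: finite_sum_squares.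
  by move=> /= h; rewrite -(eqP (_ : sq_norm ab == n)) ?eqxx// sq_norm_eq h.
rewrite -big_seq big_const_seq count_predT iter_addr_0 -mulr_natl /s_term /bessel_term mulrA; congr (_ * _ * _).
Qed.

Lemma s_term_cvg : asum (fun ab => bessel_term (sq_norm ab)) /\ series (s_term z tau) @ \oo --> tsum moment_term.
Proof.
have [hp ->] := tsum_pair asum_moment_term.
have {}hp : asum (fun ab => bessel_term (sq_norm ab)) by apply: eq_asum hp => ab; exact: tsum_row.
split=> //; rewrite (tsum_eq tsum_row) (tsum_fiber sq_norm hp).
have -> : series (s_term z tau) = series (fun n => tsum (fun ab => if sq_norm ab == n then bessel_term (sq_norm ab) else 0)).
  by congr series; apply/funext => n; exact: s_termE.
exact: tsum_nat (asum_fiber sq_norm hp).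
Qed.

Lemma asum_moment : asum (fun k => moment k tau * z ^+ (2 * k)) /\
  tsum moment_term = tsum (fun k => moment k tau * z ^+ (2 * k)).
Proof.
pose sw (u : nat * (int * int)) := (u.2, u.1).
have swi : injective sw by move=> [a b] [c d] [-> ->].
have sws u : (forall v, sw v <> u) -> moment_term u = 0 by case: u => a b /(_ (b, a)).
have ha : asum (fun u => moment_term (sw u)) by exact: asum_inj swi asum_moment_term.
rewrite (tsum_reindex swi sws asum_moment_term); have [h1 ->] := tsum_pair ha.
have E k : tsum (fun ab => moment_term (sw (k, ab))) = moment k tau * z ^+ (2 * k).
  rewrite /moment_term /= tsumMl ?/moment; last exact: qsummable_wt_pow.
  by rewrite mulrAC.
by split; [exact: eq_asum E h1|exact: tsum_eq].
Qed.

Lemma f_coef_series : [/\ cvgn (series (fun n => f_coef rec_poly n tau * z ^+ (2 * n))) &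
  tsum moment_term = theta tau ^+ 2 * expC (A tau * z ^+ 2)
    * limn (series (fun n => f_coef rec_poly n tau * z ^+ (2 * n)))].
Proof.
have [h1 h2] := asum_moment; have [h3 h4] := cauchy_prod h1 (asum_expt (- (A tau * z ^+ 2))).
have th0 : theta tau ^+ 2 != 0 by rewrite expf_neq0// theta_neq0.
have E n : f_coef rec_poly n tau * z ^+ (2 * n) = (theta tau ^+ 2)^-1 *
    \sum_(k < n.+1) moment k tau * z ^+ (2 * k) * expt (- (A tau * z ^+ 2)) (n - k).
  rewrite f_coef_gfun// /gfun big_ord_recr /= {2}/gauss_coef ltnn mulr0 addr0 -mulrA; congr (_ * _).
  rewrite mulr_suml; apply: eq_bigr => k _; have kn : (k <= n)%N by rewrite -ltnS.
  have -> : z ^+ (2 * n) = z ^+ (2 * k) * z ^+ (2 * (n - k)) by rewrite -exprD -mulnDr subnKC.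
  by rewrite /gauss_coef kn -mulNr /expt exprMn -exprM; ring.
have ha := asumMl (theta tau ^+ 2)^-1 h3; have hf := eq_asum (fun n => esym (E n)) ha.
have hc := tsum_nat hf; split; first by apply/cvg_ex; exists (tsum (fun n => f_coef rec_poly n tau * z ^+ (2 * n))).
rewrite (cvg_lim _ hc); last exact: norm_hausdorff.
rewrite (tsum_eq E) tsumMl// -h4 -expCE expCN h2; field.
by rewrite expC_neq0 theta_neq0.
Qed.
End Series.

Theorem theorem1 (R : realType) :
  exists2 p : nat -> {poly rat}, unique p_recurrence p &
    (forall n : nat, modular_form_Gamma2 (2 * n) (@f_coef R p n)) /\
    (forall tau z : Cplx R, upper_half_plane tau ->
       [/\ cvgn (series (s_term z tau)),
           cvgn (series (fun n => f_coef p n tau * z ^+ (2 * n))) &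
           s z tau = theta tau ^+ 2 * expC (Afun tau * z ^+ 2)
             * limn (series (fun n => f_coef p n tau * z ^+ (2 * n)))]).
Proof.
exists rec_poly; first exact: rec_poly_unique.
split=> [n|tau z tau_gt0]; first exact: f_coef_modular.
have [_ hs] := s_term_cvg z tau_gt0; have [hf e] := f_coef_series z tau_gt0.
split; [by apply/cvg_ex; exists (tsum (moment_term z tau)); exact: hs|exact: hf|].
rewrite /s (cvg_lim _ hs); [exact: e|exact: norm_hausdorff].
Qed.
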